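(* Let $N\ge1$ be an integer, $\sigma,\gamma\in(-1,0)$, and suppose $$p>\max\left\{\frac{\sigma}{\gamma},1\right\},\qquad q>\max\left\{\frac{\gamma}{\sigma},1\right\}$$ and $$\frac{N}{2}\ge\max\left\{\frac{(\sigma+1)(pq-1)+p+1}{pq-1},\ \frac{(\gamma+1)(pq-1)+q+1}{pq-1}\right\}.$$ Set $$d_1=\frac{N(pq-1)}{2(p+1)},\quad d_2=\frac{N(pq-1)}{2(q+1)},\quad k_1=\frac{N(pq-1)}{2[(pq-1)(1+\sigma)+p+1]},\quad k_2=\frac{N(pq-1)}{2[(pq-1)(1+\gamma)+q+1]}.$$ Then there exists $\varepsilon>0$ such that for all $$u_0\in C_0(\mathbb{R}^N)\cap L^{d_1}(\mathbb{R}^N),\quad v_0\in C_0(\mathbb{R}^N)\cap L^{d_2}(\mathbb{R}^N),\quad w_i\in C_0(\mathbb{R}^N)\cap L^{k_i}(\mathbb{R}^N)\ (i=1,2)$$ with $$\|u_0\|_{L^{d_1}}+\|v_0\|_{L^{d_2}}+\|w_1\|_{L^{k_1}}+\|w_2\|_{L^{k_2}}\le\varepsilon,$$ the corresponding mild solution $(u,v)$ to $$u_t-\Delta u=|v|^p+t^\sigma w_1(x),\quad v_t-\Delta v=|u|^q+t^\gamma w_2(x)\quad (x\in\mathbb{R}^N,\ t>0),\qquad (u(0,x),v(0,x))=(u_0(x),v_0(x))$$ is global, that is, $(u,v)\in C([0,\infty),C_0(\mathbb{R}^N)\times C_0(\mathbb{R}^N))$.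
   Context: $C_0(\mathbb{R}^N)$ denotes the set of all continuous (real-valued) functions on $\mathbb{R}^N$ decaying to zero at infinity, with the supremum norm. $S(t)=e^{t\Delta}$ is the heat semigroup on $\mathbb{R}^N$. Mild solution: for $T>0$, a pair $(u,v)\in C([0,T],C_0(\mathbb{R}^N)\times C_0(\mathbb{R}^N))$ is a mild solution to the problem (on $[0,T]$) if for all $0\le t\le T$ $$u(t)=S(t)u_0+\int_0^t S(t-s)|v(s)|^p\,ds+\int_0^t s^\sigma S(t-s)w_1\,ds,$$ $$v(t)=S(t)v_0+\int_0^t S(t-s)|u(s)|^q\,ds+\int_0^t s^\gamma S(t-s)w_2\,ds.$$ For data in $C_0(\mathbb{R}^N)$ the mild solution exists, is unique, and extends to a maximal interval $[0,T_{\max})$, where $T_{\max}\in(0,\infty]$ is the supremum of all $\tau>0$ such that a mild solution exists in $C([0,\tau],C_0(\mathbb{R}^N)\times C_0(\mathbb{R}^N))$; the solution is global when $T_{\max}=\infty$. *)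

(* Defs.v *)
From HB Require Import structures.
From mathcomp Require Import all_boot all_order all_algebra.
From mathcomp Require Import all_classical all_reals all_analysis.

Set Implicit Arguments.
Unset Strict Implicit.
Unset Printing Implicit Defensive.

Import Order.TTheory GRing.Theory Num.Theory.
Import numFieldNormedType.Exports.

Local Open Scope classical_set_scope.
Local Open Scope ring_scope.

(* The library has neither a sigma-algebra nor a Lebesgue measure on 'rV[R]_n.
   The sigma-algebra is the one generated by the coordinates, as for
   n.-tuple R. *)
Section measurable_rV.
Context (R : realType) (n : nat).

Let coors : 'I_n -> 'rV[R]_n -> R := fun i x => x ord0 i.

Let rV_set0 : g_sigma_preimage coors set0.
Proof. exact: sigma_algebra0. Qed.

Let rV_setC A : g_sigma_preimage coors A -> g_sigma_preimage coors (~` A).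
Proof. exact: sigma_algebraC. Qed.

Let rV_bigcup (F : _^nat) : (forall i, g_sigma_preimage coors (F i)) ->
  g_sigma_preimage coors (\bigcup_i (F i)).
Proof. exact: sigma_algebra_bigcup. Qed.

HB.instance Definition _ :=
  @isMeasurable.Build (measure_tuple_display default_measure_display)
  'rV[R]_n (g_sigma_preimage coors) rV_set0 rV_setC rV_bigcup.

End measurable_rV.

Lemma measurable_coord (R : realType) n (i : 'I_n) :
  measurable_fun [set: 'rV[R]_n] (fun x : 'rV[R]_n => x ord0 i).
Proof.
move=> _ Y mY; rewrite setTI; apply: sub_sigma_algebra => /=.
rewrite -bigcup_seq/=; exists i => /=; first by rewrite mem_index_enum.
by exists Y => //; rewrite setTI.
Qed.

Lemma measurable_fun_rV d (T : measurableType d) (R : realType) n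
    (f : T -> 'rV[R]_n) :
  (forall i, measurable_fun [set: T] (fun x => f x ord0 i)) ->
  measurable_fun [set: T] f.
Proof.
move=> mf _ Y mY; rewrite setTI.
set D := fun A : set 'rV[R]_n => measurable (f @^-1` A).
suff : @measurable _ 'rV[R]_n `<=` D by exact.
apply: smallest_sub => /=.
  split; rewrite /D/=.
  - by rewrite preimage_set0.
  - move=> A mA; rewrite setTD preimage_setC; exact: measurableC.
  - by move=> A mA; rewrite preimage_bigcup; exact: bigcup_measurable.
move=> A; rewrite -bigcup_seq => -[i _ [B mB <-]]; rewrite /D setTI.
by rewrite -[X in measurable X]setTI; exact: mf.
Qed.

Definition rV_cons (R : realType) n (x : measurableTypeR R * 'rV[R]_n) :
    'rV[R]_n.+1 :=
  \row_i (if unlift ord0 i is Some j then x.2 ord0 j else x.1).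

Definition rV_uncons (R : realType) n (v : 'rV[R]_n.+1) :
    measurableTypeR R * 'rV[R]_n :=
  (v ord0 ord0, \row_j v ord0 (lift ord0 j)).

Lemma rV_consK (R : realType) n : cancel (@rV_cons R n) (@rV_uncons R n).
Proof.
move=> [a v]; congr pair; rewrite ?mxE ?unlift_none//.
by apply/rowP => j; rewrite !mxE liftK.
Qed.

Lemma measurable_rV_cons (R : realType) n : measurable_fun setT (@rV_cons R n).
Proof.
apply: measurable_fun_rV => i.
under eq_fun do rewrite mxE.
case: unliftP => [j|] _; last exact: measurable_fst.
apply: (@measurableT_comp _ _ _ _ _ _ (fun v : 'rV[R]_n => v ord0 j)).
  exact: measurable_coord.
exact: measurable_snd.
Qed.

Lemma measurable_rV_uncons (R : realType) n : measurable_fun setT (@rV_uncons R n).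
Proof.
apply/measurable_fun_pairP; split; first exact: measurable_coord.
apply: measurable_fun_rV => i /=.
under eq_fun do rewrite mxE.
exact: measurable_coord.
Qed.

Section lebesgue_rV_step.
Context (R : realType) (n : nat).
Variable m : {sigma_finite_measure set 'rV[R]_n -> \bar R}.

Definition lebesgue_rVS : set 'rV[R]_n.+1 -> \bar R :=
  pushforward (@lebesgue_measure R \x m)%E (@rV_cons R n).

Let mpre A : measurable A -> measurable (@rV_cons R n @^-1` A).
Proof.
by move=> mA; rewrite -[X in measurable X]setTI; exact: measurable_rV_cons.
Qed.

Let lebesgue_rVS0 : lebesgue_rVS set0 = 0%E.
Proof. by rewrite /lebesgue_rVS /pushforward preimage_set0 measure0. Qed.

Let lebesgue_rVS_ge0 A : (0 <= lebesgue_rVS A)%E.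
Proof. exact: (measure_ge0 (@lebesgue_measure R \x m)%E). Qed.

Let lebesgue_rVS_sigma_additive : semi_sigma_additive lebesgue_rVS.
Proof.
move=> F mF tF mUF; rewrite /lebesgue_rVS /pushforward preimage_bigcup.
apply: measure_semi_sigma_additive.
- by move=> k; exact: mpre.
- apply/trivIsetP => /= i j _ _ ij; rewrite -preimage_setI.
  by move/trivIsetP : tF => /(_ _ _ _ _ ij) ->//; rewrite preimage_set0.
- by rewrite -preimage_bigcup; exact: mpre.
Qed.

HB.instance Definition _ := isMeasure.Build _ _ _ lebesgue_rVS
  lebesgue_rVS0 lebesgue_rVS_ge0 lebesgue_rVS_sigma_additive.

Let lebesgue_rVS_sigma_finite : sigma_finite setT lebesgue_rVS.
Proof.
have /sigma_finiteP[F [TF ndF Foo]] := sigma_finiteT (@lebesgue_measure R).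
have /sigma_finiteP[G [TG ndG Goo]] := sigma_finiteT m.
exists (fun k => @rV_uncons R n @^-1` (F k `*` G k)).
  rewrite -preimage_bigcup (_ : \bigcup_k _ = setT) ?preimage_setT//.
  apply/seteqP; split=> // -[x y] _.
  have [i _ Fix] : (\bigcup_i F i) x by rewrite -TF.
  have [j _ Gjy] : (\bigcup_i G i) y by rewrite -TG.
  exists (maxn i j) => //; split.
  - by move: x Fix; exact/subsetPset/ndF/leq_maxl.
  - by move: y Gjy; exact/subsetPset/ndG/leq_maxr.
move=> k; have [mF Fk] := Foo k; have [mG Gk] := Goo k.
have mFG : measurable (F k `*` G k) by exact: measurableX.
split.
  by rewrite -[X in measurable X]setTI; exact: measurable_rV_uncons.
rewrite /lebesgue_rVS /pushforward -comp_preimage.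
rewrite (_ : _ \o _ = id); last by apply/funext => x; exact: rV_consK.
by rewrite preimage_id product_measure1E// lte_mul_pinfty// ge0_fin_numE.
Qed.

HB.instance Definition _ := Measure_isSigmaFinite.Build _ _ _ lebesgue_rVS
  lebesgue_rVS_sigma_finite.

End lebesgue_rV_step.

Fixpoint lebesgue_rV (R : realType) (n : nat) :
    {sigma_finite_measure set 'rV[R]_n -> \bar R} :=
  if n is k.+1 then lebesgue_rVS (lebesgue_rV R k)
  else \d_(0 : 'rV[R]_0).

Lemma lebesgue_rV_box (R : realType) n (A : 'I_n -> set R) :
  (forall i, measurable (A i)) ->
  lebesgue_rV R n [set x | forall i, A i (x ord0 i)] =
  (\prod_(i < n) lebesgue_measure (A i))%E.
Proof.
elim: n A => [|n IH] A mA.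
  rewrite big_ord0 /= /dirac indicE mem_set// => -[].
  by [].
rewrite big_ord_recl -IH//.
rewrite /= /lebesgue_rVS /pushforward.
rewrite (_ : _ @^-1` _ = A ord0 `*`
    [set x : 'rV[R]_n | forall i, A (lift ord0 i) (x ord0 i)]).
  apply: product_measure1E; first exact: mA.
  rewrite (_ : mkset _ = \bigcap_(i in [set: 'I_n])
     ((fun x : 'rV[R]_n => x ord0 i) @^-1` A (lift ord0 i))); last first.
    by apply/seteqP; split=> [x Ax i _|x Ax i]; exact: Ax.
  apply: fin_bigcap_measurable => [|i _]; first exact: finite_finset.
  by rewrite -[X in measurable X]setTI; exact: measurable_coord.
apply/seteqP; split=> [[a v] Aav|[a v] [Aa Av] i].
  split=> [|i]; first by have := Aav ord0; rewrite mxE unlift_none.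
  by have := Aav (lift ord0 i); rewrite mxE liftK.
by rewrite mxE; case: unliftP => [j|] ->.
Qed.

Section heat.
Context (R : realType) (N : nat).
Implicit Types (f : 'rV[R]_N -> R) (x y : 'rV[R]_N).

Definition sqnorm x : R := \sum_(i < N) x ord0 i ^+ 2.

Definition heat_kernel (t : R) x : R :=
  (4 * pi * t) `^ (- (N%:R / 2)) * expR (- (sqnorm x / (4 * t))).

Definition heat_semigroup (t : R) f : 'rV[R]_N -> R := fun x =>
  if t == 0 then f x else \int[lebesgue_rV R N]_y (heat_kernel t (x - y) * f y).

(* The norm of 'rV[R]_N is the maximum norm. *)
Definition C0 f : Prop :=
  continuous f /\
  forall e, 0 < e -> exists A : R, forall x, A <= `|x| -> `|f x| <= e.

(* On bounded functions, the topology of {uniform _ -> R} is the one of the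
   supremum norm. *)
Definition C0_path (I : set R) (u : R -> 'rV[R]_N -> R) : Prop :=
  (forall t, I t -> C0 (u t)) /\
  {within I, continuous (u : R -> {uniform 'rV[R]_N -> R})}.

End heat.

(* The integrals of C_0-valued functions are taken pointwise in x: evaluation
   at x is a bounded linear form on C_0. *)
Definition mild_equation (R : realType) (N : nat) (p sigma : R)
    (u0 w : 'rV[R]_N -> R) (u v : R -> 'rV[R]_N -> R) (t : R) : Prop :=
  forall x, u t x = heat_semigroup t u0 x
    + \int[lebesgue_measure]_(s in `[0, t])
        heat_semigroup (t - s) (fun y => `|v s y| `^ p) x
    + \int[lebesgue_measure]_(s in `[0, t])
        (s `^ sigma * heat_semigroup (t - s) w x).

Section mild_solution.
Context (R : realType) (N : nat).
Variables (p q sigma gamma : R) (u0 v0 w1 w2 : 'rV[R]_N -> R).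

Definition mild_solution (I : set R) (u v : R -> 'rV[R]_N -> R) : Prop :=
  [/\ C0_path I u, C0_path I v &
      forall t, I t -> mild_equation p sigma u0 w1 u v t /\
                       mild_equation q gamma v0 w2 v u t].

Definition Tmax : \bar R :=
  ereal_sup [set tau%:E | tau in
    [set tau : R | 0 < tau /\ exists u v, mild_solution `[0, tau] u v]].

End mild_solution.

(* Main.v *)
Require Import Defs.
From HB Require Import structures.
From mathcomp Require Import all_boot all_order all_algebra.
From mathcomp Require Import all_classical all_reals all_analysis.
From mathcomp Require Import measurable_realfun ring lra.

Set Implicit Arguments.
Unset Strict Implicit.
Unset Printing Implicit Defensive.

Import Order.TTheory GRing.Theory Num.Theory.
Import numFieldNormedType.Exports.

Local Open Scope classical_set_scope.
Local Open Scope ring_scope.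

(** Write [a = (p + 1) / (pq - 1)] and [b = (q + 1) / (pq - 1)] for the scaling
exponents of [u] and [v]: they solve [p b = a + 1] and [q a = b + 1], the
solution behaves like [t^-a], [t^-b] under parabolic scaling, and with [m = N/2]
the integrability exponents of the data are [d1 = m / a], [d2 = m / b],
[k1 = m / (1 + sigma + a)], [k2 = m / (1 + gamma + b)].  The hypothesis on [N/2]
says that [k1] and [k2] are at least 1.

The solution is the limit of the Picard iterates [(u_n, v_n)] of the mild
equations, started from 0.  Three estimates make them converge on every
[[0, T]].

- A small global bound.  Choose [b1] and [b2] with
  [0 <= b1 < -sigma <= p b2 < 1] and [0 <= b2 < -gamma <= q b1 < 1]; the
  conditions [p > sigma / gamma] and [q > gamma / sigma] are exactly what makes
  room for them ([exists_decay_exponent]).  Put [A = a - b1], [B = b - b2].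
  The smoothing estimate of the heat semigroup ([Lp_le_smoothing]) and
  Minkowski's inequality in time ([Lp_le_duhamel]) show that the
  quantities [sup t^b1 |u_n(t)|] in [L^(m/A)] and [sup t^b2 |v_n(t)|] in
  [L^(m/B)] are controlled by the data and by their own [p]-th and [q]-th
  powers; all powers of [t] balance by scaling.  When the data are small the
  bound [M] reproduces itself ([picard_Lp_le]).

- A sup-norm bound on [[0, T]].  Interpolating [L^rho] between [L^(m/B)] and
  [L^oo], a large [rho] makes the kernel singularity integrable and leaves
  [|u_(n+1)| <= E1 + E2 |v_n|^e] in sup norm, with [e < A / B] because
  [p B - A < 1]; symmetrically [e' < B / A].  As [e e' < 1], the bounds [X^A]
  and [X^B] reproduce themselves once [X] is large ([picard_bounded]).

- Convergence.  On a bounded range [|.|^p] is Lipschitz, so that in the norm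
  weighted by [exp (- lambda t)] the Picard map is a contraction with factor
  1/2 ([picard_cauchy]); the limit solves the mild equations for all times
  ([picard_limit]).

Continuity in time with values in [C_0] is obtained for every term at once.
After the substitutions [y = x + sqrt t z] in space and [s = t r] in time, all
integrals are over a fixed space with a fixed integrable weight, and joint
continuity and decay at infinity pass under the integral by dominated
convergence ([weighted_dominated]). *)

(** * Continuous functions are measurable for the coordinate sigma-algebra *)

Section measurability.
Context (R : realType).

Lemma cvg_rV n (Y : Type) (F : set_system Y) (f : Y -> 'rV[R]_n) (l : 'rV[R]_n) :
  Filter F -> (forall i, f y ord0 i @[y --> F] --> l ord0 i) -> f @ F --> l.
Proof.
move=> FF fl; apply/cvg_ballP => e e0.
have : \forall y \near F, forall i : 'I_n, ball (l ord0 i) e (f y ord0 i).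
  apply: filter_forall => i.
  by move/cvg_ballP : (fl i); exact.
apply: filterS => y H; split => // i j.
by rewrite (ord1 i).
Qed.

Lemma measurable_box n (A : 'I_n -> set R) : (forall i, measurable (A i)) ->
  measurable [set x : 'rV[R]_n | forall i, A i (x ord0 i)].
Proof.
move=> mA; rewrite (_ : mkset _ = \bigcap_(i in [set: 'I_n])
   ((fun x : 'rV[R]_n => x ord0 i) @^-1` A i)); last first.
  by apply/seteqP; split=> [x Ax i _|x Ax i]; exact: Ax.
apply: fin_bigcap_measurable => [|i _]; first exact: finite_finset.
by rewrite -[X in measurable X]setTI; exact: measurable_coord.
Qed.

Definition grid n (k : nat) (m : 'rV[int]_n) : 'rV[R]_n :=
  \row_i ((m ord0 i)%:~R / k.+1%:R).

Definition cell n (k : nat) (x : 'rV[R]_n) : 'rV[int]_n :=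
  \row_i Num.floor (k.+1%:R * x ord0 i).

Lemma grid_cell_cvg n (x : 'rV[R]_n) : grid k (cell k x) @[k --> \oo] --> x.
Proof.
apply: cvg_rV => i.
under eq_fun do rewrite !mxE.
apply/cvgrPdist_le => /= e e0; near=> k.
have k0 : 0 < k.+1%:R :> R by [].
have ke : k.+1%:R^-1 <= e by apply: ltW; near: k; exact: near_infty_natSinv_lt (PosNum e0).
apply: le_trans ke.
have /andP[] := floor_itv (k.+1%:R * x ord0 i).
set f := (Num.floor _)%:~R; rewrite intrD => f1 f2.
rewrite -(ler_pM2l k0) divff ?gt_eqF// -[X in X * _]gtr0_norm// -normrM mulrBr.
rewrite mulrCA divff ?gt_eqF// mulr1 ger0_norm ?subr_ge0//.
rewrite lerBlDl; exact: ltW.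
Unshelve. all: by end_near. Qed.

(** A continuous function is the pointwise limit of its values at the corners
of the cells of finer and finer cubic grids, and each of these step functions
takes countably many values, each on a union of boxes. *)
Lemma continuous_measurable_rV n (f : 'rV[R]_n -> R) : continuous f ->
  measurable_fun setT f.
Proof.
move=> cf.
apply: (@measurable_fun_cvg _ _ _ _ (fun k x => f (grid k (cell k x)))).
  move=> k _ Y mY; rewrite setTI.
  rewrite (_ : _ @^-1` _ = \bigcup_(m : 'rV[int]_n) ([set x | cell k x = m] `&`
     [set _ | Y (f (grid k m))])); last first.
    apply/seteqP; split => [x Yx|x [m _] [/= <-]//].
    by exists (cell k x).
  apply: countable_bigcupT_measurable => [|m]; first exact: countableP.
  have [Ym|Ym] := pselect (Y (f (grid k m))); last first.
    rewrite [X in _ `&` X](_ : _ = set0) ?setI0; last by apply/seteqP; split.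
    exact: measurable0.
  rewrite [X in _ `&` X](_ : _ = setT) ?setIT; last by apply/seteqP; split.
  pose A i : set R := `[(m ord0 i)%:~R / k.+1%:R, (m ord0 i + 1)%:~R / k.+1%:R[%classic.
  rewrite (_ : mkset _ = [set x : 'rV[R]_n | forall i, A i (x ord0 i)]).
    by apply: (@measurable_box _ A) => i; exact: measurable_itv.
  have E (x : 'rV[R]_n) i : (cell k x ord0 i == m ord0 i) =
    ((m ord0 i)%:~R / k.+1%:R <= x ord0 i < (m ord0 i + 1)%:~R / k.+1%:R).
    by rewrite mxE floor_eq ler_pdivrMr// ltr_pdivlMr// [x _ _ * _]mulrC.
  apply/seteqP; split=> x /=.
    by move=> xm i; rewrite /A/= in_itv/= -E xm.
  by move=> H; apply/rowP => i; apply/eqP; rewrite E; have := H i; rewrite /A/= in_itv.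
by move=> x _; apply: continuous_cvg; [exact: cf|exact: grid_cell_cvg].
Qed.

Lemma continuous_measurable_R_rV n (f : measurableTypeR R * 'rV[R]_n -> R) :
  continuous (f : R * 'rV[R]_n -> R) ->
  measurable_fun setT f.
Proof.
move=> cf.
rewrite (_ : f = (f \o @rV_uncons R n) \o @rV_cons R n); last first.
  by apply/funext => x /=; rewrite rV_consK.
apply: measurableT_comp; last exact: measurable_rV_cons.
apply: continuous_measurable_rV => v.
apply: continuous_comp; last exact: cf.
have h1 : (fun w : 'rV[R]_n.+1 => w ord0 ord0) @ v --> v ord0 ord0 by exact: coord_continuous.
have h2 : (fun w : 'rV[R]_n.+1 => \row_j w ord0 (lift ord0 j) : 'rV[R]_n) @ v -->
    (\row_j v ord0 (lift ord0 j) : 'rV[R]_n).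
  apply: (@cvg_rV _ _ (nbhs v)) => i; rewrite mxE; under eq_fun do rewrite mxE.
  exact: coord_continuous.
exact: cvg_pair h1 h2.
Qed.

End measurability.

(** * Affine changes of variables *)

Section change_of_variables.
Context (R : realType).
Local Open Scope ereal_scope.

(** Both sides define measures that agree on half-open intervals. *)
Lemma ge0_integral_affine1 (x c : R) (f : measurableTypeR R -> \bar R) : (0 < c)%R ->
  measurable_fun setT f -> (forall z, 0 <= f z) ->
  \int[lebesgue_measure]_z f z = c%:E * \int[lebesgue_measure]_z f (x + c * z)%R.
Proof.
move=> c0 mf f0.
pose phi (z : measurableTypeR R) : measurableTypeR R := (x + c * z)%R.
have mphi : measurable_fun setT phi.
  by apply: measurable_funD => //; exact: measurable_funM.
have /esym E := ge0_integral_pushforward mphi lebesgue_measure measurableT mf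
  (fun z _ => f0 z).
rewrite preimage_setT in E.
rewrite [X in _ * X]E.
pose m2 := mscale (NngNum (ltW c0)) (pushforward lebesgue_measure phi).
transitivity (\int[m2 mphi]_z f z); last first.
  by rewrite ge0_integral_mscale.
apply: eq_measure_integral => A mA _.
apply: lebesgue_measure_unique => // X [[a b] _ <-].
rewrite -[RHS]/(c%:E * lebesgue_measure (phi @^-1` `]a, b]%classic)).
rewrite [phi @^-1` _](_ : _ = `]((a - x) / c)%R, ((b - x) / c)%R]%classic); last first.
  apply/seteqP; split => z; rewrite /= !in_itv/= /phi.
    by rewrite ltr_pdivrMr// ler_pdivlMr// ltrBlDl lerBrDl [(z * c)%R]mulrC.
  by rewrite ltr_pdivrMr// ler_pdivlMr// ltrBlDl lerBrDl [(z * c)%R]mulrC.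
rewrite !lebesgue_measure_itv/= !lte_fin ltr_pM2r ?invr_gt0// ltrD2r.
case: ifPn => _; last by rewrite mule0.
rewrite -!EFinD -EFinM; congr (_%:E).
by field; rewrite gt_eqF.
Qed.

Lemma ge0_integral_rVS n (f : 'rV[R]_n.+1 -> \bar R) :
  measurable_fun setT f -> (forall z, 0 <= f z) ->
  \int[lebesgue_rV R n.+1]_z f z =
  \int[lebesgue_measure]_a \int[lebesgue_rV R n]_v f (rV_cons (a, v)).
Proof.
move=> mf f0.
have mr := @measurable_rV_cons R n.
rewrite [LHS](ge0_integral_pushforward mr (lebesgue_measure \x lebesgue_rV R n)%E)//.
rewrite preimage_setT fubini_tonelli1//.
  exact: measurableT_comp.
by move=> z; exact: f0.
Qed.

Lemma ge0_integral_affine n (x : 'rV[R]_n) (c : R) (f : 'rV[R]_n -> \bar R) : (0 < c)%R ->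
  measurable_fun setT f -> (forall z, 0 <= f z) ->
  \int[lebesgue_rV R n]_z f z =
  (c ^+ n)%:E * \int[lebesgue_rV R n]_z f (x + c *: z)%R.
Proof.
move=> c0; elim: n x f => [|n IH] x f mf f0.
  rewrite expr0 mul1e; apply: eq_integral => z _; congr f.
  by apply/rowP => -[].
rewrite [LHS]ge0_integral_rVS//.
rewrite ge0_integral_rVS//; last first.
  apply: measurableT_comp => //.
  apply: measurable_fun_rV => i; under eq_fun do rewrite !mxE.
  apply: measurable_funD => //; apply: measurable_funM => //.
  exact: measurable_coord.
have mf2 : measurable_fun setT (fun z : measurableTypeR R * 'rV[R]_n => f (rV_cons z)).
  by apply: measurableT_comp => //; exact: measurable_rV_cons.
pose x' : 'rV[R]_n := (\row_j x ord0 (lift ord0 j))%R.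
rewrite (ge0_integral_affine1 (x ord0 ord0) c0); last 2 first.
- exact: (measurable_fun_fubini_tonelli_F (m2 := lebesgue_rV R n) _ mf2).
- by move=> z; exact: integral_ge0.
have E a : \int[lebesgue_rV R n]_v f (rV_cons (a, v)) =
   (c ^+ n)%:E * \int[lebesgue_rV R n]_v f (rV_cons (a, (x' + c *: v)%R)).
  rewrite [LHS](IH x')//.
  exact: (measurableT_comp mf2 (measurable_pair1 _)).
under eq_integral => a _ do rewrite E.
rewrite ge0_integralZl//; last 3 first.
- have mg : measurable_fun setT (fun z : measurableTypeR R * 'rV[R]_n => f (rV_cons (x ord0 ord0 + c * z.1, x' + c *: z.2)%R)).
    apply: measurableT_comp => //.
    apply: measurable_fun_rV => i; under eq_fun do rewrite mxE.
    case: unliftP => [j|] _/=; last first.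
      by apply: measurable_funD => //; apply: measurable_funM.
    under eq_fun do rewrite !mxE.
    apply: measurable_funD => //; apply: measurable_funM => //.
    by apply: (@measurableT_comp _ _ _ _ _ _ (fun v : 'rV[R]_n => v ord0 j)) => //; exact: measurable_coord.
  exact: (measurable_fun_fubini_tonelli_F (m2 := lebesgue_rV R n) _ mg).
- by move=> a _; exact: integral_ge0.
- by rewrite lee_fin exprn_ge0// ltW.
rewrite muleA -EFinM -exprS; congr (_ * _).
apply: eq_integral => a _; apply: eq_integral => v _; congr f.
apply/rowP => i; rewrite !mxE; case: unliftP => [j ->|->]; rewrite ?mxE /= ?liftK ?unlift_none//.
Qed.

End change_of_variables.

(** * The heat kernel as a Gaussian average *)

Section heat_kernel.
Context (R : realType).

Lemma continuous_sqnorm N : continuous (@sqnorm R N).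
Proof.
move=> x.
suff H (r : seq 'I_N) : (fun y : 'rV[R]_N => \sum_(i <- r) y ord0 i ^+ 2) @ nbhs x -->
    \sum_(i <- r) x ord0 i ^+ 2 by exact: H.
elim: r => [|i r IH].
  by under eq_fun do rewrite big_nil; rewrite big_nil; exact: cvg_cst.
under eq_fun do rewrite big_cons; rewrite big_cons.
apply: (@cvgD _ _ _ (nbhs x)) => //.
by under eq_fun do rewrite expr2; rewrite expr2;
  apply: (@cvgM _ _ (nbhs x)); exact: coord_continuous.
Qed.

Lemma sqnormZ N (c : R) (z : 'rV[R]_N) : sqnorm (c *: z) = c ^+ 2 * sqnorm z.
Proof. by rewrite /sqnorm mulr_sumr; apply: eq_bigr => i _; rewrite mxE exprMn. Qed.

Lemma sqnorm_ge0 N (z : 'rV[R]_N) : 0 <= sqnorm z.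
Proof. by apply: sumr_ge0 => i _; exact: sqr_ge0. Qed.

Lemma heat_kernelN N t (x : 'rV[R]_N) : heat_kernel t (- x) = heat_kernel t x.
Proof.
rewrite /heat_kernel (_ : sqnorm (- x) = sqnorm x)//.
by apply: eq_bigr => i _; rewrite !mxE sqrrN.
Qed.

Lemma heat_kernel_ge0 N t (x : 'rV[R]_N) : 0 <= heat_kernel t x.
Proof. by rewrite mulr_ge0 ?powR_ge0// expR_ge0. Qed.

Lemma continuous_heat_kernel N t : continuous (@heat_kernel R N t).
Proof.
move=> x; rewrite /heat_kernel.
apply: (@cvgM _ _ (nbhs x)); first exact: cvg_cst.
apply: (continuous_cvg (F := nbhs x)); first exact: continuous_expR.
apply: (@cvgN _ _ _ (nbhs x)).
apply: (@cvgM _ _ (nbhs x)); last exact: cvg_cst.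
exact: continuous_sqnorm.
Qed.

Lemma measurable_heat_kernel N t : measurable_fun setT (@heat_kernel R N t).
Proof. apply: continuous_measurable_rV; exact: continuous_heat_kernel. Qed.

(** In each coordinate the kernel at time 1 is the normal density of variance 2. *)
Lemma integral_heat_kernel N :
  (\int[lebesgue_rV R N]_z (heat_kernel 1 z)%:E = 1)%E.
Proof.
elim: N => [|N IH].
  rewrite /= integral_dirac//; last by apply/measurable_EFinP; exact: measurable_heat_kernel.
  rewrite diracT mul1e /heat_kernel /sqnorm big_ord0 !mul0r !oppr0 expR0.
  by rewrite powRr0 mulr1.
rewrite ge0_integral_rVS; last 2 first.
- by apply/measurable_EFinP; exact: measurable_heat_kernel.
- by move=> z; rewrite lee_fin heat_kernel_ge0.
have E a (v : 'rV[R]_N) : heat_kernel 1 (rV_cons (a, v)) =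
   normal_pdf 0 (Num.sqrt 2) a * heat_kernel 1 v :> R.
  rewrite normal_pdfE ?gt_eqF ?sqrtr_gt0//.
  rewrite /heat_kernel /normal_peak /normal_fun sqr_sqrtr//.
  rewrite mulrACA -expRD; congr (_ * _); last first.
    congr expR; rewrite /sqnorm big_ord_recl mxE unlift_none subr0 mulr1.
    under eq_bigr do rewrite mxE liftK /=.
    rewrite mulrDl opprD; congr (_ - _).
    by rewrite mulNr; congr (- (_ / _)); ring.
  have P : 0 <= 4 * pi * 1 :> R by rewrite mulr1 mulr_ge0 ?pi_ge0.
  rewrite -[N.+1%:R]natr1 [(N%:R + 1) / 2]mulrDl opprD addrC powRD; last first.
    by apply/implyP => _; rewrite gt_eqF// mulr1 mulr_gt0// pi_gt0.
  congr (_ * _); rewrite powRN mul1r -powR12_sqrt//; last first.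
    by rewrite mulrn_wge0// mulr_ge0// pi_ge0.
  by congr ((_ `^ _)^-1); ring.
under eq_integral => a _ do under eq_integral => v _ do rewrite E EFinM.
under eq_integral => a _.
  rewrite ge0_integralZl//; last 3 first.
  - by apply/measurable_EFinP; exact: measurable_heat_kernel.
  - by move=> z _; rewrite lee_fin heat_kernel_ge0.
  - by rewrite lee_fin normal_pdf_ge0.
  rewrite IH mule1; over.
exact: integral_normal_pdf.
Qed.

Lemma heat_kernel_scale N (c : R) (z : 'rV[R]_N) : 0 < c ->
  c ^+ N * heat_kernel (c ^+ 2) (c *: z) = heat_kernel 1 z.
Proof.
move=> c0; rewrite /heat_kernel sqnormZ !mulr1.
have cc : 0 < c ^+ 2 by rewrite exprn_gt0.
rewrite mulrA; congr (_ * expR (- _)); last first.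
  by field; rewrite gt_eqF.
rewrite powRM ?(ltW cc)//; last by rewrite mulr_ge0 ?pi_ge0.
rewrite mulrCA -[RHS]mulr1; congr (_ * _).
rewrite -(powR_mulrn 2) ?ltW// -powRrM -powR_mulrn ?ltW// -powRD; last by apply/implyP => _; rewrite gt_eqF.
rewrite (_ : _ + _ = 0) ?powRr0//.
by field.
Qed.

Lemma heat_kernel_le N t (x : 'rV[R]_N) : 0 < t ->
  heat_kernel t x <= t `^ (- (N%:R / 2)).
Proof.
move=> t0; rewrite /heat_kernel.
rewrite -[leRHS]mulr1 ler_pM ?powR_ge0 ?expR_ge0//; last first.
  by rewrite -expR0 ler_expR oppr_le0 divr_ge0 ?sqnorm_ge0// mulr_ge0 ?ltW.
rewrite !powRN lef_pV2 ?posrE ?powR_gt0 ?mulr_gt0 ?pi_gt0//.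
apply: ge0_ler_powR; rewrite ?nnegrE ?mulr_ge0 ?pi_ge0 ?(ltW t0) ?divr_ge0//.
rewrite ler_peMl ?ltW//.
have := pi_ge2 R; lra.
Qed.

(** The heat semigroup after the substitution [y = x + sqrt t z]: the time enters
only through the argument of [f], so that [t = 0] is no longer singular and
dominated convergence applies uniformly up to it. *)
Definition heatS N t (f : 'rV[R]_N -> R) x : R :=
  \int[lebesgue_rV R N]_z (heat_kernel 1 z * f (x + Num.sqrt t *: z)).

Lemma measurable_affine N (x : 'rV[R]_N) (c : R) :
  measurable_fun setT (fun z : 'rV[R]_N => x + c *: z).
Proof.
apply: measurable_fun_rV => i; under eq_fun do rewrite !mxE.
apply: measurable_funD => //; apply: measurable_funM => //.
exact: measurable_coord.
Qed.

Lemma ge0_integral_heat_kernel N t (f : 'rV[R]_N -> \bar R) x : 0 < t ->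
  measurable_fun setT f -> (forall y, 0 <= f y)%E ->
  (\int[lebesgue_rV R N]_y ((heat_kernel t (x - y))%:E * f y) =
  \int[lebesgue_rV R N]_z ((heat_kernel 1 z)%:E * f (x + Num.sqrt t *: z)%R))%E.
Proof.
move=> t0 mf f0.
have s0 : 0 < Num.sqrt t by rewrite sqrtr_gt0.
have k0 y : (0 <= (heat_kernel t (x - y))%:E)%E by rewrite lee_fin heat_kernel_ge0.
have mk : measurable_fun setT (fun y : 'rV[R]_N => (heat_kernel t (x - y))%:E * f y)%E.
  apply: emeasurable_funM => //; apply/measurable_EFinP.
  apply: measurableT_comp => //; first exact: measurable_heat_kernel.
  apply: measurable_fun_rV => i; under eq_fun do rewrite !mxE.
  apply: measurable_funB => //.
  exact: measurable_coord.
rewrite (ge0_integral_affine x s0)//; last first.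
  by move=> z; exact: mule_ge0.
rewrite -ge0_integralZl; last 4 first.
- exact: measurableT.
- by apply: (measurableT_comp mk); exact: measurable_affine.
- by move=> z _; exact: mule_ge0.
- by rewrite lee_fin exprn_ge0// ltW.
apply: eq_integral => z _; rewrite muleA -EFinM; congr (_%:E * _)%E.
rewrite -(heat_kernel_scale _ s0) sqr_sqrtr ?ltW//; congr (_ * _).
rewrite (_ : x - _ = - (Num.sqrt t *: z)); last by rewrite opprD addrA subrr add0r.
by rewrite heat_kernelN.
Qed.

Lemma heat_semigroupE N t (f : 'rV[R]_N -> R) x : 0 <= t ->
  measurable_fun setT f -> heat_semigroup t f x = heatS t f x.
Proof.
move=> t0 mf; rewrite /heat_semigroup /heatS.
have mG : measurable_fun setT (EFin \o @heat_kernel R N 1).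
  by apply/measurable_EFinP; exact: measurable_heat_kernel.
have [->|tn0] := eqVneq t 0.
  rewrite sqrtr0 /Rintegral.
  under eq_integral do rewrite scale0r addr0 mulrC EFinM.
  rewrite integralZl//; first by rewrite integral_heat_kernel mule1.
  apply/integrableP; split => //.
  under eq_integral => y _ do rewrite /= ger0_norm ?heat_kernel_ge0//.
  by rewrite integral_heat_kernel ltry.
have {tn0} {}t0 : 0 < t by rewrite lt_neqAle eq_sym tn0.
rewrite /Rintegral; congr fine.
rewrite integralE [RHS]integralE.
have G0 (h g : 'rV[R]_N -> R) : (forall y, 0 <= h y) ->
   ((fun y => (h y * g y)%:E)^\+)%E = (fun y => (h y)%:E * (EFin \o g)^\+ y)%E /\
   ((fun y => (h y * g y)%:E)^\-)%E = (fun y => (h y)%:E * (EFin \o g)^\- y)%E.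
  move=> h0; split; apply/funext => y; rewrite ?funeposE ?funenegE /=.
    by rewrite EFinM maxe_pMr ?mule0// lee_fin.
  by rewrite -mulrN EFinM maxe_pMr ?mule0// lee_fin.
have [-> ->] := G0 _ f (fun y => heat_kernel_ge0 t (x - y)).
have [-> ->] := G0 _ (fun z => f (x + Num.sqrt t *: z)) (fun y => heat_kernel_ge0 1 y).
have mf' : measurable_fun setT (EFin \o f) by exact/measurable_EFinP.
have mp : measurable_fun setT (EFin \o f)^\+%E by exact: measurable_funepos.
have mn : measurable_fun setT (EFin \o f)^\-%E by exact: measurable_funeneg.
rewrite (ge0_integral_heat_kernel x t0 mp (fun y => funepos_ge0 _ y)).
rewrite (ge0_integral_heat_kernel x t0 mn (fun y => funeneg_ge0 _ y)).
congr (_ - _)%E.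
  by apply: eq_integral => z _; rewrite !funeposE.
by apply: eq_integral => z _; rewrite !funenegE.
Qed.

End heat_kernel.

(** * Filters with a countable base *)

Section countable_base.

(** Dominated convergence is a statement about sequences; along a filter with a
countable base it suffices to test sequences, which covers in one stroke
convergence to a point and convergence to infinity. *)
Definition has_countable_base (Y : Type) (F : set_system Y) :=
  exists B : nat -> set Y, (forall n, F (B n)) /\
    forall A, F A -> exists n, forall m, (n <= m)%N -> B m `<=` A.

Lemma has_countable_base_nbhs (R : realType) (Y : pseudoMetricType R) (y : Y) :
  has_countable_base (nbhs y).
Proof.
exists (fun n => ball y n.+1%:R^-1); split.
  by move=> n; apply: nbhsx_ballx; rewrite invr_gt0.
move=> A /nbhs_ballP[e /= e0 yeA].
have [n _ nP] := near_infty_natSinv_lt (PosNum e0).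
exists n => m nm; apply: subset_trans yeA.
by apply: le_ball; apply: ltW; exact: (nP m).
Qed.

Lemma has_countable_base_prod (Y Z : Type) (F : set_system Y) (G : set_system Z) :
  has_countable_base F -> has_countable_base G ->
  has_countable_base (filter_prod F G).
Proof.
move=> [B [FB BF]] [C [GC CG]]; exists (fun n => B n `*` C n); split.
  by move=> n; exists (B n, C n) => //; split => /=.
move=> A [[P Q] [/= FP GQ] PQA].
have [n nP] := BF _ FP; have [m mQ] := CG _ GQ.
exists (maxn n m) => k; rewrite geq_max => /andP[nk mk] [y z] [/= By Cz].
by apply: PQA; split => /=; [exact: nP By|exact: mQ Cz].
Qed.

Lemma cvg_countable_base (R : realType) (Y : Type) (F : set_system Y) (G : set Y)
    (phi : Y -> R) (l : R) :
  Filter F -> has_countable_base F -> F G ->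
  (forall y : nat -> Y, y @ \oo --> F -> (forall n, G (y n)) ->
     phi (y n) @[n --> \oo] --> l) ->
  phi @ F --> l.
Proof.
move=> FF [B [FB BF]] FG H; apply/cvgrPdist_le => e e0.
apply: contrapT => nF.
have /choice[y yP] n : exists y, (B n `&` G) y /\ ~ (`|l - phi y| <= e).
  apply: contrapT => nex; apply: nF; apply: filterS (filterI (FB n) FG) => y By.
  by apply: contrapT => nle; apply: nex; exists y.
have yF : y @ \oo --> F.
  move=> A FA; have [n nA] := BF _ FA.
  by exists n => // m /= nm; apply: nA nm _ _; have [[]] := yP m.
have := H y yF (fun n => (yP n).1.2) => /cvgrPdist_le /(_ e e0)[n _ /(_ n (leqnn n))].
exact: (yP n).2.
Qed.

End countable_base.

(** * Integrals against a fixed weight *)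

Section weighted.
Context d (T : measurableType d) (R : realType) (mu : {measure set T -> \bar R}).
Variables (D : set T) (mD : measurable D) (k : T -> R).
Hypotheses (k0 : forall x, D x -> 0 <= k x) (ik : mu.-integrable D (EFin \o k)).

Let mk : measurable_fun D k.
Proof. by apply/measurable_EFinP; case/integrableP : ik. Qed.

Lemma integrable_weighted (h : T -> R) (C : R) : measurable_fun D h ->
  (forall x, D x -> `|h x| <= C) ->
  mu.-integrable D (EFin \o (fun x => k x * h x)).
Proof.
move=> mh hC.
apply: (le_integrable mD (g := fun x => (C%:E * (k x)%:E)%E)) => //.
- by apply/measurable_EFinP; exact: measurable_funM.
- move=> x Dx; rewrite /= lee_fin normrM [leRHS]normrM mulrC.
  by rewrite ler_wpM2r// (le_trans (hC _ Dx))// ler_norm.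
- exact: integrableZl.
Qed.

Lemma weighted_norm_le (h m : T -> R) (C : R) : measurable_fun D h -> measurable_fun D m ->
  (forall x, D x -> `|h x| <= m x) -> (forall x, D x -> m x <= C) ->
  `|\int[mu]_(x in D) (k x * h x)| <= \int[mu]_(x in D) (k x * m x).
Proof.
move=> mh mm hm mC.
have ih : mu.-integrable D (EFin \o (fun x => k x * h x)).
  apply: (integrable_weighted (C := C)) => // x Dx.
  exact: le_trans (hm _ Dx) (mC _ Dx).
apply: le_trans (le_normr_Rintegral mD ih) _.
apply: le_Rintegral => //.
- exact: (integrable_norm ih).
- apply: (integrable_weighted (C := C)) => // x Dx.
  by rewrite ger0_norm ?mC// (le_trans _ (hm _ Dx)).
- by move=> x Dx; rewrite normrM ger0_norm ?k0// ler_wpM2l ?k0// hm.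
Qed.

Lemma weighted_le_cst (h : T -> R) (C : R) : measurable_fun D h ->
  (forall x, D x -> `|h x| <= C) ->
  `|\int[mu]_(x in D) (k x * h x)| <= C * \int[mu]_(x in D) k x.
Proof.
move=> mh hC.
apply: le_trans (weighted_norm_le (m := cst C) (C := C) mh _ hC _) _ => //.
by rewrite mulrC -RintegralZr.
Qed.

(** The form of dominated convergence behind every continuity statement below: the
weight [k] does not depend on the parameter, and [h] is bounded only near the
limit. *)
Lemma weighted_dominated (Y : Type) (F : set_system Y) (h : T -> Y -> R) (l : T -> R)
    (C : R) : Filter F -> has_countable_base F ->
  (forall y, measurable_fun D (h^~ y)) -> 
  (\forall y \near F, forall x, D x -> `|h x y| <= C) ->
  (forall x, D x -> h x y @[y --> F] --> l x) ->
  \int[mu]_(x in D) (k x * h x y) @[y --> F] --> \int[mu]_(x in D) (k x * l x).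
Proof.
move=> FF Fb mh hC hl.
apply: cvg_countable_base FF Fb hC _ => y yF yC.
have hyl x : D x -> h x (y n) @[n --> \oo] --> l x.
  by move=> Dx; exact: (cvg_comp _ _ yF (hl _ Dx)).
have ml : measurable_fun D l.
  by apply: (measurable_fun_cvg (h := fun n x => h x (y n))).
pose f n x : \bar R := (k x * h x (y n))%:E.
have [] := @dominated_convergence _ T R mu D mD f (fun x => (k x * l x)%:E)
  (fun x => (C%:E * (k x)%:E)%E).
- by move=> n; apply/measurable_EFinP; exact: measurable_funM.
- by apply/measurable_EFinP; exact: measurable_funM.
- apply/aeW => x Dx; apply: cvg_EFin; first exact: nearW.
  by apply: cvgMr; exact: hyl.
- exact: integrableZl.
- apply/aeW => x n Dx; rewrite /f /= lee_fin normrM ger0_norm ?k0// mulrC.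
  by rewrite ler_wpM2r ?k0// yC.
move=> il _ cf; apply: fine_cvg.
rewrite fineK//; exact: integrable_fin_num.
Qed.

(** Young's inequality [h C'^(r-1) <= h^r / r + C'^r / r'] integrated against [k];
a zero [C] is reached as a limit of positive [C']. *)
Lemma weighted_jensen (h : T -> R) (r W C : R) : measurable_fun D h ->
  (forall x, D x -> 0 <= h x) -> 1 <= r -> 0 < W -> 0 <= C ->
  (\int[mu]_(x in D) (k x)%:E <= W%:E)%E ->
  (\int[mu]_(x in D) (k x * h x `^ r)%:E <= (W * C `^ r)%:E)%E ->
  (\int[mu]_(x in D) (k x * h x)%:E <= (W * C)%:E)%E.
Proof.
move=> mh h0 r1 W0 C0 kW khW.
have mkh : measurable_fun D (fun x => (k x * h x)%:E).
  by apply/measurable_EFinP; exact: measurable_funM.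
have mkhr : measurable_fun D (fun x => (k x * h x `^ r)%:E).
  by apply/measurable_EFinP/measurable_funM => //; exact: measurableT_comp (measurable_powR r) mh.
have [r1E|r_neq1] := eqVneq r 1.
  move: khW; rewrite r1E powRr1// => khW; apply: le_trans khW.
  rewrite le_eqVlt; apply/orP; left; apply/eqP; apply: eq_integral => x /[!inE] Dx.
  by rewrite powRr1 ?h0.
suff H C' : 0 < C' -> C <= C' -> (\int[mu]_(x in D) (k x * h x)%:E <= (W * C')%:E)%E.
  apply/lee_addgt0Pr => e e0.
  apply: le_trans (H (C + e / W) _ _) _.
  - by rewrite ltr_wpDl// divr_gt0.
  - by rewrite lerDl divr_ge0// ltW.
  - by rewrite mulrDr mulrCA divff ?gt_eqF// mulr1.
move=> C'0 CC'.
have r0 : 0 < r by rewrite (lt_le_trans _ r1).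
have rm1 : 0 < r - 1 by rewrite subr_gt0 lt_neqAle eq_sym r_neq1.
pose q := r / (r - 1).
have q0 : 0 < q by rewrite divr_gt0.
have rq : r^-1 + q^-1 = 1 by rewrite /q; field; rewrite !gt_eqF.
have P0 : 0 < C' `^ (r - 1) by rewrite powR_gt0.
have Y x : D x -> k x * h x * C' `^ (r - 1) <= r^-1 * (k x * h x `^ r) + C' `^ r / q * k x.
  move=> Dx; have := conjugate_powR (h0 _ Dx) (powR_ge0 C' (r - 1)) r0 q0 rq.
  rewrite -powRrM (_ : (r - 1) * q = r); last by rewrite /q; field; rewrite gt_eqF.
  by move/(ler_wpM2l (k0 Dx)); rewrite mulrA => /le_trans; apply; lra.
rewrite -(lee_pmul2r (x := (C' `^ (r - 1))%:E)) ?lte_fin//.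
rewrite -ge0_integralZr//; last 2 first.
- by move=> x Dx; rewrite lee_fin mulr_ge0 ?k0 ?h0.
- by rewrite lee_fin powR_ge0.
have M1 : measurable_fun D (fun x => r^-1%:E * (k x * h x `^ r)%:E)%E.
  by apply: emeasurable_funM.
have M2 : measurable_fun D (fun x => (C' `^ r / q)%:E * (k x)%:E)%E.
  by apply: emeasurable_funM => //; exact/measurable_EFinP.
have c0 : 0 <= C' `^ r / q by rewrite divr_ge0 ?powR_ge0 ?ltW.
apply: (@le_trans _ _ (\int[mu]_(x in D) (r^-1%:E * (k x * h x `^ r)%:E + (C' `^ r / q)%:E * (k x)%:E))%E).
  apply: ge0_le_integral; first exact: mD.
  - by move=> x Dx; rewrite lee_fin !mulr_ge0 ?k0 ?h0 ?powR_ge0.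
  - exact: emeasurable_funM.
  - by apply: emeasurable_funD.
  - by move=> x Dx; rewrite -!EFinM -EFinD lee_fin Y.
rewrite ge0_integralD//; last 2 first.
- by move=> x Dx; rewrite lee_fin !mulr_ge0 ?k0 ?powR_ge0 ?invr_ge0 ?ltW.
- by move=> x Dx; rewrite lee_fin mulr_ge0 ?k0.
rewrite ge0_integralZl//; last 2 first.
- by move=> x Dx; rewrite lee_fin mulr_ge0 ?k0 ?powR_ge0.
- by rewrite lee_fin invr_ge0 ltW.
rewrite ge0_integralZl//; last first.
  exact/measurable_EFinP.
apply: (@le_trans _ _ (r^-1%:E * (W * C `^ r)%:E + (C' `^ r / q)%:E * W%:E)%E).
  by apply: leeD; apply: lee_wpmul2l; rewrite ?lee_fin ?invr_ge0 ?(ltW r0).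
rewrite -!EFinM -EFinD lee_fin.
have CrC : C `^ r <= C' `^ r by rewrite ge0_ler_powR ?nnegrE ?(ltW r0) ?(ltW C'0).
have -> : W * C' * C' `^ (r - 1) = (r^-1 + q^-1) * (W * C' `^ r).
  rewrite rq mul1r -mulrA; congr (_ * _).
  by rewrite -{1}(powRr1 (ltW C'0)) -powRD ?gt_eqF ?implybT// addrC subrK.
rewrite mulrDl lerD//.
  by rewrite ler_wpM2l ?invr_ge0 ?(ltW r0)// ler_wpM2l ?(ltW W0).
by rewrite le_eqVlt; apply/orP; left; apply/eqP; ring.
Qed.

End weighted.

(** * Singular weights in time *)

Section time_weights.
Context (R : realType).

(** The fundamental theorem of calculus on segments exhausting the open interval:
the integrand may be singular at both ends. *)
Lemma ge0_integral_le_primitive (f F : R -> R) (L U : R) :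
  (forall x : R, 0 < x < 1 -> 0 <= f x) ->
  (forall x : R, 0 < x < 1 -> {for x, continuous f}) ->
  (forall x : R, 0 < x < 1 -> is_derive x 1 F (f x)) ->
  (forall x : R, 0 < x < 1 -> L <= F x <= U) ->
  (\int[lebesgue_measure]_(x in `[0%R, 1%R]) (f x)%:E <= (U - L)%:E)%E.
Proof.
move=> f0 cf dF LFU.
have mf : measurable_fun (`]0, 1[ : set R) f.
  apply: open_continuous_measurable_fun => //.
  by move=> x /[!inE]/=; rewrite in_itv/=; exact: cf.
have mf1 : measurable_fun (`]0, 1] : set R) f.
  have -> : (`]0, 1]%classic : set R) = (`]0, 1[%classic `|` [set 1] : set R).
    by rewrite setUitv1// bnd_simp.
  have H := (measurable_funU f (measurable_itv `]0, 1[) (measurable_set1 1)).2.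
  by apply: H; split => //; exact: measurable_fun_set1.
rewrite -integral_itv_obnd_cbnd; last exact/measurable_EFinP.
rewrite -integral_itv_bndo_bndc; last exact/measurable_EFinP.
(* 1/3 at most, so that the segments [[d n, 1 - d n]] are not empty *)
pose d n : R := n.+3%:R^-1.
have d0 n : 0 < d n by rewrite invr_gt0.
have d2 n : d n < 2^-1 by rewrite ltf_pV2 ?posrE// ltr_nat.
have in01 n x : d n <= x <= 1 - d n -> 0 < x < 1.
  by move=> /andP[dx xd]; have := d0 n; lra.
pose A n : set R := `[d n, 1 - d n]%classic.
have UA : \bigcup_n A n = `]0, 1[%classic.
  apply/seteqP; split => x.
    by move=> [n _]; rewrite /A /= !in_itv/=; exact: in01.
  rewrite /= in_itv/= => /andP[x0 x1].
  have m0 : 0 < Num.min x (1 - x) by rewrite lt_min x0 subr_gt0.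
  have [n _ /(_ n (leqnn n)) nP] := near_infty_natSinv_lt (PosNum m0).
  exists n => //; rewrite /A/= in_itv/=.
  have : d n <= n.+1%:R^-1 by rewrite lef_pV2 ?posrE// ler_nat ltnS leqW.
  move: nP; rewrite /= lt_min => /andP[h1 h2] h3; set c := _^-1 in h1 h2 h3; lra.
rewrite -UA.
have cvgA : (\int[lebesgue_measure]_(x in A i) (f x)%:E)%E @[i --> \oo] -->
    (\int[lebesgue_measure]_(x in \bigcup_i A i) (f x)%:E)%E.
  apply: ge0_nondecreasing_set_cvg_integral.
  - move=> n m nm; apply/subsetPset => x; rewrite /A/= !in_itv/= => /andP[x1 x2].
    have : d m <= d n by rewrite lef_pV2 ?posrE// ler_nat !ltnS.
    lra.
  - by move=> n; exact: measurable_itv.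
  - move=> n; apply/measurable_EFinP; apply: measurable_funS mf => //.
    by move=> x; rewrite /A/= !in_itv/=; exact: (in01 n).
  - by move=> n x; rewrite /A/= in_itv/= => /in01 x01; rewrite lee_fin f0.
move/cvg_lim : (cvgA) => <-//; apply: lime_le.
  by apply/cvg_ex; eexists; exact: cvgA.
apply: nearW => n.
rewrite (@continuous_FTC2 _ f F).
- rewrite -EFinB lee_fin.
  have /LFU/andP[] : 0 < d n < 1 by apply: (in01 n); have := d2 n; lra.
  have /LFU/andP[] : 0 < 1 - d n < 1 by apply: (in01 n); have := d2 n; lra.
  lra.
- have := d2 n; lra.
- apply: continuous_subspace_itv => x; rewrite in_itv/= => /in01; exact: cf.
- have cF x : 0 < x < 1 -> {for x, continuous F}.
    move=> /dF[dFx _].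
    exact/differentiable_continuous/derivable1_diffP.
  split.
  + move=> x; rewrite in_itv/= => /andP[x1 x2].
    have /dF[dFx _] : 0 < x < 1 by apply: (in01 n); rewrite !ltW.
    exact: dFx.
  + apply: cvg_at_right_filter; apply: cF; apply: (in01 n); have := d2 n; lra.
  + apply: cvg_at_left_filter; apply: cF; apply: (in01 n); have := d2 n; lra.
- move=> x; rewrite in_itv/= => /andP[x1 x2].
  have /dF[_ <-] : 0 < x < 1 by apply: (in01 n); rewrite !ltW.
  by rewrite derive1E.
Qed.

Lemma integral_powR_le (b : R) : -1 < b ->
  (\int[lebesgue_measure]_(x in `[0%R, 1%R]) (x `^ b)%:E <= ((1 + b)^-1)%:E)%E.
Proof.
move=> b1; have b0 : 0 < 1 + b by lra.
have D (x : R) : 0 < x -> is_derive x 1 (fun x : R => (1 + b)^-1 * x `^ (1 + b)) (x `^ b).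
  move=> x0; have H := is_derive1_powR (1 + b) x0.
  apply: is_derive_eq; rewrite /GRing.scale/= mulrA mulVf ?gt_eqF// mul1r.
  by congr (_ `^ _); ring.
rewrite -[(1 + b)^-1]subr0; apply: (ge0_integral_le_primitive (F := fun x : R => (1 + b)^-1 * x `^ (1 + b))).
- by move=> x _; exact: powR_ge0.
- move=> x /andP[x0 _].
  apply/differentiable_continuous/derivable1_diffP.
  by have [] := is_derive1_powR b x0.
- by move=> x /andP[x0 _]; exact: D.
- move=> x /andP[x0 x1]; rewrite mulr_ge0 ?invr_ge0 ?powR_ge0 ?(ltW b0)//=.
  rewrite -[leRHS]mulr1 ler_wpM2l ?invr_ge0 ?(ltW b0)//.
  apply: (@le_trans _ _ (1 `^ (1 + b))); last by rewrite powR1.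
  by rewrite ge0_ler_powR ?nnegrE ?ltW.
Qed.

Lemma integral_onem_powR_le (b : R) : -1 < b ->
  (\int[lebesgue_measure]_(x in `[0%R, 1%R]) ((1 - x) `^ b)%:E <= ((1 + b)^-1)%:E)%E.
Proof.
move=> b1; have b0 : 0 < 1 + b by lra.
pose F (x : R) : R := - ((1 + b)^-1 * (1 - x) `^ (1 + b)).
have dsub (x : R) : is_derive x 1 (fun y : R => 1 - y) (-1).
  by apply: is_derive_eq; rewrite add0r mul1r.
have D (c x : R) : x < 1 -> is_derive x 1 (fun y : R => (1 - y) `^ c) (- (c * (1 - x) `^ (c - 1))).
  move=> x1; have x0 : 0 < 1 - x by rewrite subr_gt0.
  have H1 := is_derive1_powR c x0.
  have H2 := dsub x.
  have H := @is_derive1_comp _ (fun y => y `^ c) (fun y : R => 1 - y) x _ _ H1 H2.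
  by apply: (is_derive_eq H); rewrite mulrN1.
rewrite -[(1 + b)^-1]opprK -[- - _]sub0r; apply: (ge0_integral_le_primitive (F := F)).
- by move=> x _; exact: powR_ge0.
- move=> x /andP[_ x1].
  apply/differentiable_continuous/derivable1_diffP.
  by have [] := D b x x1.
- move=> x /andP[_ x1]; have H := D (1 + b) x x1.
  apply: is_derive_eq; rewrite /GRing.scale/= mulrN opprK mulrA mulVf ?gt_eqF// mul1r.
  by congr (_ `^ _); ring.
- move=> x /andP[x0 x1]; rewrite /F oppr_le0 mulr_ge0 ?invr_ge0 ?powR_ge0 ?(ltW b0)//= andbT.
  rewrite lerN2 -[leRHS]mulr1 ler_wpM2l ?invr_ge0 ?(ltW b0)//.
  apply: (@le_trans _ _ (1 `^ (1 + b))); last by rewrite powR1.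
  rewrite ge0_ler_powR ?nnegrE ?(ltW b0)//; lra.
Qed.

(** On each half of the interval one of the two factors is bounded, so the
integral is controlled by those of the two single powers. *)
Lemma beta_weight (a b : R) : 0 <= a < 1 -> 0 <= b < 1 -> exists W : R, 0 < W /\
  (\int[lebesgue_measure]_(x in `[0%R, 1%R]) ((1 - x) `^ (- a) * x `^ (- b))%:E <= W%:E)%E.
Proof.
move=> /andP[a0 a1] /andP[b0 b1].
pose h (c : R) : R := 2^-1 `^ (- c).
have h0 c : 0 < h c by rewrite powR_gt0.
(* [h c] bounds [y^-c] on [[1/2, 1]]. *)
exists (h a * (1 - b)^-1 + h b * (1 - a)^-1); split.
  by rewrite addr_gt0// mulr_gt0// invr_gt0 subr_gt0.
have mono (c y : R) : 0 <= c -> 2^-1 <= y -> y `^ (- c) <= h c.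
  move=> c0 y2; have y0 : 0 < y by lra.
  rewrite /h !powRN lef_pV2 ?posrE ?powR_gt0//.
  by rewrite ge0_ler_powR ?nnegrE ?(ltW y0).
have m1 (c : R) : measurable_fun setT (fun x : R => (x `^ c)%:E).
  by apply/measurable_EFinP; exact: measurable_powR.
have m2 (c : R) : measurable_fun setT (fun x : R => ((1 - x) `^ c)%:E).
  apply/measurable_EFinP; apply: (measurableT_comp (measurable_powR c)).
  exact: measurable_funB.
apply: (@le_trans _ _ (\int[lebesgue_measure]_(x in `[0%R, 1%R])
   ((h a)%:E * (x `^ (- b))%:E + (h b)%:E * ((1 - x) `^ (- a))%:E))%E).
  apply: ge0_le_integral; first exact: measurable_itv.
  - by move=> x _; rewrite lee_fin mulr_ge0 ?powR_ge0.
  - apply: measurable_funTS; apply/measurable_EFinP; apply: measurable_funM.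
      by apply/measurable_EFinP; exact: m2.
    by apply/measurable_EFinP; exact: m1.
  - apply: measurable_funTS; by apply: emeasurable_funD; apply: measurable_funeM; [exact: m1|exact: m2].
  - move=> x; rewrite /= in_itv/= => /andP[x0 x1]; rewrite -!EFinM -EFinD lee_fin.
    have p0 := powR_ge0 x (- b); have p1 := powR_ge0 (1 - x) (- a).
    have [x2|x2] := leP x 2^-1.
      apply: (@le_trans _ _ (h a * x `^ (- b))); last by rewrite lerDl mulr_ge0 ?(ltW (h0 _)).
      by rewrite ler_wpM2r// mono//; lra.
    apply: (@le_trans _ _ (h b * (1 - x) `^ (- a))); last by rewrite lerDr mulr_ge0 ?(ltW (h0 _)).
    by rewrite mulrC ler_wpM2r// mono// ltW.
rewrite ge0_integralD//; last 4 first.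
- by move=> x _; rewrite mule_ge0 ?lee_fin ?powR_ge0 ?ltW.
- by apply: measurable_funTS; apply: measurable_funeM; exact: m1.
- by move=> x _; rewrite mule_ge0 ?lee_fin ?powR_ge0 ?ltW.
- by apply: measurable_funTS; apply: measurable_funeM; exact: m2.
rewrite EFinD !EFinM.
have Z (c e : R) (g : R -> R) : 0 <= c -> measurable_fun setT (EFin \o g) -> (forall x, 0 <= g x) ->
  (\int[lebesgue_measure]_(x in `[0%R, 1%R]) (g x)%:E <= e%:E)%E ->
  (\int[lebesgue_measure]_(x in `[0%R, 1%R]) (c%:E * (g x)%:E) <= c%:E * e%:E)%E.
  move=> c0 mg g0 H; rewrite ge0_integralZl//.
  - by apply: lee_wpmul2l.
  - exact: measurable_funTS.
  - by move=> x _; rewrite lee_fin.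
apply: leeD.
  apply: (Z _ _ (fun x => x `^ (- b))).
  - exact: ltW.
  - exact: m1.
  - by move=> x; exact: powR_ge0.
  - by apply: integral_powR_le; lra.
apply: (Z _ _ (fun x => (1 - x) `^ (- a))).
- exact: ltW.
- exact: m2.
- by move=> x; exact: powR_ge0.
- by apply: integral_onem_powR_le; lra.
Qed.

End time_weights.

(** * Continuous families of functions vanishing at infinity *)

Section regularity.
Context (R : realType) (N : nat).
Implicit Types (g : R -> 'rV[R]_N -> R) (f : 'rV[R]_N -> R).

(** The neighbourhoods of infinity in the one-point compactification of space. *)
Definition at_infty : set_system 'rV[R]_N :=
  filter_from [set: R] (fun M => [set x | M <= `|x|]).

Global Instance at_infty_filter : Filter at_infty.
Proof.
apply: filter_from_filter; first by exists 0.
move=> M M' _ _; exists (Num.max M M') => // x /=.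
by rewrite ge_max => /andP.
Qed.

Lemma has_countable_base_infty : has_countable_base at_infty.
Proof.
exists (fun n => [set x | n%:R <= `|x|]); split; first by move=> n; exists n%:R.
move=> A [M _ MA]; have [n _ nP] := nbhs_infty_ger M.
exists n => m nm x /= mx; apply: MA => /=.
by apply: le_trans mx; exact: nP.
Qed.

Lemma C0_infty f : C0 f -> f @ at_infty --> 0.
Proof.
move=> [_ fi]; apply/cvgrPdist_le => e /fi[A fA].
by exists A => // x /= Ax; rewrite sub0r normrN fA.
Qed.

Lemma infty_decay f e : f @ at_infty --> 0 -> 0 < e ->
  exists A : R, forall x, A <= `|x| -> `|f x| <= e.
Proof.
move=> /cvgrPdist_le fi e0; have [A _ fA] := fi e e0.
by exists A => x /fA/=; rewrite sub0r normrN.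
Qed.

Lemma C0_bounded f : C0 f -> exists2 C, 0 <= C & forall x, `|f x| <= C.
Proof.
move=> [cf fi]; have [A fA] := fi 1 ltr01.
pose K : set 'rV[R]_N := [set x | `|x| <= Num.max A 0].
have K0 : K 0 by rewrite /K/= normr0 le_max lexx orbT.
have cK : compact K.
  apply: bounded_closed_compact.
    by exists (Num.max A 0); split; [exact: num_real|move=> M AM x /= /le_trans; apply; exact: ltW].
  rewrite (_ : K = (fun x => `|x|) @^-1` [set y | y <= Num.max A 0]); last by [].
  by apply: closed_comp => [x _|]; [exact: norm_continuous|exact: closed_le].
have [|c _ cP] := EVT_max_rV (f := fun x => `|f x|) (ex_intro _ 0 K0) cK.
  apply: continuous_subspaceT => x.
  by apply: (continuous_comp (cf x)); exact: norm_continuous.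
exists (`|f c| + 1); first by rewrite addr_ge0.
move=> x; have [Ax|xA] := leP A `|x|; first by rewrite (le_trans (fA _ Ax))// lerDr.
rewrite (le_trans (cP x _)) ?lerDl//.
by rewrite inE /K /= le_max (ltW xA).
Qed.

Lemma C0_measurable f : C0 f -> measurable_fun setT f.
Proof. by case=> cf _; exact: continuous_measurable_rV. Qed.

(** A continuous curve in [C_0], written as joint continuity on the product of
time and the one-point compactification of space.  Unlike continuity for the
uniform topology, this form is pointwise and passes under integrals by
dominated convergence. *)
Definition regular g : Prop := [/\
  forall (t : R) (x : 'rV[R]_N), (fun y : R * 'rV[R]_N => g y.1 y.2) @ nbhs (t, x) --> g t x,
  forall t : R, (fun y : R * 'rV[R]_N => g y.1 y.2) @ filter_prod (nbhs t) at_infty --> 0 &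
  forall T, exists C : R, forall t x, t <= T -> `|g t x| <= C].

Lemma regular_C0 g t : regular g -> C0 (g t).
Proof.
move=> [gc gi _]; split.
  move=> x.
  have H : (fun y => (t, y)) @ nbhs x --> nbhs (t, x).
    by apply: (@cvg_pair _ _ _ (nbhs x) (nbhs t) (nbhs x)); [exact: cvg_cst|exact: cvg_id].
  exact: (cvg_comp _ _ H (gc t x)).
move=> e e0; apply: (infty_decay _ e0).
have H : (fun y => (t, y)) @ at_infty --> filter_prod (nbhs t) at_infty.
  by apply: (@cvg_pair _ _ _ at_infty (nbhs t) at_infty); [exact: cvg_cst|exact: cvg_id].
exact: (cvg_comp _ _ H (gi t)).
Qed.

Lemma regular_cst f : C0 f -> regular (fun=> f).
Proof.
move=> C0f; split.
- by move=> t x; apply: (cvg_comp _ _ cvg_snd); case: C0f => cf _; exact: cf.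
- by move=> t; apply: (cvg_comp _ _ cvg_snd); exact: C0_infty.
- by move=> T; have [C _ fC] := C0_bounded C0f; exists C => t x _.
Qed.

Lemma regularD g1 g2 : regular g1 -> regular g2 -> regular (fun t x => g1 t x + g2 t x).
Proof.
move=> [c1 i1 b1] [c2 i2 b2]; split.
- by move=> t x; apply: (cvgD (c1 t x) (c2 t x)).
- by move=> t; rewrite -[0]addr0; apply: (cvgD (i1 t) (i2 t)).
- move=> T; have [C1 H1] := b1 T; have [C2 H2] := b2 T.
  exists (C1 + C2) => t x tT; apply: (le_trans (ler_normD _ _)).
  by rewrite lerD ?H1 ?H2.
Qed.

End regularity.
Arguments at_infty {R N}.

(** * Regularity of the heat flow *)

Section heatS_regularity.
Context (R : realType) (N : nat).
Implicit Types (g : R -> 'rV[R]_N -> R) (f : 'rV[R]_N -> R).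

Let G : 'rV[R]_N -> R := heat_kernel 1.

Lemma integrable_heat_kernel1 : (lebesgue_rV R N).-integrable setT (EFin \o G).
Proof.
apply/integrableP; split; first by apply/measurable_EFinP; exact: measurable_heat_kernel.
under eq_integral => y _ do rewrite /= ger0_norm ?heat_kernel_ge0//.
by rewrite integral_heat_kernel ltry.
Qed.

Lemma Rintegral_heat_kernel1 : \int[lebesgue_rV R N]_z G z = 1.
Proof. by rewrite /Rintegral integral_heat_kernel. Qed.

Lemma measurable_shift f (x : 'rV[R]_N) (c : R) : measurable_fun setT f ->
  measurable_fun setT (fun z : 'rV[R]_N => f (x + c *: z)).
Proof. by move=> mf; apply: (measurableT_comp mf); exact: measurable_affine. Qed.

Lemma heatS_le t f C x : measurable_fun setT f -> (forall y, `|f y| <= C) ->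
  `|heatS t f x| <= C.
Proof.
move=> mf fC.
have := @weighted_le_cst _ _ _ _ setT measurableT G (fun x _ => heat_kernel_ge0 1 x)
  integrable_heat_kernel1 _ C (measurable_shift x (Num.sqrt t) mf) (fun z _ => fC _).
by rewrite Rintegral_heat_kernel1 mulr1.
Qed.

(** Only the limit of the integrand for each fixed [z] has to be identified; this
serves both for limits at points of space and for limits at infinity. *)
Lemma heatS_cvg_dominated (Y : Type) (F : set_system Y) (tau s : Y -> R) (x : Y -> 'rV[R]_N)
    g (l : 'rV[R]_N -> R) (T : R) :
  Filter F -> has_countable_base F -> regular g -> (\forall y \near F, s y <= T) ->
  (forall z, g (s y) (x y + Num.sqrt (tau y) *: z) @[y --> F] --> l z) ->
  heatS (tau y) (g (s y)) (x y) @[y --> F] --> \int[lebesgue_rV R N]_z (G z * l z).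
Proof.
move=> FF Fb gr sT gl; have [_ _ /(_ T)[C gC]] := gr.
apply: (@weighted_dominated _ _ _ _ setT measurableT G (fun x _ => heat_kernel_ge0 1 x)
  integrable_heat_kernel1 _ _ (fun z y => g (s y) (x y + Num.sqrt (tau y) *: z)) _ C) => //.
- by move=> y; apply: measurable_shift; exact: C0_measurable (regular_C0 _ gr).
- by apply: filterS sT => y sT z _; exact: gC.
Qed.

Lemma cvg_affine (Y : Type) (F : set_system Y) (tau : Y -> R) (x : Y -> 'rV[R]_N)
    (a : R) (b z : 'rV[R]_N) : Filter F -> tau @ F --> a -> x @ F --> b ->
  x y + Num.sqrt (tau y) *: z @[y --> F] --> b + Num.sqrt a *: z.
Proof.
move=> FF ta xb; apply: (@cvgD _ _ _ F) => //.
apply: (@cvgZr_tmp _ _ _ F) => //.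
apply: (continuous_cvg (F := F)) ta; exact: sqrt_continuous.
Qed.

(** For a fixed [z] the displacement [sqrt tau z] stays bounded. *)
Lemma cvg_affine_infty (Y : Type) (F : set_system Y) (tau : Y -> R) (x : Y -> 'rV[R]_N)
    (a : R) (z : 'rV[R]_N) : Filter F -> tau @ F --> a -> x @ F --> at_infty ->
  x y + Num.sqrt (tau y) *: z @[y --> F] --> at_infty.
Proof.
move=> FF ta xi A [M _ MA].
have st : Num.sqrt (tau y) @[y --> F] --> Num.sqrt a.
  apply: (continuous_cvg (F := F)) ta; exact: sqrt_continuous.
have sb : \forall y \near F, Num.sqrt (tau y) <= Num.sqrt a + 1.
  have : \forall y \near F, `|Num.sqrt a - Num.sqrt (tau y)| <= 1.
    by move/cvgrPdist_le : st; apply.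
  by apply: filterS => y; rewrite ler_norml; lra.
have xb : \forall y \near F, M + (Num.sqrt a + 1) * `|z| <= `|x y|.
  by apply: (xi [set v : 'rV[R]_N | M + (Num.sqrt a + 1) * `|z| <= `|v|]); exists (M + (Num.sqrt a + 1) * `|z|).
apply: filterS2 sb xb => y sb xb; apply: MA => /=.
apply: le_trans (lerB_normD _ _).
rewrite normrZ ger0_norm ?sqrtr_ge0//.
have : Num.sqrt (tau y) * `|z| <= (Num.sqrt a + 1) * `|z| by rewrite ler_wpM2r.
lra.
Qed.

Lemma cvg_le_near (Y : Type) (F : set_system Y) (s : Y -> R) (b : R) : Filter F ->
  s @ F --> b -> \forall y \near F, s y <= b + 1.
Proof.
move=> FF /cvgrPdist_le /(_ 1 ltr01); apply: filterS => y.
by rewrite ler_norml; lra.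
Qed.

Lemma heatS_cvg (Y : Type) (F : set_system Y) (tau s : Y -> R) (x : Y -> 'rV[R]_N)
    g (a b : R) (c : 'rV[R]_N) : Filter F -> has_countable_base F -> regular g ->
  tau @ F --> a -> s @ F --> b -> x @ F --> c ->
  heatS (tau y) (g (s y)) (x y) @[y --> F] --> heatS a (g b) c.
Proof.
move=> FF Fb gr ta sb xc.
apply: (heatS_cvg_dominated FF Fb gr (cvg_le_near FF sb)) => z.
have [gc _ _] := gr.
have H := @cvg_pair _ _ _ F (nbhs b) (nbhs (c + Num.sqrt a *: z)) FF (nbhs_filter _) (nbhs_filter _) s _ sb
  (cvg_affine (z := z) FF ta xc).
exact: (cvg_comp _ _ H (gc b _)).
Qed.

Lemma heatS_cvg_infty (Y : Type) (F : set_system Y) (tau s : Y -> R)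
    (x : Y -> 'rV[R]_N) g (a b : R) : Filter F -> has_countable_base F -> regular g ->
  tau @ F --> a -> s @ F --> b -> x @ F --> at_infty ->
  heatS (tau y) (g (s y)) (x y) @[y --> F] --> 0.
Proof.
move=> FF Fb gr ta sb xi.
rewrite (_ : 0 = \int[lebesgue_rV R N]_z (G z * 0)); last first.
  by under eq_Rintegral do rewrite mulr0; rewrite Rintegral_cst ?mul0r//; exact: measurableT.
apply: (heatS_cvg_dominated FF Fb gr (cvg_le_near FF sb)) => z.
have [_ gi _] := gr.
have H := @cvg_pair _ _ _ F (nbhs b) at_infty FF (nbhs_filter _) (at_infty_filter _ _) s _ sb
  (cvg_affine_infty z FF ta xi).
exact: (cvg_comp _ _ H (gi b)).
Qed.

Lemma base_nbhs_pair (t : R) (x : 'rV[R]_N) : has_countable_base (nbhs (t, x)).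
Proof. by apply: has_countable_base_prod; exact: has_countable_base_nbhs. Qed.

Lemma base_nbhs_infty (t : R) : has_countable_base (filter_prod (nbhs t) (@at_infty R N)).
Proof.
apply: has_countable_base_prod; first exact: has_countable_base_nbhs.
exact: has_countable_base_infty.
Qed.

Lemma regular_heatS f : C0 f -> regular (fun t => heatS t f).
Proof.
move=> C0f; have gr := regular_cst C0f; split.
- move=> t x.
  apply: (@heatS_cvg _ (nbhs (t, x)) (fun y => y.1) (fun=> 0) (fun y => y.2) _ t 0 x
    _ _ gr).
  + exact: base_nbhs_pair.
  + exact: cvg_fst.
  + exact: cvg_cst.
  + exact: cvg_snd.
- move=> t.
  apply: (@heatS_cvg_infty _ (filter_prod (nbhs t) at_infty) (fun y => y.1) (fun=> 0)
     (fun y => y.2) _ t 0 _ _ gr).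
  + exact: base_nbhs_infty.
  + exact: cvg_fst.
  + exact: cvg_cst.
  + exact: cvg_snd.
- move=> T; have [C _ fC] := C0_bounded C0f; exists C => t x _.
  by apply: heatS_le => //; exact: C0_measurable.
Qed.

End heatS_regularity.

(** * The Duhamel operator *)

Section duhamel.
Context (R : realType) (N : nat).
Implicit Types (g : R -> 'rV[R]_N -> R) (f : 'rV[R]_N -> R).

(** At a zero limit the derivative of the power is of no help; there the
continuity follows from monotonicity. *)
Lemma cvg_powR (Y : Type) (F : set_system Y) (s : Y -> R) (t c : R) : Filter F ->
  0 < c -> (forall y, 0 <= s y) -> 0 <= t -> s @ F --> t ->
  s y `^ c @[y --> F] --> t `^ c.
Proof.
move=> FF c0 s0; rewrite le_eqVlt => /predU1P[<-|t0] st; last first.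
  apply: (@continuous_cvg _ _ _ F FF s (fun a => a `^ c) t _ st).
  apply/differentiable_continuous/derivable1_diffP.
  by have [] := is_derive1_powR c t0.
rewrite powR0 ?gt_eqF//; apply/cvgrPdist_le => e e0.
have d0 : 0 < e `^ c^-1 by rewrite powR_gt0.
move/cvgrPdist_le : st => /(_ _ d0); apply: filterS => y.
rewrite !sub0r !normrN !ger0_norm ?powR_ge0// => sd.
rewrite -[leRHS](@powRr1 _ e) ?(ltW e0)// -(mulVf (lt0r_neq0 c0)) powRrM.
by rewrite ge0_ler_powR ?nnegrE ?(ltW c0) ?(ltW d0).
Qed.

(** Replacing [t] by its positive part extends curves on half-lines to the whole
line, where continuity needs no restriction to a subspace. *)
Definition tpos (t : R) : R := Num.max t 0.

Lemma tpos_ge0 t : 0 <= tpos t. Proof. by rewrite le_max lexx orbT. Qed.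

Lemma tpos_id t : 0 <= t -> tpos t = t.
Proof. by move=> t0; rewrite /tpos max_l. Qed.

Lemma continuous_tpos : continuous tpos.
Proof. by move=> t; apply: continuous_max; [exact: cvg_id|exact: cvg_cst]. Qed.

Lemma le_tpos t T : t <= T -> tpos t <= tpos T.
Proof. by move=> tT; rewrite /tpos ge_max !le_max tT lexx orbT. Qed.

(** The integral of [s^kappa S(t - s) g(s)] over [[0, t]] after the substitution
[s = t r] (see [mild_integralE]): neither the domain nor the weight depends
on [t].  The nonlinear term has [kappa = 0] and the source term a constant
[g]. *)
Definition duhamel (kappa : R) g (t : R) (x : 'rV[R]_N) : R :=
  tpos t `^ (1 + kappa) * \int[lebesgue_measure]_(s in `[0, 1])
    (s `^ kappa * heatS (tpos t * (1 - s)) (g (tpos t * s)) x).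

Lemma measurable_duhamel g (t : R) x : regular g ->
  measurable_fun (`[0, 1]%classic : set R) (fun s => heatS (t * (1 - s)) (g (t * s)) x).
Proof.
move=> gr; apply: measurable_funTS; apply: continuous_measurable_fun => s.
apply: (@heatS_cvg _ _ _ (nbhs s) (fun s => t * (1 - s)) (fun s => t * s) (fun=> x)) => //.
- exact: has_countable_base_nbhs.
- by apply: (@cvgMr _ _ (nbhs s)); apply: (@cvgB _ _ _ (nbhs s)); [exact: cvg_cst|exact: cvg_id].
- by apply: (@cvgMr _ _ (nbhs s)); exact: cvg_id.
- exact: cvg_cst.
Qed.

Lemma integrable_powR01 (kappa : R) : -1 < kappa ->
  (@lebesgue_measure R).-integrable `[0, 1] (EFin \o (fun s : R => s `^ kappa)).
Proof.
move=> k1; apply/integrableP; split.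
  by apply: measurable_funTS; apply/measurable_EFinP; exact: measurable_powR.
under eq_integral => s _ do rewrite /= ger0_norm ?powR_ge0//.
by apply: le_lt_trans (integral_powR_le k1) _; rewrite ltry.
Qed.

(** Each Duhamel integral is a weighted integral over [[0, 1]] of the heat flow of
[g], which converges along any filter along which [t] and [x] do. *)
Lemma regular_duhamel kappa g : -1 < kappa -> regular g -> regular (duhamel kappa g).
Proof.
move=> k1 gr; have [_ _ gb] := gr.
have pw (Y : Type) (F : set_system Y) (s : Y -> R) (t : R) : Filter F -> s @ F --> t ->
    tpos (s y) `^ (1 + kappa) @[y --> F] --> tpos t `^ (1 + kappa).
  move=> FF st; apply: (cvg_powR (F := F)).
  - by lra.
  - by move=> y; exact: tpos_ge0.
  - exact: tpos_ge0.
  - by apply: (@continuous_cvg _ _ _ F FF s tpos t _ st); exact: continuous_tpos.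
have ct (Y : Type) (F : set_system Y) (s : Y -> R) (t : R) (c : R) : Filter F -> s @ F --> t ->
    tpos (s y) * c @[y --> F] --> tpos t * c.
  move=> FF st; apply: (@cvgMl _ _ F).
  by apply: (@continuous_cvg _ _ _ F FF s tpos t _ st); exact: continuous_tpos.
have near_pos (Y : Type) (F : set_system Y) (s : Y -> R) (t : R) : Filter F -> s @ F --> t ->
    \forall y \near F, s y <= t + 1 by move=> FF; exact: cvg_le_near.
have dom (Y : Type) (F : set_system Y) (s : Y -> R) (x : Y -> 'rV[R]_N) (t : R) (l : R -> R) :
    Filter F -> has_countable_base F -> s @ F --> t ->
    (forall r : R, 0 <= r <= 1 ->
       heatS (tpos (s y) * (1 - r)) (g (tpos (s y) * r)) (x y) @[y --> F] --> l r) ->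
    duhamel kappa g (s y) (x y) @[y --> F] --> tpos t `^ (1 + kappa) *
      \int[lebesgue_measure]_(r in `[0, 1]) (r `^ kappa * l r).
  move=> FF Fb st hl; apply: (@cvgM _ _ F); first exact: pw.
  have [C gC] := gb (tpos (t + 1)).
  apply: (@weighted_dominated _ _ R lebesgue_measure `[0, 1]%classic (measurable_itv _)
    (fun r : R => r `^ kappa) (fun r _ => powR_ge0 r kappa) (integrable_powR01 k1) Y F
    (fun r y => heatS (tpos (s y) * (1 - r)) (g (tpos (s y) * r)) (x y)) l C) => //.
  - by move=> y; exact: measurable_duhamel.
  - apply: filterS (near_pos _ _ _ _ FF st) => y sy r /=; rewrite in_itv/= => /andP[r0 r1].
    apply: heatS_le => [|z]; first exact: C0_measurable (regular_C0 _ gr).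
    apply: gC; apply: le_trans (le_tpos sy).
    by rewrite ler_piMr ?tpos_ge0.
split.
- move=> t x.
  apply: (dom _ (nbhs (t, x)) (fun y => y.1) (fun y => y.2) t
    (fun r => heatS (tpos t * (1 - r)) (g (tpos t * r)) x) (nbhs_filter _)).
  + exact: base_nbhs_pair.
  + exact: cvg_fst.
  + move=> r _; apply: heatS_cvg => //.
    * exact: base_nbhs_pair.
    * by apply: ct; exact: cvg_fst.
    * by apply: ct; exact: cvg_fst.
    * exact: cvg_snd.
- move=> t.
  rewrite (_ : 0 = tpos t `^ (1 + kappa) *
      \int[lebesgue_measure]_(r in `[0, 1]) (r `^ kappa * 0)); last first.
    by under eq_Rintegral do rewrite mulr0; rewrite Rintegral_cst ?mul0r ?mulr0.
  apply: (dom _ (filter_prod (nbhs t) at_infty) (fun y => y.1) (fun y => y.2) t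
    (fun=> 0) _).
  + exact: base_nbhs_infty.
  + exact: cvg_fst.
  + move=> r _; apply: (@heatS_cvg_infty _ _ _ _ _ _ _ _ (tpos t * (1 - r)) (tpos t * r)) => //.
    * exact: base_nbhs_infty.
    * by apply: ct; exact: cvg_fst.
    * by apply: ct; exact: cvg_fst.
    * exact: cvg_snd.
- move=> T; have [C gC] := gb (tpos T).
  exists (tpos T `^ (1 + kappa) * (Num.max C 0 * \int[lebesgue_measure]_(r in `[0, 1]) (r `^ kappa))).
  move=> t x tT; rewrite normrM ger0_norm ?powR_ge0//.
  apply: ler_pM; rewrite ?powR_ge0//.
    by rewrite ge0_ler_powR ?nnegrE ?tpos_ge0 ?le_tpos//; lra.
  apply: (@weighted_le_cst _ _ R lebesgue_measure `[0, 1]%classic (measurable_itv _)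
    (fun r : R => r `^ kappa) (fun r _ => powR_ge0 r kappa) (integrable_powR01 k1)).
  + exact: measurable_duhamel.
  + move=> r; rewrite /= in_itv/= => /andP[r0 r1].
    apply: heatS_le => [|z]; first exact: C0_measurable (regular_C0 _ gr).
    rewrite le_max gC//; apply: le_trans (le_tpos tT).
    by rewrite ler_piMr ?tpos_ge0.
Qed.

End duhamel.

(** * Closure properties of regular families *)

Section regular_closure.
Context (R : realType) (N : nat).
Implicit Types (g : R -> 'rV[R]_N -> R) (f : 'rV[R]_N -> R).

Lemma regular_powR p g : 0 < p -> regular g -> regular (fun t x => `|g t x| `^ p).
Proof.
move=> p0 [gc gi gb]; split.
- move=> t x; apply: (cvg_powR (F := nbhs (t, x))) => //.
  apply: (@cvg_norm _ _ _ (nbhs (t, x))); exact: gc.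
- move=> t; rewrite -(@powR0 _ p) ?gt_eqF//.
  apply: (cvg_powR (F := filter_prod (nbhs t) at_infty)) => //.
  rewrite -(@normr0 _ R); apply: (@cvg_norm _ _ _ (filter_prod (nbhs t) at_infty)).
  exact: gi.
- move=> T; have [C gC] := gb T; exists (Num.max C 0 `^ p) => t x tT.
  rewrite ger0_norm ?powR_ge0// ge0_ler_powR ?nnegrE ?(ltW p0)//.
    by rewrite le_max lexx orbT.
  by rewrite le_max gC.
Qed.

(** Uniform limits inherit joint continuity and decay; uniformity is needed on
bounded time intervals only. *)
Lemma regular_limit (gn : nat -> R -> 'rV[R]_N -> R) g : (forall n, regular (gn n)) ->
  (forall T e, 0 < e -> exists n, forall t x, t <= T -> `|g t x - gn n t x| <= e) ->
  regular g.
Proof.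
move=> gr H.
have L (F : set_system (R * 'rV[R]_N)) (t : R) (l : R) (ln : nat -> R) : Filter F ->
    (fun y => y.1) @ F --> t ->
    (forall n, (fun y : R * 'rV[R]_N => gn n y.1 y.2) @ F --> ln n) ->
    (forall e, 0 < e -> exists n, (forall t' x, t' <= t + 1 -> `|g t' x - gn n t' x| <= e) /\
       `|l - ln n| <= e) ->
    (fun y : R * 'rV[R]_N => g y.1 y.2) @ F --> l.
  move=> FF yt gnl ll; apply/cvgrPdist_le => e e0.
  have e3 : 0 < e / 3 by rewrite divr_gt0.
  have [n [gn1 ln1]] := ll _ e3.
  have /cvgrPdist_le/(_ _ e3) := gnl n.
  apply: filterS2 (cvg_le_near FF yt) => y y1 y2.
  have /= y3 := gn1 _ y.2 y1.
  move: ln1 y2 y3; rewrite !ler_norml /=; lra.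
split.
- move=> t x; apply: (L _ t _ (fun n => gn n t x)); first exact: cvg_fst.
    by move=> n; have [gc _ _] := gr n; exact: gc.
  move=> e /(H (t + 1))[n Hn]; exists n; split; first exact: Hn.
  by apply: Hn; rewrite lerDl.
- move=> t; apply: (L _ t _ (fun=> 0)); first exact: cvg_fst.
    by move=> n; have [_ gi _] := gr n; exact: gi.
  move=> e e0; have [n Hn] := H (t + 1) _ e0; exists n; split; first exact: Hn.
  by rewrite subrr normr0 ltW.
- move=> T; have [n Hn] := H T 1 ltr01; have [_ _ /(_ T)[C gC]] := gr n.
  exists (C + 1) => t x tT; have := Hn _ x tT; have := gC _ x tT.
  by rewrite !ler_norml; lra.
Qed.

(** Outside a large ball both functions are small by uniform decay; on the ball,
which is compact, joint continuity is uniform in space. *)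
Lemma regular_C0_path g (I : set R) : regular g -> C0_path I g.
Proof.
move=> gr; split; first by move=> t _; exact: regular_C0.
apply: continuous_subspaceT => t A /uniform_nbhs[E [entE EA]].
move: entE; rewrite -entourage_from_ballE => -[e /= e0 eE].
have [gc gi _] := gr.
have e2 : 0 < e / 3 by rewrite divr_gt0.
have [cg _] := regular_C0 t gr.
have /cvgrPdist_le/(_ _ e2)[[P Q] [/= tP [M _ MQ]] PQ] := gi t.
pose K : set 'rV[R]_N := [set x | `|x| <= M].
have cK : compact K.
  apply: bounded_closed_compact.
    by exists M; split; [exact: num_real|move=> M' AM x /= /le_trans; apply; exact: ltW].
  rewrite (_ : K = (fun x => `|x|) @^-1` [set y | y <= M]); last by [].
  by apply: closed_comp => [x _|]; [exact: norm_continuous|exact: closed_le].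
have near_cov := (compact_near_coveringP K).1 cK R (nbhs t)
  (fun t' x => `|g t x - g t' x| < e) _.
have : \forall t' \near t, K `<=` (fun x => `|g t x - g t' x| < e).
  apply: near_cov => x Kx.
  have /cvgrPdist_le/(_ _ e2)[[P1 Q1] [/= tP1 xQ1] PQ1] := gc t x.
  have /cvgrPdist_le/(_ _ e2) xQ2 := cg x.
  exists (Q1 `&` [set x' | `|g t x - g t x'| <= e / 3], P1); first by split => //=; exact: filterI.
  move=> [x' t'] [/= [x'Q1 x'2] t'P1].
  have := PQ1 (t', x') (conj t'P1 x'Q1) => /=.
  move: x'2; rewrite !ler_norml ltr_norml; lra.
have Pt := nbhs_singleton tP.
apply: filterS2 tP => t' Pt' Kt'; apply: EA => x _; apply: eE => /=.
have [xM|Mx] := leP `|x| M; first exact: Kt'.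
have := PQ (t', x) (conj Pt' (MQ _ (ltW Mx))).
have := PQ (t, x) (conj Pt (MQ _ (ltW Mx))).
rewrite /ball /= !ler_norml ltr_norml; lra.
Qed.

End regular_closure.

(** * Rescaling time to the unit interval *)

Section time_scaling.
Context (R : realType).

Lemma ge0_integral_itv_scale (t : R) (f : measurableTypeR R -> \bar R) : 0 < t ->
  measurable_fun setT f -> (forall s, 0 <= f s)%E ->
  (\int[lebesgue_measure]_(s in `[0%R, t]) f s =
   t%:E * \int[lebesgue_measure]_(r in `[0%R, 1%R]) f (t * r)%R)%E.
Proof.
move=> t0 mf f0.
rewrite integral_mkcond [in RHS]integral_mkcond.
rewrite (ge0_integral_affine1 0 t0); last 2 first.
- by apply/(measurable_restrictT _ _).1 => //; exact: measurable_funTS.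
- by move=> z; rewrite patchE; case: ifP.
congr (_ * _)%E; apply: eq_integral => r _.
rewrite !patchE add0r; congr (if _ then _ else _).
apply/idP/idP; rewrite !inE/= !in_itv/=.
  by rewrite pmulr_rge0// -ler_pdivlMl// mulVf ?gt_eqF.
by rewrite pmulr_rge0// -[X in _ -> _ && X]ler_pdivlMl// mulVf ?gt_eqF.
Qed.

Lemma Rintegral_itv_scale (t : R) (f : measurableTypeR R -> R) : 0 < t ->
  measurable_fun setT f ->
  \int[lebesgue_measure]_(s in `[0, t]) f s =
   t * \int[lebesgue_measure]_(r in `[0, 1]) f (t * r).
Proof.
move=> t0 mf; rewrite /Rintegral integralE.
have mf' : measurable_fun setT (EFin \o f) by exact/measurable_EFinP.
have mp : measurable_fun setT (EFin \o f)^\+%E by exact: measurable_funepos.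
have mn : measurable_fun setT (EFin \o f)^\-%E by exact: measurable_funeneg.
rewrite (ge0_integral_itv_scale t0 mp (fun s => funepos_ge0 _ s)).
rewrite (ge0_integral_itv_scale t0 mn (fun s => funeneg_ge0 _ s)).
have -> : (\int[lebesgue_measure]_(r in `[0%R, 1%R]) (f (t * r)%R)%:E =
  \int[lebesgue_measure]_(r in `[0%R, 1%R]) (EFin \o f)^\+ (t * r)%R -
  \int[lebesgue_measure]_(r in `[0%R, 1%R]) (EFin \o f)^\- (t * r)%R)%E.
  by rewrite integralE; congr (_ - _)%E; apply: eq_integral => r _; rewrite ?funeposE ?funenegE.
set a := (\int[_]_(_ in _) _)%E; set b := (\int[_]_(_ in _) _)%E.
have a0 : (0 <= a)%E by exact: integral_ge0.
have b0 : (0 <= b)%E by exact: integral_ge0.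
move: a b a0 b0 => [a| |] [b| |] //= a0 b0.
- by rewrite mulrBr.
- by rewrite gt0_muley ?lte_fin//= mulr0.
- by rewrite gt0_muley ?lte_fin//= mulr0.
- by rewrite gt0_muley ?lte_fin//= mulr0.
Qed.

Lemma ge0_Rintegral_le d (T : measurableType d) (mu : {measure set T -> \bar R})
    (D : set T) (f : T -> R) (c : R) : (forall x, D x -> 0 <= f x) ->
  (\int[mu]_(x in D) (f x)%:E <= c%:E)%E -> \int[mu]_(x in D) f x <= c.
Proof.
move=> f0 fc; rewrite /Rintegral -lee_fin fineK//.
rewrite ge0_fin_numE; first by rewrite (le_lt_trans fc)// ltry.
by apply: integral_ge0 => x Dx; rewrite lee_fin f0.
Qed.

End time_scaling.

(** * Duhamel integrals: the mild form and differences *)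

Section duhamel_estimates.
Context (R : realType) (N : nat).
Implicit Types (g : R -> 'rV[R]_N -> R) (f : 'rV[R]_N -> R).

Lemma heatSB t f1 f2 x : C0 f1 -> C0 f2 ->
  heatS t f1 x - heatS t f2 x = heatS t (fun y => f1 y - f2 y) x.
Proof.
move=> C1 C2; rewrite /heatS -RintegralB//.
- by apply: eq_Rintegral => z _; rewrite mulrBr.
- have [C _ fC] := C0_bounded C1.
  apply: (integrable_weighted measurableT (integrable_heat_kernel1 _ _) (C := C)) => //.
  by apply: measurable_shift; exact: C0_measurable.
- have [C _ fC] := C0_bounded C2.
  apply: (integrable_weighted measurableT (integrable_heat_kernel1 _ _) (C := C)) => //.
  by apply: measurable_shift; exact: C0_measurable.
Qed.

(** The linear substitution [s = t r], valid for measurable integrands because it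
is an identity of measures; [t = 0] is treated apart. *)
Lemma mild_integralE kappa g t x : -1 < kappa -> regular g -> 0 <= t ->
  \int[lebesgue_measure]_(s in `[0, t]) (s `^ kappa * heat_semigroup (t - s) (g s) x) =
  duhamel kappa g t x.
Proof.
move=> k1 gr; rewrite le_eqVlt => /predU1P[<-|t0].
  rewrite set_itv1 Rintegral_set1 /duhamel tpos_id// powR0 ?mul0r//.
  by rewrite gt_eqF//; lra.
rewrite /duhamel tpos_id ?(ltW t0)//.
transitivity (\int[lebesgue_measure]_(s in `[0, t]) (s `^ kappa * heatS (t - s) (g s) x)).
  apply: eq_Rintegral => s; rewrite inE/= in_itv/= => /andP[s0 st].
  rewrite heat_semigroupE ?subr_ge0//; exact: C0_measurable (regular_C0 _ gr).
have mF : measurable_fun setT (fun s : R => s `^ kappa * heatS (t - s) (g s) x).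
  apply: measurable_funM; first exact: measurable_powR.
  apply: continuous_measurable_fun => s.
  apply: (@heatS_cvg _ _ _ (nbhs s) (fun s => t - s) (fun s => s) (fun=> x)) => //.
  - exact: has_countable_base_nbhs.
  - by apply: (@cvgB _ _ _ (nbhs s)); [exact: cvg_cst|exact: cvg_id].
  - exact: cvg_cst.
rewrite (Rintegral_itv_scale t0 mF).
have -> : t `^ (1 + kappa) = t * t `^ kappa.
  by rewrite powRD ?powRr1 ?(ltW t0)//; apply/implyP => _; rewrite gt_eqF.
rewrite -mulrA; congr (_ * _); rewrite -RintegralZl.
- apply: eq_Rintegral => r; rewrite inE/= in_itv/= => /andP[r0 r1].
  have -> : (t * r) `^ kappa = t `^ kappa * r `^ kappa by rewrite powRM// ltW.
  have -> : t - t * r = t * (1 - r) by rewrite mulrBr mulr1.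
  by rewrite mulrA.
- exact: measurable_itv.
- have [_ _ /(_ t)[C gC]] := gr.
  apply: (@integrable_weighted _ _ R lebesgue_measure _ (measurable_itv _) _
    (integrable_powR01 k1) (fun r => heatS (t * (1 - r)) (g (t * r)) x) C).
  + exact: measurable_duhamel.
  + move=> r; rewrite /= in_itv/= => /andP[r0 r1].
    apply: heatS_le => [|z]; first exact: C0_measurable (regular_C0 _ gr).
    by apply: gC; rewrite ler_piMr// ltW.
Qed.

(** Integrating [exp (lambda s)] gains a factor [1 / lambda]: for a large
[lambda] the Duhamel operator is as contractive as desired in the weighted
sup norm. *)
Lemma duhamel_sub_le g1 g2 t x (D lambda : R) : regular g1 -> regular g2 -> 0 <= t -> 0 < lambda ->
  0 <= D ->
  (forall s y, 0 <= s <= t -> `|g1 s y - g2 s y| <= D * expR (lambda * s)) ->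
  `|duhamel 0 g1 t x - duhamel 0 g2 t x| <= D / lambda * expR (lambda * t).
Proof.
move=> r1 r2 t0 l0 D0 H.
rewrite /duhamel addr0 tpos_id// powRr1// -mulrBr normrM ger0_norm//.
have k1 : -1 < 0 :> R by lra.
have int g : regular g -> lebesgue_measure.-integrable (`[0, 1]%classic : set R)
   (fun r => (r `^ 0 * heatS (t * (1 - r)) (g (t * r)) x)%:E).
  move=> gr; have [_ _ /(_ t)[C gC]] := gr.
  apply: (@integrable_weighted _ _ R lebesgue_measure _ (measurable_itv _) _
    (integrable_powR01 k1) (fun r => heatS (t * (1 - r)) (g (t * r)) x) C).
  + exact: measurable_duhamel.
  + move=> r; rewrite /= in_itv/= => /andP[ra rb].
    apply: heatS_le => [|z]; first exact: C0_measurable (regular_C0 _ gr).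
    by apply: gC; rewrite ler_piMr.
rewrite -RintegralB//; last 2 first.
- exact: int.
- exact: int.
set I := \int[_]_(_ in _) _.
have -> : I = \int[lebesgue_measure]_(r in `[0, 1]) (r `^ 0 *
    heatS (t * (1 - r)) (fun y => g1 (t * r) y - g2 (t * r) y) x).
  by apply: eq_Rintegral => r _; rewrite -mulrBr heatSB//; exact: regular_C0.
pose m (r : R) := D * expR (lambda * (t * r)).
have mm : measurable_fun (`[0, 1]%classic : set R) m.
  apply: measurable_funTS; apply: measurable_funM => //.
  apply: (measurableT_comp (@measurable_expR R)).
  by do 2 apply: measurable_funM => //.
have [te0|tn0] := eqVneq t 0.
  by rewrite [X in X * `|_|]te0 mul0r mulr_ge0 ?divr_ge0 ?expR_ge0// ltW.
have {tn0} tp : 0 < t by rewrite lt_neqAle eq_sym tn0.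
have lt0 : 0 < lambda * t by rewrite mulr_gt0.
have le1 : `|\int[lebesgue_measure]_(r in `[0, 1])
   (r `^ 0 * heatS (t * (1 - r)) (fun y => g1 (t * r) y - g2 (t * r) y) x)| <=
   \int[lebesgue_measure]_(r in `[0, 1]) (r `^ 0 * m r).
  apply: (@weighted_norm_le _ _ R lebesgue_measure `[0, 1]%classic (measurable_itv _)
    (fun r : R => r `^ 0) (fun r _ => powR_ge0 r 0) (integrable_powR01 k1)
    (fun r => heatS (t * (1 - r)) (fun y => g1 (t * r) y - g2 (t * r) y) x) m
    (D * expR (lambda * t))) => //.
  - rewrite (_ : (fun r : R => _) = (fun r => heatS (t * (1 - r)) (g1 (t * r)) x -
        heatS (t * (1 - r)) (g2 (t * r)) x)).
      by apply: measurable_funB; exact: measurable_duhamel.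
    by apply/funext => r; rewrite heatSB//; exact: regular_C0.
  - move=> r; rewrite /= in_itv/= => /andP[ra rb].
    apply: heatS_le => [|y].
      by apply: measurable_funB; exact: C0_measurable (regular_C0 _ _).
    by apply: H; rewrite mulr_ge0 ?ler_piMr.
  - move=> r; rewrite /= in_itv/= => /andP[ra rb].
    by rewrite /m ler_wpM2l// ler_expR ler_wpM2l ?(ltW l0)// ler_piMr.
apply: (@le_trans _ _ (t * (D / (lambda * t) * expR (lambda * t)))); last first.
  rewrite le_eqVlt; apply/orP; left; apply/eqP; field.
  by rewrite !gt_eqF.
rewrite ler_wpM2l//; apply: (le_trans le1).
apply: ge0_Rintegral_le => [r _|]; first by rewrite mulr_ge0 ?powR_ge0// mulr_ge0 ?expR_ge0.
rewrite -[X in (_ <= X%:E)%E]subr0.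
apply: (ge0_integral_le_primitive (F := fun r => D / (lambda * t) * expR (lambda * (t * r)))).
- by move=> r _; rewrite mulr_ge0 ?powR_ge0// mulr_ge0 ?expR_ge0.
- move=> r _.
  suff cm : (fun s : R => s `^ 0 * m s) @ nbhs r --> r `^ 0 * m r by exact: cm.
  rewrite powRr0 mul1r; under eq_fun do rewrite powRr0 mul1r.
  apply: (@cvgMr _ _ (nbhs r)).
  apply: (@continuous_cvg _ _ _ (nbhs r) _ (fun s : R => lambda * (t * s)) expR).
    exact: continuous_expR.
  by apply: (@cvgMr _ _ (nbhs r)); apply: (@cvgMr _ _ (nbhs r)); exact: cvg_id.
- move=> r _; rewrite powRr0 mul1r /m.
  have d1 : is_derive r 1 (fun r => lambda * (t * r)) (lambda * t).
    by apply: is_derive_eq; rewrite /GRing.scale/= mulr1.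
  have d2 : is_derive (lambda * (t * r)) 1 expR (expR (lambda * (t * r))) by exact: is_derive_expR.
  have d3 := @is_derive1_comp _ expR (fun r : R => lambda * (t * r)) r _ _ d2 d1.
  have d4 : is_derive r 1 ((D / (lambda * t)) *: (expR \o (fun r : R => lambda * (t * r))))
    ((D / (lambda * t)) *: (expR (lambda * (t * r)) * (lambda * t))) by exact: is_deriveZ.
  apply: (is_derive_eq d4); rewrite /GRing.scale/=; field.
  by rewrite !gt_eqF.
- move=> r /andP[ra rb]; apply/andP; split.
    by rewrite mulr_ge0 ?expR_ge0// divr_ge0// ltW.
  rewrite ler_wpM2l ?divr_ge0 ?(ltW lt0)// ler_expR ler_wpM2l ?(ltW l0)// ler_piMr ?ltW//.
Qed.

End duhamel_estimates.

(** * Jensen's inequality for powers *)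

Section jensen_power.
Context d (T : measurableType d) (R : realType) (mu : {measure set T -> \bar R}).

(** [weighted_jensen] with the optimal constant, allowing an infinite right-hand
side. *)
Lemma jensen_powR (D : set T) (k h : T -> R) (r W : R) : measurable D ->
  (forall x, D x -> 0 <= k x) -> measurable_fun D k -> measurable_fun D h ->
  (forall x, D x -> 0 <= h x) -> 1 <= r -> 0 < W ->
  (\int[mu]_(x in D) (k x)%:E <= W%:E)%E ->
  (((\int[mu]_(x in D) (k x * h x)) `^ r)%:E <=
   (W `^ (r - 1))%:E * \int[mu]_(x in D) (k x * h x `^ r)%:E)%E.
Proof.
move=> mD k0 mk mh h0 r1 W0 kW.
have r0 : 0 < r by rewrite (lt_le_trans _ r1).
have ik : mu.-integrable D (EFin \o k).
  apply/integrableP; split; first exact/measurable_EFinP.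
  rewrite (eq_integral (fun x => (k x)%:E)).
    by rewrite (le_lt_trans kW)// ltry.
  by move=> x /[!inE] Dx; rewrite /= ger0_norm// k0.
have I0 : (0 <= \int[mu]_(x in D) (k x * h x `^ r)%:E)%E.
  by apply: integral_ge0 => x Dx; rewrite lee_fin mulr_ge0 ?powR_ge0 ?k0.
have Wr : 0 < W `^ (r - 1) by rewrite powR_gt0.
case IE : (\int[mu]_(x in D) (k x * h x `^ r)%:E)%E I0 => [i| |] //.
- rewrite lee_fin => i0; rewrite -EFinM lee_fin.
  have iW : 0 <= i / W by rewrite divr_ge0// ltW.
  have J : (\int[mu]_(x in D) (k x * h x)%:E <= (W * (i / W) `^ r^-1)%:E)%E.
    apply: (weighted_jensen mD k0 ik mh h0 r1 W0 (powR_ge0 _ _) kW).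
    rewrite IE lee_fin -powRrM mulVf ?gt_eqF// powRr1// mulrCA divff ?mulr1//.
    by rewrite gt_eqF.
  have {}J : \int[mu]_(x in D) (k x * h x) <= W * (i / W) `^ r^-1.
    by apply: ge0_Rintegral_le J => x Dx; rewrite mulr_ge0 ?k0 ?h0.
  have J0 : 0 <= \int[mu]_(x in D) (k x * h x).
    by apply: Rintegral_ge0 => x Dx; rewrite mulr_ge0 ?k0 ?h0.
  apply: (@le_trans _ _ ((W * (i / W) `^ r^-1) `^ r)).
    by rewrite ge0_ler_powR ?nnegrE ?(ltW r0) ?mulr_ge0 ?powR_ge0 ?(ltW W0).
  rewrite powRM ?powR_ge0 ?(ltW W0)// -powRrM mulVf ?gt_eqF// powRr1//.
  rewrite (_ : W `^ r = W `^ (r - 1) * W).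
    by rewrite -mulrA [W * _]mulrC divfK ?gt_eqF.
  rewrite -[X in _ = _ * X](powRr1 (ltW W0)) -powRD ?subrK//.
  by apply/implyP => _; rewrite gt_eqF.
- by move=> _; rewrite gt0_muley ?leey// lte_fin.
Qed.

End jensen_power.

(** * Bounds in Lebesgue spaces *)

Section Lp_bounds.
Context (R : realType) (N : nat).
Implicit Types (g : R -> 'rV[R]_N -> R) (f : 'rV[R]_N -> R).
Local Notation mu := (lebesgue_rV R N).

(** The norm of [f] in [L^r] is at most [C], for explicit constants: powers,
suprema over time and infinite values need no extended-real arithmetic. *)
Definition Lp_le (r : R) f (C : R) : Prop :=
  (\int[mu]_x (`|f x| `^ r)%:E <= (C `^ r)%:E)%E.

Lemma measurable_normpow f (r : R) : measurable_fun setT f ->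
  measurable_fun setT (fun x => (`|f x| `^ r)%:E).
Proof.
move=> mf; apply/measurable_EFinP; apply: (measurableT_comp (measurable_powR r)).
exact: measurableT_comp.
Qed.

Lemma Lp_le_trans r f1 f2 C1 C2 : 0 <= r -> measurable_fun setT f1 -> measurable_fun setT f2 ->
  0 <= C1 -> C1 <= C2 ->
  (forall x, `|f1 x| <= `|f2 x|) -> Lp_le r f2 C1 -> Lp_le r f1 C2.
Proof.
move=> r0 m1 m2 C0 CC ff H; apply: le_trans (le_trans H _).
  apply: ge0_le_integral; first exact: measurableT.
  - by move=> x _; rewrite lee_fin powR_ge0.
  - exact: measurable_normpow.
  - exact: measurable_normpow.
  - by move=> x _; rewrite lee_fin ge0_ler_powR ?nnegrE.
by rewrite lee_fin ge0_ler_powR ?nnegrE// (le_trans C0).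
Qed.

Lemma Lp_le_powR p r f C : 0 < p -> 0 <= C -> Lp_le r f C ->
  Lp_le (r / p) (fun x => `|f x| `^ p) (C `^ p).
Proof.
move=> p0 C0; rewrite /Lp_le -powRrM mulrCA divff ?gt_eqF// mulr1.
apply: le_trans; rewrite le_eqVlt; apply/orP; left; apply/eqP.
apply: eq_integral => x _; rewrite ger0_norm ?powR_ge0// -powRrM mulrCA.
by rewrite divff ?gt_eqF// mulr1.
Qed.

Lemma Lp_le_interp r rho f C K : 0 < r -> r <= rho -> 0 <= C -> 0 <= K ->
  measurable_fun setT f ->
  (forall x, `|f x| <= K) -> Lp_le r f C ->
  Lp_le rho f (K `^ (1 - r / rho) * C `^ (r / rho)).
Proof.
move=> r0 rr C0 K0 mf fK H; have rho0 : 0 < rho by rewrite (lt_le_trans r0).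
rewrite /Lp_le powRM ?powR_ge0// -!powRrM divfK ?gt_eqF// mulrBl mul1r divfK ?gt_eqF//.
apply: (@le_trans _ _ (\int[mu]_x ((K `^ (rho - r))%:E * (`|f x| `^ r)%:E))%E).
  apply: ge0_le_integral; first exact: measurableT.
  - by move=> x _; rewrite lee_fin powR_ge0.
  - exact: measurable_normpow.
  - by apply: measurable_funeM; exact: measurable_normpow.
  - move=> x _; rewrite -EFinM lee_fin.
    have -> : `|f x| `^ rho = `|f x| `^ (rho - r) * `|f x| `^ r.
      rewrite -powRD; first by rewrite subrK.
      by apply/implyP; rewrite subrK => /eqP E; move: rho0; rewrite E ltxx.
    by rewrite ler_wpM2r ?powR_ge0// ge0_ler_powR ?nnegrE ?subr_ge0.
rewrite ge0_integralZl.
- by rewrite EFinM; apply: lee_wpmul2l; rewrite ?lee_fin ?powR_ge0.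
- exact: measurableT.
- exact: measurable_normpow.
- by move=> x _; rewrite lee_fin powR_ge0.
- by rewrite lee_fin powR_ge0.
Qed.

(** The factor 4 replaces Minkowski's inequality by the convexity bound
[(x + y)^r <= 2^r (x^r + y^r)]; only the linear dependence on the norms
matters. *)
Lemma Lp_leD r f1 f2 C1 C2 : 1 <= r -> measurable_fun setT f1 -> measurable_fun setT f2 ->
  0 <= C1 -> 0 <= C2 -> Lp_le r f1 C1 -> Lp_le r f2 C2 ->
  Lp_le r (fun x => f1 x + f2 x) (4 * (C1 + C2)).
Proof.
move=> r1 m1 m2 C10 C20 H1 H2.
have r0 : 0 <= r by rewrite (le_trans _ r1).
have two : 0 <= 2 `^ r :> R by exact: powR_ge0.
apply: (@le_trans _ _ (\int[mu]_x ((2 `^ r)%:E * ((`|f1 x| `^ r)%:E + (`|f2 x| `^ r)%:E)))%E).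
  apply: ge0_le_integral; first exact: measurableT.
  - by move=> x _; rewrite lee_fin powR_ge0.
  - by apply: measurable_normpow; exact: measurable_funD.
  - by apply: measurable_funeM; apply: emeasurable_funD; exact: measurable_normpow.
  - move=> x _; rewrite -EFinD -EFinM lee_fin.
    apply: (@le_trans _ _ ((2 * Num.max `|f1 x| `|f2 x|) `^ r)).
      rewrite ge0_ler_powR ?nnegrE ?mulr_ge0 ?le_max ?normr_ge0//.
      apply: (le_trans (ler_normD _ _)).
      have : `|f1 x| <= Num.max `|f1 x| `|f2 x| by rewrite le_max lexx.
      have : `|f2 x| <= Num.max `|f1 x| `|f2 x| by rewrite le_max lexx orbT.
      lra.
    rewrite powRM ?le_max ?normr_ge0// ler_wpM2l//.
    by case: (leP `|f1 x| `|f2 x|) => _; rewrite ?lerDl ?lerDr powR_ge0.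
rewrite ge0_integralZl; last 4 first.
- exact: measurableT.
- by apply: emeasurable_funD; exact: measurable_normpow.
- by move=> x _; rewrite adde_ge0// lee_fin powR_ge0.
- by rewrite lee_fin.
rewrite ge0_integralD; last 5 first.
- exact: measurableT.
- by move=> x _; rewrite lee_fin powR_ge0.
- exact: measurable_normpow.
- by move=> x _; rewrite lee_fin powR_ge0.
- exact: measurable_normpow.
apply: (@le_trans _ _ ((2 `^ r)%:E * ((C1 `^ r)%:E + (C2 `^ r)%:E))%E).
  by apply: lee_wpmul2l; rewrite ?lee_fin//; exact: leeD.
rewrite -EFinD -EFinM lee_fin.
have -> : 4 = 2 * 2 :> R by lra.
rewrite -mulrA [leRHS]powRM ?mulr_ge0 ?addr_ge0// ler_wpM2l//.
rewrite powRM ?addr_ge0//.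
apply: (@le_trans _ _ (2 * (C1 + C2) `^ r)).
  have : C1 `^ r <= (C1 + C2) `^ r by rewrite ge0_ler_powR ?nnegrE ?addr_ge0 ?lerDl.
  have : C2 `^ r <= (C1 + C2) `^ r by rewrite ge0_ler_powR ?nnegrE ?addr_ge0 ?lerDr.
  lra.
rewrite ler_wpM2r ?powR_ge0//.
by rewrite -[leLHS]powRr1// ler_powR//; lra.
Qed.

End Lp_bounds.

(** * Smoothing by the heat semigroup *)

Section heatS_Lp.
Context (R : realType) (N : nat).
Implicit Types (g : R -> 'rV[R]_N -> R) (f : 'rV[R]_N -> R).
Local Notation mu := (lebesgue_rV R N).

(** The kernel has mass 1, so this is Jensen's inequality at each point. *)
Lemma heatS_powR_le a t f x : 1 <= a -> C0 f ->
  ((`|heatS t f x| `^ a)%:E <=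
   \int[mu]_z ((heat_kernel 1 z)%:E * (`|f (x + Num.sqrt t *: z)%R| `^ a)%:E))%E.
Proof.
move=> a1 C0f; have a0 : 0 <= a by rewrite (le_trans _ a1).
have mf := C0_measurable C0f; have [C _ fC] := C0_bounded C0f.
have mh : measurable_fun setT (fun z : 'rV[R]_N => `|f (x + Num.sqrt t *: z)|).
  by apply: measurableT_comp => //; exact: measurable_shift.
have := @jensen_powR _ _ R mu setT (@heat_kernel R N 1) _ a 1 measurableT
  (fun z _ => heat_kernel_ge0 1 z) (@measurable_heat_kernel R N 1) mh
  (fun z _ => normr_ge0 _) a1 ltr01.
rewrite integral_heat_kernel => /(_ (lexx _)).
rewrite powR1 mul1e => J.
apply: le_trans (le_trans J _); last first.
  by rewrite le_eqVlt; apply/orP; left; apply/eqP; apply: eq_integral => z _.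
rewrite lee_fin ge0_ler_powR ?nnegrE//.
  by apply: Rintegral_ge0 => z _; rewrite mulr_ge0 ?heat_kernel_ge0.
apply: (@weighted_norm_le _ _ R mu setT measurableT (@heat_kernel R N 1)
  (fun z _ => heat_kernel_ge0 1 z) (@integrable_heat_kernel1 R N)
  (fun z => f (x + Num.sqrt t *: z)) _ C) => //.
exact: measurable_shift.
Qed.

(** Jensen's inequality pointwise, then Tonelli and translation invariance. *)
Lemma Lp_le_heatS a t f C : 1 <= a -> C0 f -> Lp_le a f C -> Lp_le a (heatS t f) C.
Proof.
move=> a1 C0f H; apply: le_trans H.
have mf := C0_measurable C0f.
pose c := Num.sqrt t.
have mF : measurable_fun setT (fun y : 'rV[R]_N => (`|f y| `^ a)%:E) by exact: measurable_normpow.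
pose phi (y : 'rV[R]_N * 'rV[R]_N) : 'rV[R]_N := y.1 + c *: y.2.
have mphi : measurable_fun setT phi.
  apply: measurable_fun_rV => i; under eq_fun do rewrite !mxE.
  apply: measurable_funD.
    by apply: (@measurableT_comp _ _ _ _ _ _ (fun v : 'rV[R]_N => v ord0 i)) => //; exact: measurable_coord.
  apply: measurable_funM => //.
  by apply: (@measurableT_comp _ _ _ _ _ _ (fun v : 'rV[R]_N => v ord0 i)) => //; exact: measurable_coord.
pose Phi (y : 'rV[R]_N * 'rV[R]_N) := ((heat_kernel 1 y.2)%:E * (`|f (phi y)| `^ a)%:E)%E.
have mPhi : measurable_fun setT Phi.
  apply: emeasurable_funM; last exact: (measurableT_comp mF mphi).
  apply/measurable_EFinP; apply: (measurableT_comp (@measurable_heat_kernel R N 1)).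
  exact: measurable_snd.
have Phi0 y : (0 <= Phi y)%E by rewrite mule_ge0// lee_fin ?powR_ge0 ?heat_kernel_ge0.
apply: (@le_trans _ _ (\int[mu]_x \int[mu]_z Phi (x, z))%E).
  apply: ge0_le_integral; first exact: measurableT.
  - by move=> x _; rewrite lee_fin powR_ge0.
  - apply: measurable_normpow.
    exact: C0_measurable (regular_C0 t (regular_heatS C0f)).
  - exact: (measurable_fun_fubini_tonelli_F (m2 := mu) _ mPhi Phi0).
  - by move=> x _; exact: heatS_powR_le.
rewrite (@fubini_tonelli _ _ _ _ R mu mu Phi mPhi Phi0).
rewrite (eq_integral (fun z => (heat_kernel 1 z)%:E * \int[mu]_x (`|f x| `^ a)%:E)%E); last first.
  move=> z _; rewrite /Phi/=.
  rewrite ge0_integralZl; last 4 first.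
  - exact: measurableT.
  - apply: (measurableT_comp mF).
    apply: measurable_fun_rV => i; under eq_fun do rewrite /phi /= !mxE.
    by apply: measurable_funD => //; exact: measurable_coord.
  - by move=> x _; rewrite lee_fin powR_ge0.
  - by rewrite lee_fin heat_kernel_ge0.
  congr (_ * _)%E.
  rewrite [RHS](ge0_integral_affine (c *: z) ltr01 mF); last first.
    by move=> x; rewrite lee_fin powR_ge0.
  rewrite expr1n mul1e; apply: eq_integral => x _.
  by rewrite /phi /= scale1r addrC.
rewrite ge0_integralZr.
- by rewrite integral_heat_kernel mul1e.
- exact: measurableT.
- by apply/measurable_EFinP; exact: measurable_heat_kernel.
- by move=> z _; rewrite lee_fin heat_kernel_ge0.
- by apply: integral_ge0 => z _; rewrite lee_fin powR_ge0.
Qed.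

(** Jensen's inequality pointwise, then the kernel is at most [t^(-N/2)]. *)
Lemma heatS_sup_le a t f C x : 1 <= a -> 0 < t -> 0 <= C -> C0 f -> Lp_le a f C ->
  `|heatS t f x| <= t `^ (- (N%:R / 2 / a)) * C.
Proof.
move=> a1 t0 C00 C0f H; have a0 : 0 < a by rewrite (lt_le_trans _ a1).
have mF : measurable_fun setT (fun y : 'rV[R]_N => (`|f y| `^ a)%:E).
  by apply: measurable_normpow; exact: C0_measurable.
have F0 y : (0 <= (`|f y| `^ a)%:E)%E by rewrite lee_fin powR_ge0.
have B : ((`|heatS t f x| `^ a)%:E <= ((t `^ (- (N%:R / 2 / a)) * C) `^ a)%:E)%E.
  apply: le_trans (heatS_powR_le t x a1 C0f) _.
  rewrite -(ge0_integral_heat_kernel _ t0 mF F0).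
  apply: (@le_trans _ _ (\int[mu]_y ((t `^ (- (N%:R / 2)))%:E * (`|f y| `^ a)%:E))%E).
    apply: ge0_le_integral; first exact: measurableT.
    - by move=> y _; rewrite mule_ge0// lee_fin heat_kernel_ge0.
    - apply: emeasurable_funM => //; apply/measurable_EFinP.
      apply: (measurableT_comp (@measurable_heat_kernel R N t)).
      apply: measurable_fun_rV => i; under eq_fun do rewrite !mxE.
      apply: measurable_funB => //.
      exact: measurable_coord.
    - exact: measurable_funeM.
    - by move=> y _; apply: lee_wpmul2r => //; rewrite lee_fin heat_kernel_le.
  rewrite ge0_integralZl.
  - rewrite powRM ?powR_ge0// -powRrM mulNr divfK ?gt_eqF// EFinM.
    by apply: lee_wpmul2l => //; rewrite lee_fin powR_ge0.
  - exact: measurableT.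
  - exact: mF.
  - by move=> y _.
  - by rewrite lee_fin powR_ge0.
move: B; rewrite lee_fin => B.
have := @ge0_ler_powR _ a^-1 _ _ _ _ _ B.
rewrite -!powRrM mulfV ?gt_eqF// !powRr1 ?mulr_ge0 ?powR_ge0//.
by apply; rewrite ?nnegrE ?invr_ge0 ?powR_ge0 ?(ltW a0).
Qed.

(** Interpolation between the contraction in [L^a] and the bound from [L^a] to
[L^oo]. *)
Lemma Lp_le_smoothing a r t f C : 1 <= a -> a <= r -> 0 < t -> 0 <= C -> C0 f -> Lp_le a f C ->
  Lp_le r (heatS t f) (t `^ (- (N%:R / 2 / a - N%:R / 2 / r)) * C).
Proof.
move=> a1 ar t0 C00 C0f H.
have a0 : 0 < a by rewrite (lt_le_trans _ a1).
have r0 : 0 < r by rewrite (lt_le_trans _ ar).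
have K0 : 0 <= t `^ (- (N%:R / 2 / a)) * C by rewrite mulr_ge0 ?powR_ge0.
have m : measurable_fun setT (heatS t f) by exact: C0_measurable (regular_C0 t (regular_heatS C0f)).
have := Lp_le_interp a0 ar C00 K0 m (fun x => heatS_sup_le x a1 t0 C00 C0f H)
  (Lp_le_heatS t a1 C0f H).
rewrite powRM ?powR_ge0// -mulrA -powRrM.
have -> : C `^ (1 - a / r) * C `^ (a / r) = C.
  rewrite -powRD; first by rewrite subrK powRr1.
  by rewrite subrK oner_eq0.
congr (Lp_le _ _ (_ `^ _ * _)).
by field; rewrite !gt_eqF.
Qed.

End heatS_Lp.

(** * Minkowski's inequality for Duhamel integrals *)

Section duhamel_Lp.
Context (R : realType) (N : nat).
Implicit Types (g : R -> 'rV[R]_N -> R) (f : 'rV[R]_N -> R).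
Local Notation mu := (lebesgue_rV R N).
Local Notation leb := (@lebesgue_measure R).

(** Minkowski's integral inequality when the norms of the integrand are dominated
by an explicit weight [omega] of mass [W]: dividing the integrand by [omega]
gives functions of norm at most [D], Jensen's inequality for [omega] bounds
the power of the time integral by an average of powers, and Tonelli exchanges
the integrals. *)
Lemma Lp_le_duhamel kappa g t rho D alpha b W : -1 < kappa -> regular g -> 0 < t ->
  1 <= rho -> 0 <= D -> 0 < W ->
  (forall r, 0 < r < 1 -> Lp_le rho (heatS (t * (1 - r)) (g (t * r)))
    (D * ((1 - r) `^ (- alpha) * r `^ (- b)))) ->
  (\int[leb]_(r in `[0%R, 1%R]) ((1 - r) `^ (- alpha) * r `^ (- (b - kappa)))%:E <= W%:E)%E ->
  Lp_le rho (duhamel kappa g t) (t `^ (1 + kappa) * (W * D)).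
Proof.
move=> k1 gr t0 rho1 D0 W0 HD HW.
have rho0 : 0 < rho by rewrite (lt_le_trans _ rho1).
pose H (r : R) (x : 'rV[R]_N) := heatS (t * (1 - r)) (g (t * r)) x.
(* [om] is the weight and [ph] normalises: [om * ph] is [r^kappa]. *)
pose om (r : R) := (1 - r) `^ (- alpha) * r `^ (- (b - kappa)).
pose ph (r : R) := (1 - r) `^ alpha * r `^ b.
(* At the endpoints [om * ph] may vanish, so the open interval is needed. *)
pose I : set R := `]0, 1[%classic.
have mI : measurable I by exact: measurable_itv.
have om0 r : 0 <= om r by rewrite mulr_ge0 ?powR_ge0.
have ph0 r : 0 <= ph r by rewrite mulr_ge0 ?powR_ge0.
have m1 (c : R) : measurable_fun setT (fun r : R => (1 - r) `^ c).
  by apply: (measurableT_comp (measurable_powR c)); exact: measurable_funB.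
have mom : measurable_fun setT om by apply: measurable_funM; [exact: m1|exact: measurable_powR].
have mph : measurable_fun setT ph by apply: measurable_funM; [exact: m1|exact: measurable_powR].
have mH : measurable_fun setT (fun y : measurableTypeR R * 'rV[R]_N => H y.1 y.2).
  apply: continuous_measurable_R_rV => -[r x].
  apply: (@heatS_cvg _ _ _ (nbhs (r, x)) (fun y => t * (1 - y.1)) (fun y => t * y.1)
    (fun y => y.2) _ (t * (1 - r)) (t * r) x) => //.
  - exact: base_nbhs_pair.
  - apply: (@cvgMr _ _ (nbhs (r, x))); apply: (@cvgB _ _ _ (nbhs (r, x))).
      exact: cvg_cst.
    exact: cvg_fst.
  - by apply: (@cvgMr _ _ (nbhs (r, x))); exact: cvg_fst.
  - exact: cvg_snd.
have mHx x : measurable_fun setT (fun r : R => H r x).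
  exact: (measurableT_comp mH (measurable_pair2 x)).
have mHr r : measurable_fun setT (H r).
  exact: (measurableT_comp mH (measurable_pair1 r)).
pose h r x := `|H r x| * ph r.
have h0 r x : 0 <= h r x by rewrite mulr_ge0.
have mh : measurable_fun setT (fun y : measurableTypeR R * 'rV[R]_N => h y.1 y.2).
  apply: measurable_funM; first exact: measurableT_comp.
  exact: (measurableT_comp mph measurable_fst).
have mhx x : measurable_fun setT (fun r : R => h r x).
  exact: (measurableT_comp mh (measurable_pair2 x)).
have omh r x : 0 < r < 1 -> om r * h r x = `|r `^ kappa * H r x|.
  move=> /andP[r0 r1]; have r1' : 0 < 1 - r by rewrite subr_gt0.
  rewrite normrM [`|_ `^ _|]ger0_norm ?powR_ge0// /om /h /ph mulrCA mulrACA.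
  rewrite -powRD; last by apply/implyP => _; rewrite gt_eqF.
  rewrite -powRD; last by apply/implyP => _; rewrite gt_eqF.
  rewrite addNr powRr0 mul1r opprB subrK mulrC.
  by [].
have omW : (\int[leb]_(r in I) (om r)%:E <= W%:E)%E.
  apply: le_trans HW; apply: ge0_subset_integral => //.
  - by apply: measurable_funTS; exact/measurable_EFinP.
  - by move=> r _; rewrite lee_fin om0.
  - by move=> r; rewrite /I/= !in_itv/= => /andP[? ?]; rewrite !ltW.
have S1 x : `|duhamel kappa g t x| <=
    t `^ (1 + kappa) * \int[leb]_(r in I) (om r * h r x).
  rewrite /duhamel tpos_id ?(ltW t0)// normrM ger0_norm ?powR_ge0// ler_wpM2l ?powR_ge0//.
  have ik : leb.-integrable `[0, 1] (EFin \o (fun r => r `^ kappa * H r x)).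
    have [_ _ /(_ t)[C gC]] := gr.
    apply: (@integrable_weighted _ _ R lebesgue_measure _ (measurable_itv _) _
      (integrable_powR01 k1) (fun r => H r x) C).
    + exact: measurable_duhamel.
    + move=> r; rewrite /= in_itv/= => /andP[r0 r1].
      apply: heatS_le => [|z]; first exact: C0_measurable (regular_C0 _ gr).
      by apply: gC; rewrite ler_piMr// ltW.
  have L1 := @le_normr_Rintegral _ _ R leb `[0, 1]%classic _ (measurable_itv _) ik.
  apply: (le_trans L1).
  have ik1 := integrable_norm ik.
  rewrite -Rintegral_itv_obnd_cbnd; last first.
    apply: integrableS ik1 => //; apply: subset_itvr; by rewrite bnd_simp.
  rewrite -Rintegral_itv_bndo_bndc; last first.
    apply: integrableS ik1 => //; apply: subset_itv; by rewrite bnd_simp.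
  rewrite le_eqVlt; apply/orP; left; apply/eqP; apply: eq_Rintegral => r.
  by rewrite inE/= in_itv/= => /omh ->.
have S2 x : (((\int[leb]_(r in I) (om r * h r x)) `^ rho)%:E <=
    (W `^ (rho - 1))%:E * \int[leb]_(r in I) (om r * h r x `^ rho)%:E)%E.
  apply: (@jensen_powR _ _ R leb I om (h^~ x) rho W mI _ _ _ _ rho1 W0 omW).
  - by move=> r _; exact: om0.
  - exact: measurable_funTS.
  - by apply: measurable_funTS; exact: mhx.
  - by move=> r _; exact: h0.
pose Phi (y : measurableTypeR R * 'rV[R]_N) : \bar R :=
  (\1_I y.1 * (om y.1 * h y.1 y.2 `^ rho))%:E.
have mPhi : measurable_fun setT Phi.
  apply/measurable_EFinP; apply: measurable_funM.
    exact: (measurableT_comp (measurable_indic mI) measurable_fst).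
  apply: measurable_funM; first exact: (measurableT_comp mom measurable_fst).
  exact: (measurableT_comp (measurable_powR rho) mh).
have Phi0 y : (0 <= Phi y)%E by rewrite lee_fin !mulr_ge0 ?powR_ge0// indicE.
have E1 x : (\int[leb]_(r in I) (om r * h r x `^ rho)%:E = \int[leb]_r Phi (r, x))%E.
  rewrite integral_mkcond; apply: eq_integral => r _.
  by rewrite patchE /Phi/= indicE; case: ifP => _; rewrite ?mul1r ?mul0r.
have tW : 0 <= t `^ (1 + kappa) by exact: powR_ge0.
have cW0 : (0 <= ((t `^ (1 + kappa)) `^ rho * W `^ (rho - 1))%:E)%E by rewrite lee_fin mulr_ge0 ?powR_ge0.
have mG : measurable_fun setT (fun x => \int[leb]_r Phi (r, x))%E.
  exact: (measurable_fun_fubini_tonelli_G (m1 := leb) _ mPhi Phi0).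
apply: (@le_trans _ _ (\int[mu]_x (((t `^ (1 + kappa)) `^ rho * W `^ (rho - 1))%:E *
   \int[leb]_r Phi (r, x)))%E).
  apply: ge0_le_integral; first exact: measurableT.
  - by move=> x _; rewrite lee_fin powR_ge0.
  - apply: measurable_normpow; exact: C0_measurable (regular_C0 t (regular_duhamel k1 gr)).
  - exact: measurable_funeM.
  - move=> x _.
    have J0 : 0 <= \int[leb]_(r in I) (om r * h r x).
      by apply: Rintegral_ge0 => r _; rewrite mulr_ge0.
    apply: (@le_trans _ _ (((t `^ (1 + kappa)) `^ rho)%:E *
       ((\int[leb]_(r in I) (om r * h r x)) `^ rho)%:E)%E).
      rewrite -EFinM lee_fin -powRM// ge0_ler_powR ?nnegrE ?(ltW rho0) ?mulr_ge0//.
    rewrite [in leRHS]EFinM -muleA; apply: lee_wpmul2l; first by rewrite lee_fin powR_ge0.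
    by rewrite -E1; exact: S2.
rewrite ge0_integralZl; last 4 first.
- exact: measurableT.
- exact: mG.
- by move=> x _; exact: integral_ge0.
- exact: cW0.
rewrite -(@fubini_tonelli _ _ _ _ R leb mu Phi mPhi Phi0).
have S3 : (\int[leb]_r \int[mu]_x Phi (r, x) <= (W * D `^ rho)%:E)%E.
  apply: (@le_trans _ _ (\int[leb]_r ((D `^ rho)%:E * (\1_I r * om r)%:E))%E).
    apply: ge0_le_integral; first exact: measurableT.
    - by move=> r _; exact: integral_ge0.
    - exact: (measurable_fun_fubini_tonelli_F (m2 := mu) _ mPhi Phi0).
    - apply: measurable_funeM; apply/measurable_EFinP; apply: measurable_funM => //.
    - move=> r _; rewrite /Phi/=.
      rewrite indicE; case: (boolP (r \in I)) => [|rI]; last first.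
        rewrite integral0_eq; first by rewrite mul0r mule0.
        by move=> x _; rewrite mul0r.
      rewrite inE /I/= in_itv/= => r01; rewrite mul1r.
      rewrite (eq_integral (fun x => (om r * ph r `^ rho)%:E * (`|H r x| `^ rho)%:E)%E); last first.
        move=> x _; rewrite -EFinM; congr (_%:E).
        have -> : h r x `^ rho = ph r `^ rho * `|H r x| `^ rho by rewrite /h powRM// mulrC.
        by rewrite mul1r mulrA.
      rewrite ge0_integralZl; last 4 first.
      + exact: measurableT.
      + by apply: measurable_normpow; exact: mHr.
      + by move=> x _; rewrite lee_fin powR_ge0.
      + by rewrite lee_fin mulr_ge0 ?powR_ge0.
      apply: (@le_trans _ _ ((om r * ph r `^ rho)%:E *
         ((D * ((1 - r) `^ (- alpha) * r `^ (- b))) `^ rho)%:E)%E).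
        by apply: lee_wpmul2l; [rewrite lee_fin mulr_ge0 ?powR_ge0|exact: HD].
      have c0 r' : 0 <= (1 - r') `^ (- alpha) * r' `^ (- b) by rewrite mulr_ge0 ?powR_ge0.
      rewrite -!EFinM lee_fin (powRM rho D0 (c0 r)).
      have -> : om r * ph r `^ rho * (D `^ rho * ((1 - r) `^ (- alpha) * r `^ (- b)) `^ rho) =
        D `^ rho * om r * (ph r * ((1 - r) `^ (- alpha) * r `^ (- b))) `^ rho.
        by rewrite (powRM rho (ph0 r) (c0 r)) mulrACA [om r * D `^ rho]mulrC.
      have -> : ph r * ((1 - r) `^ (- alpha) * r `^ (- b)) = 1.
        move/andP : r01 => [r0 r1]; have r1' : 0 < 1 - r by rewrite subr_gt0.
        rewrite /ph mulrACA !powRN !mulfV ?mul1r// gt_eqF// powR_gt0//.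
      by rewrite powR1 mulr1.
  rewrite ge0_integralZl; last 4 first.
  - exact: measurableT.
  - by apply/measurable_EFinP; apply: measurable_funM.
  - by move=> r _; rewrite lee_fin mulr_ge0// indicE.
  - by rewrite lee_fin powR_ge0.
  rewrite mulrC EFinM; apply: lee_wpmul2l; first by rewrite lee_fin powR_ge0.
  apply: le_trans omW; rewrite le_eqVlt; apply/orP; left; apply/eqP.
  rewrite [RHS]integral_mkcond; apply: eq_integral => r _.
  by rewrite patchE indicE; case: ifP => _; rewrite ?mul1r ?mul0r.
apply: (@le_trans _ _ (((t `^ (1 + kappa)) `^ rho * W `^ (rho - 1))%:E * (W * D `^ rho)%:E)%E).
  exact: lee_wpmul2l.
rewrite -EFinM lee_fin powRM ?mulr_ge0 ?(ltW W0)// powRM ?(ltW W0)//.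
rewrite (_ : W `^ rho = W `^ (rho - 1) * W); first by rewrite !mulrA.
rewrite -[X in _ = _ * X](powRr1 (ltW W0)) -powRD ?subrK//.
by apply/implyP => _; rewrite gt_eqF.
Qed.

End duhamel_Lp.

(** * Elementary real analysis *)

Section real_lemmas.
Context (R : realType).

(** For [0 <= x <= y], Young's inequality for the product [x y^(p-1)] says that
[y^p - x^p <= p y^(p-1) (y - x)]. *)
Lemma powR_lipschitz (p K a b : R) : 1 < p -> `|a| <= K -> `|b| <= K ->
  `| `|a| `^ p - `|b| `^ p| <= p * K `^ (p - 1) * `|a - b|.
Proof.
move=> p1.
have p0 : 0 < p by lra.
have key x y : 0 <= x <= y -> y <= K -> y `^ p - x `^ p <= p * K `^ (p - 1) * (y - x).
  move=> /andP[x0 xy] yK; have y0 := le_trans x0 xy.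
  have q0 : 0 < p / (p - 1) by rewrite divr_gt0// subr_gt0.
  have pq : p^-1 + (p / (p - 1))^-1 = 1 by field; apply/andP; split; lra.
  have := conjugate_powR x0 (powR_ge0 y (p - 1)) p0 q0 pq.
  rewrite -powRrM (_ : (p - 1) * (p / (p - 1)) = p); last by field; lra.
  move=> /(ler_wpM2l (ltW p0)).
  have -> : p * (x `^ p / p + y `^ p / (p / (p - 1))) = x `^ p + (p - 1) * y `^ p.
    by field; apply/andP; split; lra.
  have yp : y `^ p = y * y `^ (p - 1).
    rewrite -{2}(powRr1 y0) -powRD; first by congr (_ `^ _); ring.
    by apply/implyP => /eqP; lra.
  have yK' : y `^ (p - 1) * (y - x) <= K `^ (p - 1) * (y - x).
    rewrite ler_wpM2r ?subr_ge0// ge0_ler_powR ?nnegrE//; [lra|exact: le_trans yK].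
  move: yK' => /(ler_wpM2l (ltW p0)) yK' Y.
  have -> : p * K `^ (p - 1) * (y - x) = p * (K `^ (p - 1) * (y - x)) by ring.
  apply: le_trans yK'.
  move: Y; rewrite yp; lra.
wlog ab : a b / `|b| <= `|a| => [H aK bK|aK bK].
  have [ab|/ltW ba] := leP `|b| `|a|; first exact: H.
  by rewrite distrC [`|a - b|]distrC; exact: H.
rewrite ger0_norm; last by rewrite subr_ge0 ge0_ler_powR ?nnegrE ?(ltW p0).
apply: le_trans (key _ _ _ aK) _; first by rewrite normr_ge0.
by rewrite ler_wpM2l ?mulr_ge0 ?powR_ge0 ?(ltW p0)// lerB_dist.
Qed.

(** The sequences [a_n - 2 C / 2^n] and [a_n + 2 C / 2^n] are monotone and
enclose the limit. *)
Lemma geometric_cauchy_limit_of (a : nat -> R) (C : R) :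
  (forall n, `|a n.+1 - a n| <= C * 2^-1 ^+ n) ->
  exists l, forall n, `|l - a n| <= 2 * C * 2^-1 ^+ n.
Proof.
move=> H.
have C0 : 0 <= C by have := H 0%N; rewrite expr0 mulr1; exact: le_trans.
have h0 n : 0 <= C * 2^-1 ^+ n by rewrite mulr_ge0// exprn_ge0.
pose b n := a n - 2 * C * 2^-1 ^+ n.
pose c n := a n + 2 * C * 2^-1 ^+ n.
have bnd n : b n <= b n.+1.
  have := H n; rewrite /b exprS ler_norml; lra.
have cnd n : c n.+1 <= c n.
  have := H n; rewrite /c exprS ler_norml; lra.
have bnd' : {homo b : n m / (n <= m)%N >-> n <= m} by exact: homo_leq le_refl le_trans bnd.
have cnd' n m : (n <= m)%N -> c m <= c n.
  elim: m => [|m IH]; first by rewrite leqn0 => /eqP ->.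
  rewrite leq_eqVlt => /predU1P[->//|/IH]; exact: le_trans.
have bc n m : b n <= c m.
  have bcn k : b k <= c k by rewrite /b /c; have := h0 k; lra.
  have [nm|/ltnW mn] := leqP n m.
    exact: le_trans (bnd' _ _ nm) (bcn m).
  exact: le_trans (bcn n) (cnd' _ _ mn).
have hs : has_sup (range b).
  by split; [exists (b 0%N), 0%N|exists (c 0%N) => _ [n _ <-]].
exists (sup (range b)) => n.
have h1 : b n <= sup (range b) by apply: sup_upper_bound => //; exists n.
have h2 : sup (range b) <= c n by apply: ge_sup; [case: hs|move=> _ [k _ <-]].
by move: h1 h2; rewrite /b /c ler_norml; lra.
Qed.

Lemma le_geometric_eq0 (x C : R) : (forall n, `|x| <= C * 2^-1 ^+ n) -> x = 0.
Proof.
move=> H; apply/eqP; rewrite -normr_le0; apply/ler_addgt0Pr => e e0; rewrite add0r.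
have cC : (fun n => C * 2^-1 ^+ n : R) @ \oo --> (C * 0 : R).
  by apply: cvgMr; apply: cvg_expr; rewrite ger0_norm//; lra.
rewrite mulr0 in cC.
have /cvgrPdist_le/(_ _ e0)[n _ /(_ n (leqnn n))] := cC.
rewrite sub0r normrN => /le_trans; have := H n; move=> h /(_ _ (lexx _)).
by move=> h'; apply: le_trans h (le_trans (ler_norm _) h').
Qed.

(** One limit serves all rates [C]: below, the rate depends on the time horizon,
the limit must not. *)
Lemma geometric_cauchy_limit (a : nat -> R) :
  (exists C, forall n, `|a n.+1 - a n| <= C * 2^-1 ^+ n) ->
  exists l, forall C, (forall n, `|a n.+1 - a n| <= C * 2^-1 ^+ n) ->
    forall n, `|l - a n| <= 2 * C * 2^-1 ^+ n.
Proof.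
move=> [C0 /geometric_cauchy_limit_of[l lP]]; exists l => C /geometric_cauchy_limit_of[l' lP'].
suff -> : l = l' by [].
apply/eqP; rewrite -subr_eq0; apply/eqP.
apply: (@le_geometric_eq0 _ (2 * C0 + 2 * C)) => n.
rewrite -(subrK (a n) l) -addrA mulrDl; apply: (le_trans (ler_normD _ _)).
by rewrite lerD// distrC.
Qed.

End real_lemmas.

(** * Convergence of the Picard iterates *)

Section picard.
Context (R : realType) (N : nat).
Variables (p q : R) (F1 F2 : R -> 'rV[R]_N -> R).
Implicit Types (g : R -> 'rV[R]_N -> R) (f : 'rV[R]_N -> R).

(** The right-hand side of a mild equation, with the contribution [F] of the data
and of the source kept apart from the Duhamel integral of the nonlinearity. *)
Definition mild_rhs (p : R) (F g : R -> 'rV[R]_N -> R) (t : R) (x : 'rV[R]_N) : R :=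
  F t x + duhamel 0 (fun s y => `|g s y| `^ p) t x.

Fixpoint picard (n : nat) : (R -> 'rV[R]_N -> R) * (R -> 'rV[R]_N -> R) :=
  if n is k.+1 then (mild_rhs p F1 (picard k).2, mild_rhs q F2 (picard k).1)
  else ((fun _ _ => 0), (fun _ _ => 0)).

Hypotheses (p1 : 1 < p) (q1 : 1 < q) (cF1 : regular F1) (cF2 : regular F2).
Hypotheses (F1_tpos : forall t, F1 (tpos t) = F1 t) (F2_tpos : forall t, F2 (tpos t) = F2 t).

Lemma regular_mild_rhs r F g : 1 < r -> regular F -> regular g -> regular (mild_rhs r F g).
Proof.
move=> r1 cF cg; apply: regularD => //; apply: regular_duhamel; first by lra.
by apply: regular_powR => //; lra.
Qed.

Lemma regular_picard n : regular (picard n).1 /\ regular (picard n).2.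
Proof.
have c0 : regular (fun (_ : R) (_ : 'rV[R]_N) => 0 : R).
  apply: regular_cst; split; first exact: cst_continuous.
  by move=> e e0; exists 0 => x _; rewrite normr0 ltW.
by elim: n => [|n [IH1 IH2]] //=; split; exact: regular_mild_rhs.
Qed.


Hypothesis bounded : forall T, exists K, forall n t x, 0 <= t <= T ->
  `|(picard n).1 t x| <= K /\ `|(picard n).2 t x| <= K.

Lemma picard_tpos n t : (picard n).1 (tpos t) = (picard n).1 t /\
  (picard n).2 (tpos t) = (picard n).2 t.
Proof.
have pp : tpos (tpos t) = tpos t by rewrite tpos_id// tpos_ge0.
have dp g : duhamel 0 g (tpos t) = duhamel 0 g t.
  by apply/funext => x; rewrite /duhamel pp.
have np r F g : F (tpos t) = F t -> mild_rhs r F g (tpos t) = mild_rhs r F g t.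
  by move=> Fp; apply/funext => x; rewrite /mild_rhs dp Fp.
case: n => [|n]; first by split.
by split; [exact: np (F1_tpos t)|exact: np (F2_tpos t)].
Qed.

Lemma mild_rhs_sub_le r K F g1 g2 t x (D lambda : R) : 1 < r -> 0 <= K ->
  regular g1 -> regular g2 -> 0 <= t ->
  0 < lambda -> 0 <= D ->
  (forall s y, 0 <= s <= t -> [/\ `|g1 s y| <= K, `|g2 s y| <= K &
    `|g1 s y - g2 s y| <= D * expR (lambda * s)]) ->
  `|mild_rhs r F g1 t x - mild_rhs r F g2 t x| <=
    (r * K `^ (r - 1)) * D / lambda * expR (lambda * t).
Proof.
move=> r1 K0 c1 c2 t0 l0 D0 H.
have -> : mild_rhs r F g1 t x - mild_rhs r F g2 t x =
   duhamel 0 (fun s y => `|g1 s y| `^ r) t x - duhamel 0 (fun s y => `|g2 s y| `^ r) t x.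
  by rewrite /mild_rhs opprD addrACA subrr add0r.
have rK : 0 <= r * K `^ (r - 1) by rewrite mulr_ge0 ?powR_ge0//; lra.
apply: duhamel_sub_le => //.
- by apply: regular_powR => //; lra.
- by apply: regular_powR => //; lra.
- by rewrite mulr_ge0.
- move=> s y /(H s y)[g1K g2K gD].
  apply: le_trans (powR_lipschitz r1 g1K g2K) _.
  by rewrite -[leRHS]mulrA ler_wpM2l.
Qed.

(** By induction the increments are at most [K 2^-n exp (lambda t)]: with [lambda]
twice the Lipschitz constants, [duhamel_sub_le] gains the factor 1/2. *)
Lemma picard_cauchy T : exists2 C, 0 <= C & forall n t x, 0 <= t <= T ->
  `|(picard n.+1).1 t x - (picard n).1 t x| <= C * 2^-1 ^+ n /\
  `|(picard n.+1).2 t x - (picard n).2 t x| <= C * 2^-1 ^+ n.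
Proof.
have [K' K'P] := bounded T.
pose K := Num.max K' 0.
have K0 : 0 <= K by rewrite le_max lexx orbT.
have KP n t x : 0 <= t <= T -> `|(picard n).1 t x| <= K /\ `|(picard n).2 t x| <= K.
  by move=> tT; have [h1 h2] := K'P n t x tT; rewrite !le_max h1 h2.
pose Lp := p * K `^ (p - 1); pose Lq := q * K `^ (q - 1).
have Lp0 : 0 <= Lp by apply: mulr_ge0; [exact: ltW (lt_trans ltr01 p1)|exact: powR_ge0].
have Lq0 : 0 <= Lq by apply: mulr_ge0; [exact: ltW (lt_trans ltr01 q1)|exact: powR_ge0].
(* the summand 1 keeps [la] positive *)
pose la := 2 * (Lp + Lq) + 1.
have la0 : 0 < la by rewrite /la; lra.
have half L : 0 <= L -> L <= Lp + Lq -> L / la <= 2^-1.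
  by move=> L0 LL; rewrite ler_pdivrMr// /la; lra.
have step L D t : 0 <= L -> L <= Lp + Lq -> 0 <= D ->
    L * D / la * expR (la * t) <= (D * 2^-1) * expR (la * t).
  move=> L0 LL D0; rewrite ler_wpM2r ?expR_ge0// mulrAC mulrC ler_wpM2l//.
  exact: half.
have main n t x : 0 <= t <= T ->
    `|(picard n.+1).1 t x - (picard n).1 t x| <= K * 2^-1 ^+ n * expR (la * t) /\
    `|(picard n.+1).2 t x - (picard n).2 t x| <= K * 2^-1 ^+ n * expR (la * t).
  elim: n t x => [|n IH] t x t0T; have /andP[t0 tT] := t0T.
    have E : K <= K * 2^-1 ^+ 0 * expR (la * t).
      rewrite expr0 mulr1 ler_peMr//.
      by rewrite -[leLHS]expR0 ler_expR mulr_ge0// ltW.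
    have [h1 h2] := KP 1%N t x t0T.
    split; [have := le_trans h1 E|have := le_trans h2 E].
      by rewrite -[X in `|X| <= _ -> _]subr0; exact.
    by rewrite -[X in `|X| <= _ -> _]subr0; exact.
  have [c1 c2] := regular_picard n; have [c1' c2'] := regular_picard n.+1.
  have D0 : 0 <= K * 2^-1 ^+ n by rewrite mulr_ge0// exprn_ge0.
  rewrite exprSr mulrA; split.
  - apply: (le_trans _ (step Lp (K * 2^-1 ^+ n) t Lp0 _ D0)); last by rewrite lerDl.
    apply: (@mild_rhs_sub_le p K F1 (picard n.+1).2 (picard n).2 t x _ la p1 K0 c2' c2 t0 la0 D0) => s y /andP[s0 st].
    have sT : 0 <= s <= T by rewrite s0 (le_trans st).
    by split; [exact: (KP n.+1 _ _ _).2|exact: (KP n _ _ _).2|exact: (IH _ _ _).2].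
  - apply: (le_trans _ (step Lq (K * 2^-1 ^+ n) t Lq0 _ D0)); last by rewrite lerDr.
    apply: (@mild_rhs_sub_le q K F2 (picard n.+1).1 (picard n).1 t x _ la q1 K0 c1' c1 t0 la0 D0) => s y /andP[s0 st].
    have sT : 0 <= s <= T by rewrite s0 (le_trans st).
    by split; [exact: (KP n.+1 _ _ _).1|exact: (KP n _ _ _).1|exact: (IH _ _ _).1].
exists (K * expR (la * T)); first by rewrite mulr_ge0 ?expR_ge0.
move=> n t x t0T; have /andP[t0 tT] := t0T; have [h1 h2] := main n t x t0T.
have E : K * 2^-1 ^+ n * expR (la * t) <= K * expR (la * T) * 2^-1 ^+ n.
  rewrite mulrAC ler_wpM2r ?exprn_ge0// ler_wpM2l// ler_expR ler_wpM2l// ltW//.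
by split; [exact: le_trans h1 E|exact: le_trans h2 E].
Qed.

(** On each [[0, T]] the iterates converge geometrically and uniformly, so that
the limit is regular and the two sides of each equation differ by a
geometrically small quantity. *)
Lemma picard_limit : exists u v : R -> 'rV[R]_N -> R, [/\ regular u, regular v,
  forall t x, 0 <= t -> u t x = mild_rhs p F1 v t x &
  forall t x, 0 <= t -> v t x = mild_rhs q F2 u t x].
Proof.
have t0P (t : R) : 0 <= tpos t <= tpos t by rewrite tpos_ge0 lexx.
have lim1 (y : R * 'rV[R]_N) : exists l, forall C, (forall n,
    `|(picard n.+1).1 (tpos y.1) y.2 - (picard n).1 (tpos y.1) y.2| <= C * 2^-1 ^+ n) ->
    forall n, `|l - (picard n).1 (tpos y.1) y.2| <= 2 * C * 2^-1 ^+ n.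
  apply: geometric_cauchy_limit; have [C _ CP] := picard_cauchy (tpos y.1).
  by exists C => n; have [] := CP n _ y.2 (t0P y.1).
have lim2 (y : R * 'rV[R]_N) : exists l, forall C, (forall n,
    `|(picard n.+1).2 (tpos y.1) y.2 - (picard n).2 (tpos y.1) y.2| <= C * 2^-1 ^+ n) ->
    forall n, `|l - (picard n).2 (tpos y.1) y.2| <= 2 * C * 2^-1 ^+ n.
  apply: geometric_cauchy_limit; have [C _ CP] := picard_cauchy (tpos y.1).
  by exists C => n; have [] := CP n _ y.2 (t0P y.1).
have [wu uP] := choice lim1; have [wv vP] := choice lim2.
pose u t x := wu (t, x); pose v t x := wv (t, x).
have unif T : exists2 C, 0 <= C & forall n t x, t <= T ->
    `|u t x - (picard n).1 t x| <= C * 2^-1 ^+ n /\ `|v t x - (picard n).2 t x| <= C * 2^-1 ^+ n.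
  have [C C0 CP] := picard_cauchy (tpos T); exists (2 * C); first by rewrite mulr_ge0.
  move=> n t x tT; have pT : 0 <= tpos t <= tpos T by rewrite tpos_ge0 le_tpos.
  have [<- <-] := picard_tpos n t; split.
    by apply: (uP (t, x) C) => k; have [] := CP k _ x pT.
  by apply: (vP (t, x) C) => k; have [] := CP k _ x pT.
have small C e : 0 < e -> exists n, C * 2^-1 ^+ n <= e :> R.
  move=> e0; apply: contrapT => H.
  have : e = 0; last by move/eqP; rewrite gt_eqF.
  apply: (@le_geometric_eq0 _ e C) => n; rewrite gtr0_norm//.
  by have [//|/ltW h] := leP e (C * 2^-1 ^+ n); case: H; exists n.
have cu : regular u.
  apply: (regular_limit (gn := fun n => (picard n).1)) => [n|T e e0]; first exact: (regular_picard n).1.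
  have [C _ CP] := unif T; have [n nP] := small C e e0; exists n => t x tT.
  exact: le_trans (CP n t x tT).1 nP.
have cv : regular v.
  apply: (regular_limit (gn := fun n => (picard n).2)) => [n|T e e0]; first exact: (regular_picard n).2.
  have [C _ CP] := unif T; have [n nP] := small C e e0; exists n => t x tT.
  exact: le_trans (CP n t x tT).2 nP.
(* the defect of the limit equation is geometrically small *)
have eqn r F g (gn : nat -> R -> 'rV[R]_N -> R) w (wn : nat -> R -> 'rV[R]_N -> R) t x :
    1 < r -> 0 <= t -> regular g -> (forall n, regular (gn n)) ->
    (forall T, exists2 C, 0 <= C & forall n t x, t <= T -> `|g t x - gn n t x| <= C * 2^-1 ^+ n) ->
    (exists C, forall n, `|w t x - wn n.+1 t x| <= C * 2^-1 ^+ n) ->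
    (forall n, wn n.+1 = mild_rhs r F (gn n)) -> w t x = mild_rhs r F g t x.
  move=> r1 t0 cg cgn gP [Cw wP] wnE; apply/eqP; rewrite -subr_eq0; apply/eqP.
  have [Cg Cg0 gP'] := gP t.
  have [_ _ /(_ t)[Kg Kg']] := cg.
  pose K := Num.max Kg 0 + Cg.
  have K0 : 0 <= K by rewrite addr_ge0// le_max lexx orbT.
  have h1 n : 0 <= (2^-1 : R) ^+ n <= 1 by rewrite exprn_ge0//= exprn_ile1//; lra.
  have gK s y : s <= t -> `|g s y| <= K.
    by move=> st; rewrite /K (le_trans (Kg' s y st))// -[leLHS]addr0 lerD// le_max lexx.
  have gnK n s y : s <= t -> `|gn n s y| <= K.
    move=> st; have := gP' n s y st; have := Kg' s y st.
    have : Kg <= Num.max Kg 0 by rewrite le_max lexx.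
    have : Cg * 2^-1 ^+ n <= Cg by rewrite ler_piMr//; case/andP: (h1 n).
    rewrite /K !ler_norml; lra.
  apply: (@le_geometric_eq0 _ _ (Cw + r * K `^ (r - 1) * Cg / 1 * expR (1 * t))) => n.
  rewrite -(subrK (wn n.+1 t x) (w t x)) -addrA mulrDl.
  apply: (le_trans (ler_normD _ _)); apply: lerD; first exact: wP.
  rewrite wnE distrC.
  have D0 : 0 <= Cg * 2^-1 ^+ n by rewrite mulr_ge0// exprn_ge0.
  apply: (le_trans (@mild_rhs_sub_le r K F g (gn n) t x (Cg * 2^-1 ^+ n) 1 r1 K0 cg (cgn n)
    t0 ltr01 D0 _)).
    move=> s y /andP[s0 st]; split; [exact: gK|exact: gnK|].
    apply: (le_trans (gP' n s y st)); rewrite ler_peMr// -[leLHS]expR0 ler_expR mul1r//.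
  by rewrite le_eqVlt; apply/orP; left; apply/eqP; ring.
have half n (C : R) : 0 <= C -> C * 2^-1 ^+ n.+1 <= C * 2^-1 ^+ n.
  by move=> C0; rewrite ler_wpM2l// exprS ler_piMl ?exprn_ge0//; lra.
exists u, v; split => // t x t0.
- apply: (eqn p F1 v (fun n => (picard n).2) u (fun n => (picard n).1)) => //.
  + by move=> n; exact: (regular_picard n).2.
  + by move=> T; have [C C0 CP] := unif T; exists C => // n s y sT; exact: (CP n s y sT).2.
  + have [C C0 CP] := unif t; exists C => n.
    exact: le_trans (CP n.+1 t x (lexx _)).1 (half n C C0).
- apply: (eqn q F2 u (fun n => (picard n).1) v (fun n => (picard n).2)) => //.
  + by move=> n; exact: (regular_picard n).1.
  + by move=> T; have [C C0 CP] := unif T; exists C => // n s y sT; exact: (CP n s y sT).1.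
  + have [C C0 CP] := unif t; exists C => n.
    exact: le_trans (CP n.+1 t x (lexx _)).2 (half n C C0).
Qed.

End picard.

(** * One Picard step in sup norm *)

Section sup_bound.
Context (R : realType) (N : nat).
Implicit Types (g F : R -> 'rV[R]_N -> R) (f : 'rV[R]_N -> R).
Local Notation leb := (@lebesgue_measure R).
Local Notation m := (N%:R / 2 : R).

(** The singular weight [(1 - r)^-la] is integrable; the constant [c0] allows a
separate bound for small times. *)
Lemma duhamel0_le g t x (c0 c1 la : R) : regular g -> 0 <= t -> 0 <= c0 -> 0 <= c1 ->
  la < 1 ->
  (forall r, 0 < r < 1 -> `|heatS (t * (1 - r)) (g (t * r)) x| <= c0 + c1 * (1 - r) `^ (- la)) ->
  `|duhamel 0 g t x| <= t * (c0 + c1 / (1 - la)).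
Proof.
move=> gr t0 c00 c10 la1 H.
have k1 : -1 < 0 :> R by lra.
rewrite /duhamel tpos_id// addr0 powRr1// normrM ger0_norm// ler_wpM2l//.
pose h (r : R) := heatS (t * (1 - r)) (g (t * r)) x.
have ik : leb.-integrable `[0, 1] (EFin \o (fun r => r `^ 0 * h r)).
  have [_ _ /(_ t)[C gC]] := gr.
  apply: (@integrable_weighted _ _ R lebesgue_measure _ (measurable_itv _) _
    (integrable_powR01 k1) h C).
  + exact: measurable_duhamel.
  + move=> r; rewrite /= in_itv/= => /andP[r0 r1].
    apply: heatS_le => [|z]; first exact: C0_measurable (regular_C0 _ gr).
    by apply: gC; rewrite ler_piMr.
have L1 := @le_normr_Rintegral _ _ R leb `[0, 1]%classic _ (measurable_itv _) ik.
apply: (le_trans L1).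
have ik1 := integrable_norm ik.
rewrite -Rintegral_itv_obnd_cbnd; last first.
  by apply: integrableS ik1 => //; apply: subset_itvr; rewrite bnd_simp.
rewrite -Rintegral_itv_bndo_bndc; last first.
  by apply: integrableS ik1 => //; apply: subset_itv; rewrite bnd_simp.
apply: ge0_Rintegral_le => [r _|]; first exact: normr_ge0.
have m1 (c : R) : measurable_fun setT (fun r : R => (1 - r) `^ c).
  by apply: (measurableT_comp (measurable_powR c)); exact: measurable_funB.
pose w (r : R) := c0 + c1 * (1 - r) `^ (- la).
have mw : measurable_fun setT w.
  by apply: measurable_funD => //; apply: measurable_funM => //; exact: m1.
have w0 r : 0 <= w r by rewrite addr_ge0// mulr_ge0 ?powR_ge0.
apply: (@le_trans _ _ (\int[leb]_(r in `]0%R, 1%R[) (w r)%:E)%E).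
  apply: ge0_le_integral; first exact: measurable_itv.
  - by move=> r _; rewrite lee_fin.
  - have ik2 : leb.-integrable `]0, 1[ (EFin \o (fun r => `|r `^ 0 * h r|)).
      by apply: integrableS ik1 => //; apply: subset_itv; rewrite bnd_simp.
    by case/integrableP : ik2.
  - by apply: measurable_funTS; exact/measurable_EFinP.
  - move=> r; rewrite /= in_itv/= => r01; rewrite lee_fin powRr0 mul1r; exact: H.
apply: (@le_trans _ _ (\int[leb]_(r in `[0%R, 1%R]) (w r)%:E)%E).
  apply: ge0_subset_integral => //.
  - by apply: measurable_funTS; exact/measurable_EFinP.
  - by move=> r _; rewrite lee_fin.
  - by apply: subset_itv; rewrite bnd_simp.
have E : (\int[leb]_(r in `[0%R, 1%R]) (w r)%:E =
   \int[leb]_(r in `[0%R, 1%R]) (c0%:E + c1%:E * ((1 - r) `^ (- la))%:E))%E.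
  by apply: eq_integral => r _; rewrite /w EFinD EFinM.
rewrite E ge0_integralD; last 5 first.
- exact: measurable_itv.
- by move=> r _; rewrite lee_fin.
- exact: measurable_cst.
- by move=> r _; rewrite mule_ge0// lee_fin ?powR_ge0.
- by apply: measurable_funTS; apply: measurable_funeM; apply/measurable_EFinP; exact: m1.
rewrite integral_cst; last exact: measurable_itv.
rewrite [X in (_ * X + _)%E](_ : _ = 1%E); last first.
  have := lebesgue_measure_itv (`[0, 1] : interval R).
  by rewrite /= lte_fin ltr01 oppr0 adde0.
rewrite mule1 EFinD; apply: leeD => //.
rewrite ge0_integralZl; last 4 first.
- exact: measurable_itv.
- by apply: measurable_funTS; apply/measurable_EFinP; exact: m1.
- by move=> r _; rewrite lee_fin powR_ge0.
- by rewrite lee_fin.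
rewrite EFinM; apply: lee_wpmul2l; first by rewrite lee_fin.
by apply: integral_onem_powR_le; lra.
Qed.

(** With [rho = p m / la], interpolate [L^rho] between the known bound in [L^r2]
and the sup bound [K]; the heat flow of [|g s|^p] then has sup norm at most
[(t - s)^-la C].  Near [s = 0] the weight [s^-beta] could add a non-integrable
singularity, so that [s <= T0] is handled by the local bound [K0]. *)
Lemma mild_rhs_sup_le (p r2 la M beta T T0 K0 D : R) : 1 < p -> 0 < la < 1 -> la <= m -> 0 < r2 ->
  r2 <= p * m / la -> 0 <= M -> 0 <= beta -> 0 < T0 -> 0 <= K0 -> 0 <= D -> 0 <= T ->
  exists E1 E2, [/\ 0 <= E1, 0 <= E2 &
  forall F g K, regular g -> 0 <= K ->
    (forall t x, 0 <= t <= T -> `|F t x| <= D) ->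
    (forall s x, 0 <= s <= T0 -> `|g s x| <= K0) ->
    (forall s, 0 < s -> Lp_le r2 (g s) (M * s `^ (- beta))) ->
    (forall s x, 0 <= s <= T -> `|g s x| <= K) ->
    forall t x, 0 <= t <= T -> `|mild_rhs p F g t x| <= E1 + E2 * K `^ (p - la * r2 / m)].
Proof.
move=> p1 /andP[la0 la1] lam r20 r2rho M0 beta0 T00 K00 D0 T_0.
have p0 : 0 < p by lra.
have m0 : 0 < m by lra.
have N0 : N%:R != 0 :> R by apply: contraTneq m0 => ->; rewrite mul0r ltxx.
pose rho := p * m / la.
have rho0 : 0 < rho by rewrite divr_gt0// mulr_gt0.
pose cM := (M * T0 `^ (- beta)) `^ (r2 / rho * p).
have cM0 : 0 <= cM by exact: powR_ge0.
exists (D + T * K0 `^ p), (T `^ (1 - la) * cM / (1 - la)); split.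
- by rewrite addr_ge0// mulr_ge0 ?powR_ge0.
- by rewrite divr_ge0 ?mulr_ge0 ?powR_ge0//; lra.
move=> F g K gr Kg0 FD gK0 gL gK t x /andP[t0 tT].
have gpr : regular (fun s y => `|g s y| `^ p) by exact: regular_powR.
have KE : (K `^ (1 - r2 / rho)) `^ p = K `^ (p - la * r2 / m).
  rewrite -powRrM; congr (_ `^ _); rewrite /rho; field.
  by rewrite N0 !gt_eqF.
pose C := K `^ (p - la * r2 / m) * cM.
have C00 : 0 <= C by rewrite mulr_ge0 ?powR_ge0.
rewrite /mild_rhs; apply: (le_trans (ler_normD _ _)).
rewrite -addrA; apply: lerD; first by apply: FD; rewrite t0.
have [->|tn0] := eqVneq t 0.
  rewrite /duhamel tpos_id// addr0 powRr1// mul0r normr0.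
  by apply: addr_ge0; rewrite !mulr_ge0 ?powR_ge0// invr_ge0 subr_ge0 ltW.
have tp : 0 < t by rewrite lt_neqAle eq_sym tn0.
have H : `|duhamel 0 (fun s y => `|g s y| `^ p) t x| <=
   t * (K0 `^ p + (t `^ (- la) * C) / (1 - la)).
  apply: duhamel0_le => //; rewrite ?powR_ge0 ?mulr_ge0 ?powR_ge0//.
  move=> r /andP[r0 r1]; have r1' : 0 < 1 - r by rewrite subr_gt0.
  have tr0 : 0 < t * r by rewrite mulr_gt0.
  have P1 : 0 <= t `^ (- la) * C * (1 - r) `^ (- la) by rewrite !mulr_ge0 ?powR_ge0.
  have mg : measurable_fun setT (g (t * r)) by exact: C0_measurable (regular_C0 _ gr).
  have mgp : measurable_fun setT (fun y => `|g (t * r) y| `^ p).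
    exact: C0_measurable (regular_C0 (t * r) gpr).
  have [trT|Ttr] := leP (t * r) T0.
    apply: (@le_trans _ _ (K0 `^ p)); last by rewrite lerDl.
    apply: heatS_le => [|y]; first exact: mgp.
    by rewrite ger0_norm ?powR_ge0// ge0_ler_powR ?nnegrE ?(ltW p0)// gK0// (ltW tr0).
  apply: (@le_trans _ _ (t `^ (- la) * C * (1 - r) `^ (- la))); last by rewrite lerDr powR_ge0.
  have Mle : M * (t * r) `^ (- beta) <= M * T0 `^ (- beta).
    rewrite ler_wpM2l// !powRN lef_pV2 ?posrE ?powR_gt0//.
    by rewrite ge0_ler_powR ?nnegrE ?(ltW T00) ?(ltW tr0) ?(ltW Ttr).
  have L1 : Lp_le r2 (g (t * r)) (M * T0 `^ (- beta)).
    apply: (Lp_le_trans (ltW r20) mg mg _ Mle _ (gL _ tr0)) => //.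
    by rewrite mulr_ge0 ?powR_ge0.
  have MT0 : 0 <= M * T0 `^ (- beta) by rewrite mulr_ge0 ?powR_ge0.
  have trT' : 0 <= t * r <= T by rewrite (ltW tr0) (le_trans _ tT)// ler_piMr// ltW.
  have L2 := Lp_le_interp r20 r2rho MT0 Kg0 mg (fun y => gK _ y trT') L1.
  have L3 := Lp_le_powR p0 (mulr_ge0 (powR_ge0 _ _) (powR_ge0 _ _)) L2.
  rewrite -/rho (powRM p (powR_ge0 K _) (powR_ge0 _ _)) KE -powRrM -/cM -/C in L3.
  have a1 : 1 <= rho / p by rewrite ler_pdivlMr// mul1r /rho ler_pdivlMr// ler_wpM2l// ltW.
  have C0g := regular_C0 (t * r) gpr.
  have t1r : 0 < t * (1 - r) by rewrite mulr_gt0.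
  apply: (le_trans (heatS_sup_le x a1 t1r C00 C0g L3)).
  rewrite (_ : m / (rho / p) = la); last by rewrite /rho; field; rewrite N0 !gt_eqF.
  by rewrite powRM ?(ltW tp) ?(ltW r1')// le_eqVlt; apply/orP; left; apply/eqP; ring.
apply: (le_trans H); rewrite mulrDr; apply: lerD.
  by rewrite ler_wpM2r ?powR_ge0.
have -> : t * (t `^ (- la) * C / (1 - la)) = t `^ (1 - la) * (C / (1 - la)).
  rewrite -{1}(powRr1 t0) !mulrA -powRD ?addr0//.
  by apply/implyP => _; rewrite gt_eqF.
have -> : T `^ (1 - la) * cM / (1 - la) * K `^ (p - la * r2 / m) = T `^ (1 - la) * (C / (1 - la)).
  by rewrite /C; ring.
rewrite ler_wpM2r ?divr_ge0//; first by lra.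
by rewrite ge0_ler_powR ?nnegrE//; lra.
Qed.

End sup_bound.

(** * A priori bounds for the Picard iterates *)

Section apriori.
Context (R : realType) (N : nat).
Implicit Types (g F : R -> 'rV[R]_N -> R) (f : 'rV[R]_N -> R).
Local Notation m := (N%:R / 2 : R).

(** A strictly larger power absorbs a constant and a multiple of a smaller power. *)
Lemma powR_absorbs_affine (E1 E2 e f : R) : 0 <= E1 -> 0 <= E2 -> 0 <= e < f ->
  exists X0, forall X, 1 <= X -> X0 <= X -> E1 + E2 * X `^ e <= X `^ f.
Proof.
move=> E10 E20 /andP[e0 ef]; have fe : 0 < f - e by rewrite subr_gt0.
exists ((E1 + E2) `^ (f - e)^-1) => X X1 XX.
have X0 : 0 < X by rewrite (lt_le_trans _ X1).
have h1 : E1 + E2 <= X `^ (f - e).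
  rewrite -[leLHS](@powRr1 _ (E1 + E2)) ?addr_ge0// -(mulVf (lt0r_neq0 fe)) powRrM.
  by rewrite ge0_ler_powR ?nnegrE ?powR_ge0 ?(ltW fe) ?(ltW X0).
have Xe : 1 <= X `^ e by rewrite -[leLHS](powRr0 X) ler_powR.
apply: (@le_trans _ _ ((E1 + E2) * X `^ e)).
  by rewrite mulrDl lerD2r ler_peMr.
have -> : X `^ f = X `^ (f - e) * X `^ e.
  by rewrite -powRD ?subrK//; apply/implyP => _; rewrite gt_eqF.
by rewrite ler_wpM2r ?powR_ge0.
Qed.

(** [la < 1] keeps the kernel singularity integrable, [p B - A < la] makes the
exponent [p - la / B] smaller than [A / B], and [la <= p B] means that the
interpolation exponent [rho] is not below [m / B]. *)
Lemma exists_interpolation_exponent (p A B : R) : 0 < p * B -> 0 < A -> p * B - A < 1 ->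
  exists la, [/\ 0 < la < 1, p * B - A < la & la <= p * B].
Proof.
move=> pB0 A0 h; pose l := Num.max 0 (p * B - A); pose u := Num.min 1 (p * B).
have l1 : 0 <= l /\ p * B - A <= l by rewrite /l !le_max !lexx orbT.
have u1 : u <= 1 /\ u <= p * B by rewrite /u !ge_min !lexx orbT.
have lu : l < u.
  rewrite /l /u gt_max !lt_min ltr01 pB0 h /=; lra.
by exists ((l + u) / 2); case: l1 u1 => ? ? [? ?]; split; lra.
Qed.

Variables (p q : R) (F1 F2 : R -> 'rV[R]_N -> R).
Hypotheses (p1 : 1 < p) (q1 : 1 < q) (cF1 : regular F1) (cF2 : regular F2).
Local Notation P := (picard p q F1 F2).

Lemma regular_pair_bounded T : exists2 D, 0 < D & forall t x, t <= T ->
  `|F1 t x| <= D /\ `|F2 t x| <= D.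
Proof.
have [_ _ /(_ T)[D1 H1]] := cF1; have [_ _ /(_ T)[D2 H2]] := cF2.
exists (Num.max (Num.max D1 D2) 1); first by rewrite !lt_max ltr01 orbT.
by move=> t x tT; rewrite !le_max H1// H2// !orbT.
Qed.

(** On a short interval the Duhamel term cannot double the size of the linear
parts. *)
Lemma picard_local_sup : exists T0 K0, [/\ 0 < T0, 0 <= K0 &
  forall n t x, 0 <= t <= T0 -> `|(P n).1 t x| <= K0 /\ `|(P n).2 t x| <= K0].
Proof.
have [D D0 FD] := regular_pair_bounded 1.
pose K0 := 2 * D.
have K00 : 0 < K0 by rewrite mulr_gt0.
pose S := K0 `^ p + K0 `^ q.
have S0 : 0 < S by rewrite addr_gt0 ?powR_gt0.
pose T0 := Num.min 1 (D / S).
have T00 : 0 < T0 by rewrite lt_min ltr01 divr_gt0.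
exists T0, K0; split => //; first exact: ltW.
have step r F g t x : 1 < r -> K0 `^ r <= S -> regular g -> (forall t x, t <= 1 -> `|F t x| <= D) ->
   (forall s x, 0 <= s <= T0 -> `|g s x| <= K0) -> 0 <= t <= T0 ->
   `|mild_rhs r F g t x| <= K0.
  move=> r1 rS cg HF Hg /andP[t0 tT].
  have t1 : t <= 1 by rewrite (le_trans tT)// ge_min lexx.
  have cgp : regular (fun s y => `|g s y| `^ r) by apply: regular_powR => //; lra.
  rewrite /mild_rhs; apply: (le_trans (ler_normD _ _)).
  have -> : K0 = D + D by rewrite /K0; ring.
  apply: lerD; first exact: HF.
  have z1 : 0 < 1 :> R by [].
  have := @duhamel0_le R N _ t x (K0 `^ r) 0 0 cgp t0 (powR_ge0 _ _) (lexx _) z1.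
  rewrite mul0r addr0 => H; apply: le_trans (H _) _.
    move=> s /andP[s0 s1]; rewrite mul0r addr0.
    apply: heatS_le => [|y]; first exact: C0_measurable (regular_C0 _ cgp).
    rewrite ger0_norm ?powR_ge0// ge0_ler_powR ?nnegrE ?(ltW K00)//; first by lra.
    by apply: Hg; rewrite mulr_ge0 ?(ltW s0)//= (le_trans _ tT)// ler_piMr// ltW.
  apply: (@le_trans _ _ (D / S * S)); last by rewrite divfK ?gt_eqF.
  by apply: ler_pM; rewrite ?powR_ge0// (le_trans tT)// ge_min lexx orbT.
have rp : K0 `^ p <= S by rewrite lerDl powR_ge0.
have rq : K0 `^ q <= S by rewrite lerDr powR_ge0.
elim=> [|n IH] t x tT; first by rewrite /= normr0 ltW.
have [c1 c2] := regular_picard p1 q1 cF1 cF2 n.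
split.
- apply: (step p F1 (P n).2 t x p1 rp c2) => //.
    by move=> s y s1; exact: (FD s y s1).1.
  by move=> s y sT; exact: (IH s y sT).2.
- apply: (step q F2 (P n).1 t x q1 rq c1) => //.
    by move=> s y s1; exact: (FD s y s1).2.
  by move=> s y sT; exact: (IH s y sT).1.
Qed.

(** The sup bounds [X^A] and [X^B] reproduce themselves for [X] large:
[mild_rhs_sup_le] turns [X^B] into [E1 + E2 X^(p B - la1)], and
[p B - la1 < A]. *)
Lemma picard_bounded (A B M b1 b2 : R) : 0 < A -> 0 < B -> 0 <= M -> 0 <= b1 -> 0 <= b2 ->
  p * B <= m -> q * A <= m -> p * B - A < 1 -> q * A - B < 1 ->
  (forall n t, 0 < t -> Lp_le (m / A) ((P n).1 t) (M * t `^ (- b1)) /\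
     Lp_le (m / B) ((P n).2 t) (M * t `^ (- b2))) ->
  forall T, exists K, forall n t x, 0 <= t <= T ->
    `|(P n).1 t x| <= K /\ `|(P n).2 t x| <= K.
Proof.
move=> A0 B0 M0 b10 b20 pBm qAm pBA qAB HL T.
have [T0 [K0 [T00 K00 loc]]] := picard_local_sup.
have [T_neg|T_0] := ltP T 0.
  exists 0 => n t x /andP[t0 tT]; have := le_lt_trans (le_trans t0 tT) T_neg.
  by rewrite ltxx.
have p0 : 0 < p by exact: lt_trans ltr01 p1.
have q0 : 0 < q by exact: lt_trans ltr01 q1.
have [D D0 FD] := regular_pair_bounded T.
have m0 : 0 < m by rewrite (lt_le_trans _ pBm)// mulr_gt0.
have [la1 [la1b la1A la1B]] := exists_interpolation_exponent (mulr_gt0 p0 B0) A0 pBA.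
have [la2 [la2b la2B la2A]] := exists_interpolation_exponent (mulr_gt0 q0 A0) B0 qAB.
have step r la C : 0 < r -> 0 < la < 1 -> 0 < C -> la <= r * C -> r * C <= m ->
    [/\ la <= m, 0 < m / C & m / C <= r * m / la].
  move=> r0 /andP[l0 _] C0 lrC rCm; split; first exact: le_trans rCm.
    by rewrite divr_gt0.
  rewrite ler_pdivrMr// mulrAC ler_pdivlMr// [leRHS]mulrAC mulrC ler_wpM2r//.
have [h1 h2 h3] := step p la1 B p0 la1b B0 la1B pBm.
have [h4 h5 h6] := step q la2 A q0 la2b A0 la2A qAm.
have [E1 [E2 [E10 E20 HE]]] := @mild_rhs_sup_le R N p (m / B) la1 M b2 T T0 K0 D p1 la1b h1 h2 h3
  M0 b20 T00 K00 (ltW D0) T_0.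
have [E3 [E4 [E30 E40 HE']]] := @mild_rhs_sup_le R N q (m / A) la2 M b1 T T0 K0 D q1 la2b h4 h5 h6
  M0 b10 T00 K00 (ltW D0) T_0.
have ex1 : 0 <= p * B - la1 < A by rewrite subr_ge0 la1B /= ltrBlDr -ltrBlDl.
have [X1 X1P] := powR_absorbs_affine E10 E20 ex1.
have ex2 : 0 <= q * A - la2 < B by rewrite subr_ge0 la2A /= ltrBlDr -ltrBlDl.
have [X2 X2P] := powR_absorbs_affine E30 E40 ex2.
pose X := Num.max 1 (Num.max X1 X2).
have X_1 : 1 <= X by rewrite le_max lexx.
have X_X1 : X1 <= X by rewrite !le_max lexx orbT.
have X_X2 : X2 <= X by rewrite !le_max lexx !orbT.
have main n t x : 0 <= t <= T -> `|(P n).1 t x| <= X `^ A /\ `|(P n).2 t x| <= X `^ B.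
  elim: n t x => [|n IH] t x tT; first by rewrite /= normr0 !powR_ge0.
  have [c1 c2] := regular_picard p1 q1 cF1 cF2 n; split.
  - apply: (le_trans (HE F1 (P n).2 (X `^ B) c2 (powR_ge0 _ _) _ _ _ _ t x tT)).
    + by move=> s y /andP[_ sT]; exact: (FD s y sT).1.
    + by move=> s y sT; exact: (loc n s y sT).2.
    + by move=> s s0; exact: (HL n s s0).2.
    + by move=> s y sT; exact: (IH s y sT).2.
    rewrite -powRrM (_ : B * _ = p * B - la1); first exact: X1P.
    by field; rewrite !gt_eqF//; move: m0; rewrite pmulr_lgt0// invr_gt0.
  - apply: (le_trans (HE' F2 (P n).1 (X `^ A) c1 (powR_ge0 _ _) _ _ _ _ t x tT)).
    + by move=> s y /andP[_ sT]; exact: (FD s y sT).2.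
    + by move=> s y sT; exact: (loc n s y sT).1.
    + by move=> s s0; exact: (HL n s s0).1.
    + by move=> s y sT; exact: (IH s y sT).1.
    rewrite -powRrM (_ : A * _ = q * A - la2); first exact: X2P.
    by field; rewrite !gt_eqF//; move: m0; rewrite pmulr_lgt0// invr_gt0.
exists (Num.max (X `^ A) (X `^ B)) => n t x tT.
by have [h7 h8] := main n t x tT; rewrite !le_max h7 h8 orbT.
Qed.

(** The bound [M] in the two weighted norms reproduces itself as soon as linear
and nonlinear contributions are small fractions of [M]. *)
Lemma picard_Lp_le (r1 r2 b1 b2 M e c1 c2 : R) : 1 <= r1 -> 1 <= r2 -> 0 <= M -> 0 <= e ->
  0 <= c1 -> 0 <= c2 ->
  (forall t, 0 < t -> Lp_le r1 (F1 t) (e * t `^ (- b1))) ->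
  (forall t, 0 < t -> Lp_le r2 (F2 t) (e * t `^ (- b2))) ->
  (forall g, regular g -> (forall s, 0 < s -> Lp_le r2 (g s) (M * s `^ (- b2))) ->
     forall t, 0 < t -> Lp_le r1 (duhamel 0 (fun s y => `|g s y| `^ p) t) (c1 * t `^ (- b1))) ->
  (forall g, regular g -> (forall s, 0 < s -> Lp_le r1 (g s) (M * s `^ (- b1))) ->
     forall t, 0 < t -> Lp_le r2 (duhamel 0 (fun s y => `|g s y| `^ q) t) (c2 * t `^ (- b2))) ->
  4 * (e + c1) <= M -> 4 * (e + c2) <= M ->
  forall n t, 0 < t -> Lp_le r1 ((P n).1 t) (M * t `^ (- b1)) /\
     Lp_le r2 ((P n).2 t) (M * t `^ (- b2)).
Proof.
move=> r11 r21 M0 e0 c10 c20 HF1 HF2 H1 H2 eM1 eM2.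
have zero r C : 1 <= r -> Lp_le r (fun _ : 'rV[R]_N => 0) C.
  move=> rr; rewrite /Lp_le integral0_eq ?lee_fin ?powR_ge0// => x _.
  by rewrite normr0 powR0// gt_eqF// (lt_le_trans _ rr).
have step r b c s F g t : 1 <= r -> 0 <= c -> 4 * (e + c) <= M -> 0 < t -> regular F ->
    regular (duhamel 0 (fun s' y => `|g s' y| `^ s)) ->
    Lp_le r (F t) (e * t `^ (- b)) ->
    Lp_le r (duhamel 0 (fun s' y => `|g s' y| `^ s) t) (c * t `^ (- b)) ->
    Lp_le r (mild_rhs s F g t) (M * t `^ (- b)).
  move=> rr c0 ecM t0 cF cd L1 L2.
  have mF := C0_measurable (regular_C0 t cF); have md := C0_measurable (regular_C0 t cd).
  have L := Lp_leD rr mF md (mulr_ge0 e0 (powR_ge0 t _)) (mulr_ge0 c0 (powR_ge0 t _)) L1 L2.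
  rewrite -mulrDl mulrA in L.
  have mn := measurable_funD mF md.
  apply: (Lp_le_trans _ mn mn _ _ _ L) => //; first by rewrite (le_trans _ rr).
    by rewrite !mulr_ge0 ?addr_ge0 ?powR_ge0.
  by rewrite ler_wpM2r ?powR_ge0.
have k0 : -1 < 0 :> R by lra.
elim=> [|n IH] t t0; first by split; exact: zero.
have [cr1 cr2] := regular_picard p1 q1 cF1 cF2 n; split.
- apply: (step _ b1 c1) => //.
  + by apply: regular_duhamel => //; apply: regular_powR => //; exact: lt_trans ltr01 p1.
  + exact: HF1.
  + by apply: (H1 _ cr2 _ _ t0) => s s0; exact: (IH s s0).2.
- apply: (step _ b2 c2) => //.
  + by apply: regular_duhamel => //; apply: regular_powR => //; exact: lt_trans ltr01 q1.
  + exact: HF2.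
  + by apply: (H2 _ cr1 _ _ t0) => s s0; exact: (IH s s0).1.
Qed.

End apriori.

(** * Scaling of Duhamel integrals *)

Section duhamel_step.
Context (R : realType) (N : nat).
Local Notation m := (N%:R / 2 : R).

(** Smoothing from [L^a] to [L^r] costs [(t - s)^-al]; on the unit interval this
leaves a Beta integral, and the power of [t] comes out by homogeneity. *)
Lemma Lp_le_duhamel_scaling (kappa a b r : R) : -1 < kappa -> 1 <= a -> a <= r ->
  m / a - m / r < 1 -> 0 <= b - kappa < 1 ->
  exists2 W, 0 < W & forall (g : R -> 'rV[R]_N -> R) M, regular g -> 0 <= M ->
    (forall s, 0 < s -> Lp_le a (g s) (M * s `^ (- b))) ->
    forall t, 0 < t -> Lp_le r (duhamel kappa g t)
      (W * M * t `^ (1 + kappa - (m / a - m / r) - b)).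
Proof.
move=> k1 a1 ar al1 bk; have a0 : 0 < a by lra.
have r0 : 0 < r by lra.
pose al := m / a - m / r.
have al0 : 0 <= al < 1.
  rewrite al1 andbT subr_ge0 ler_wpM2l ?divr_ge0// lef_pV2 ?posrE//.
have [W [W0 HW]] := beta_weight al0 bk; exists W; first exact: W0.
move=> g M cg M0 H t t0.
have r1 : 1 <= r by rewrite (le_trans a1).
have D0 : 0 <= M * t `^ (- al - b) by rewrite mulr_ge0 ?powR_ge0.
have L := @Lp_le_duhamel R N kappa g t r (M * t `^ (- al - b)) al b W k1 cg t0 r1 D0 W0 _ HW.
have E : t `^ (1 + kappa) * (W * (M * t `^ (- al - b))) = W * M * t `^ (1 + kappa - al - b).
  rewrite mulrCA [t `^ _ * _]mulrCA -powRD; last by apply/implyP => _; rewrite gt_eqF.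
  by rewrite mulrA; congr (_ * _ `^ _); ring.
rewrite -E; apply: L => s /andP[s0 s1].
have s1' : 0 < 1 - s by rewrite subr_gt0.
have ts : 0 < t * s by rewrite mulr_gt0.
have ts1 : 0 < t * (1 - s) by rewrite mulr_gt0.
have := Lp_le_smoothing a1 ar ts1 (mulr_ge0 M0 (powR_ge0 _ _)) (regular_C0 _ cg) (H _ ts).
rewrite -/al (_ : _ * (M * _) = M * t `^ (- al - b) * ((1 - s) `^ (- al) * s `^ (- b)))//.
rewrite (powRM (- al) (ltW t0) (ltW s1')) (powRM (- b) (ltW t0) (ltW s0)).
rewrite powRD; last by apply/implyP => _; rewrite gt_eqF.
set x1 := t `^ _; set x2 := t `^ _; set y1 := _ `^ _; set y2 := s `^ _.
by ring.
Qed.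

End duhamel_step.

(** * The linear and the nonlinear parts in weighted norms *)

Section Lp_constants.
Context (R : realType) (N : nat).
Local Notation m := (N%:R / 2 : R).

Lemma ler_wpdivl_half (x y : R) : 0 < m -> 0 < x -> x <= y -> m / y <= m / x.
Proof.
move=> m0 x0 xy; have y0 := lt_le_trans x0 xy.
by rewrite ler_wpM2l ?(ltW m0)// lef_pV2 ?posrE.
Qed.

(** The choice of [b] balances both terms: the data have scaling exponent [a], the
source gains [1 + sigma] from the time integral, and [b < - sigma] keeps its
kernel singularity integrable. *)
Lemma Lp_le_linear_part (sigma a b : R) : -1 < sigma < 0 -> 0 <= b < - sigma -> b < a ->
  1 + sigma + a <= m ->
  exists2 W, 0 < W & forall (u0 w : 'rV[R]_N -> R) e, C0 u0 -> C0 w -> 0 <= e ->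
    Lp_le (m / a) u0 e -> Lp_le (m / (1 + sigma + a)) w e ->
    forall t, 0 < t -> Lp_le (m / (a - b))
      (fun x => heatS t u0 x + duhamel sigma (fun=> w) t x) (W * e * t `^ (- b)).
Proof.
move=> /andP[s1 s0] /andP[b0 bs] ba am.
have a0 : 0 < a by lra.
have ab0 : 0 < a - b by lra.
have sa0 : 0 < 1 + sigma + a by lra.
have m0 : 0 < m by rewrite (lt_le_trans _ am).
have mn : m != 0 by rewrite gt_eqF.
have h1 : 1 <= m / a by rewrite ler_pdivlMr// mul1r; lra.
have h2 : m / a <= m / (a - b) by apply: ler_wpdivl_half => //; lra.
have h3 : 1 <= m / (1 + sigma + a) by rewrite ler_pdivlMr// mul1r.
have h4 : m / (1 + sigma + a) <= m / (a - b) by apply: ler_wpdivl_half => //; lra.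
have e1 : m / (m / (1 + sigma + a)) - m / (m / (a - b)) = 1 + sigma + b.
  by rewrite !(divKf mn); ring.
have h5 : m / (m / (1 + sigma + a)) - m / (m / (a - b)) < 1 by rewrite e1; lra.
have h6 : 0 <= 0 - sigma < 1 by apply/andP; split; lra.
have [W W0 HW] := Lp_le_duhamel_scaling s1 h3 h4 h5 h6.
exists (4 * (1 + W)); first by rewrite mulr_gt0// addr_gt0.
move=> u0 w e C0u C0w e0 Lu Lw t t0.
have L1 := Lp_le_smoothing h1 h2 t0 e0 C0u Lu.
rewrite !(divKf mn) (_ : - (a - (a - b)) = - b) in L1; last by ring.
have L2 : Lp_le (m / (a - b)) (duhamel sigma (fun=> w) t) (W * e * t `^ (- b)).
  have := HW (fun=> w) e (regular_cst C0w) e0 _ t t0.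
  rewrite e1 (_ : 1 + sigma - (1 + sigma + b) - 0 = - b); last by ring.
  by apply=> s s0'; rewrite oppr0 powRr0 mulr1.
have mu1 := C0_measurable (regular_C0 t (regular_heatS C0u)).
have mu2 := C0_measurable (regular_C0 t (regular_duhamel s1 (regular_cst C0w))).
have We : 0 <= W * e * t `^ (- b) by rewrite !mulr_ge0 ?powR_ge0 ?(ltW W0).
have te : 0 <= t `^ (- b) * e by rewrite mulr_ge0 ?powR_ge0.
have := Lp_leD (le_trans h1 h2) mu1 mu2 te We L1 L2.
congr (Lp_le _ _ _).
set x := t `^ _; ring.
Qed.

(** If [g s] has norm at most [M s^-b2] in [L^(m/B)], then [|g s|^p] has norm at
most [M^p s^(- p b2)] in [L^(m/(p B))], which the heat flow maps to [L^(m/A)]. *)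
Lemma Lp_le_duhamel_powR (p A B b1 b2 : R) : 1 < p -> 0 < A -> 0 < B -> p * B <= m -> A <= p * B ->
  p * B - A < 1 -> 0 <= p * b2 < 1 -> 1 - (p * B - A) - p * b2 = - b1 ->
  exists2 W, 0 < W & forall (g : R -> 'rV[R]_N -> R) M, regular g -> 0 <= M ->
    (forall s, 0 < s -> Lp_le (m / B) (g s) (M * s `^ (- b2))) ->
    forall t, 0 < t -> Lp_le (m / A) (duhamel 0 (fun s y => `|g s y| `^ p) t)
       (W * M `^ p * t `^ (- b1)).
Proof.
move=> p1 A0 B0 pBm ApB pBA pb2 E.
have p0 : 0 < p by lra.
have pB0 : 0 < p * B by rewrite mulr_gt0.
have m0 : 0 < m by rewrite (lt_le_trans _ pBm).
have mn : m != 0 by rewrite gt_eqF.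
have k1 : -1 < 0 :> R by lra.
have h1 : 1 <= m / (p * B) by rewrite ler_pdivlMr// mul1r.
have h2 : m / (p * B) <= m / A by exact: ler_wpdivl_half.
have h3 : m / (m / (p * B)) - m / (m / A) < 1 by rewrite !(divKf mn).
have h4 : 0 <= p * b2 - 0 < 1 by rewrite subr0.
have [W W0 HW] := Lp_le_duhamel_scaling k1 h1 h2 h3 h4; exists W; first exact: W0.
move=> g M cg M0 HM t t0.
have cgp : regular (fun s y => `|g s y| `^ p) by exact: regular_powR.
have := HW _ (M `^ p) cgp (powR_ge0 _ _) _ t t0.
rewrite !(divKf mn) addr0 E; apply => s s0.
have L := Lp_le_powR p0 (mulr_ge0 M0 (powR_ge0 s (- b2))) (HM s s0).
have Em : m / B / p = m / (p * B) by rewrite [in RHS]invfM mulrA mulrAC.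
have Ep : (M * s `^ (- b2)) `^ p = M `^ p * s `^ (- (p * b2)).
  by rewrite (powRM p M0 (powR_ge0 s _)) -powRrM mulNr [b2 * p]mulrC.
rewrite Em Ep in L; exact: L.
Qed.

Lemma superlinear_small (p c : R) : 1 < p -> 0 < c ->
  exists2 d, 0 < d & forall M, 0 < M -> M <= d -> c * M `^ p <= M / 8.
Proof.
move=> p1 c0; have p10 : 0 < p - 1 by rewrite subr_gt0.
exists ((8 * c)^-1 `^ (p - 1)^-1); first by apply: powR_gt0; rewrite invr_gt0 mulr_gt0.
move=> M M0 Md.
have h : M `^ (p - 1) <= (8 * c)^-1.
  have -> : (8 * c)^-1 = ((8 * c)^-1 `^ (p - 1)^-1) `^ (p - 1).
    rewrite -powRrM mulVf ?gt_eqF// powRr1// invr_ge0.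
    by apply: mulr_ge0 => //; exact: ltW.
  by rewrite ge0_ler_powR ?nnegrE ?powR_ge0 ?(ltW p10) ?(ltW M0).
have -> : M `^ p = M `^ (p - 1) * M.
  rewrite -{3}(powRr1 (ltW M0)) -powRD ?subrK//.
  by apply/implyP => _; rewrite gt_eqF.
rewrite mulrA [leRHS]mulrC ler_wpM2r ?(ltW M0)//.
apply: (@le_trans _ _ (c * (8 * c)^-1)); first by rewrite ler_wpM2l ?(ltW c0).
by rewrite invfM mulrCA mulfV ?mulr1// gt_eqF.
Qed.

Lemma Lp_le_Lnorm d (f : 'rV[R]_N -> R) e : 0 < d -> 0 <= e ->
  ('N[lebesgue_rV R N]_(d%:E)[EFin \o f] <= e%:E)%E -> Lp_le d f e.
Proof.
move=> d0 e0 H; rewrite /Lp_le.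
have -> : (\int[lebesgue_rV R N]_x (`|f x| `^ d)%:E =
    'N[lebesgue_rV R N]_(d%:E)[EFin \o f] `^ d)%E.
  by rewrite poweR_Lnorm ?gt_eqF//; apply: eq_integral => x _; rewrite /= poweR_EFin.
rewrite -poweR_EFin; apply: gt0_ler_poweR => //; first exact: ltW.
- by rewrite in_itv/= Lnorm_ge0 leey.
- by rewrite in_itv/= lee_fin e0 leey.
Qed.

End Lp_constants.

(** * From fixed points to global mild solutions *)

Section mild.
Context (R : realType) (N : nat).

Definition linear_part (sigma : R) (u0 w : 'rV[R]_N -> R) (t : R) (x : 'rV[R]_N) : R :=
  heatS t u0 x + duhamel sigma (fun=> w) t x.

Lemma regular_linear_part sigma u0 w : -1 < sigma -> C0 u0 -> C0 w -> regular (linear_part sigma u0 w).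
Proof.
move=> s1 C0u C0w; apply: regularD; first exact: regular_heatS.
by apply: regular_duhamel => //; exact: regular_cst.
Qed.

(** The square root of a negative time is 0, as for the time 0. *)
Lemma linear_part_tpos sigma u0 w t : linear_part sigma u0 w (tpos t) = linear_part sigma u0 w t.
Proof.
have sp : Num.sqrt (tpos t) = Num.sqrt t.
  rewrite /tpos; case: (leP t 0) => // t0; by rewrite sqrtr0 ler0_sqrtr.
have pp : tpos (tpos t) = tpos t by rewrite tpos_id// tpos_ge0.
by apply/funext => x; rewrite /linear_part /heatS /duhamel sp pp.
Qed.

Lemma mild_equationP (p sigma : R) (u0 w : 'rV[R]_N -> R) u v t : 1 < p -> -1 < sigma ->
  C0 u0 -> C0 w -> regular v -> 0 <= t ->
  (forall x, u t x = mild_rhs p (linear_part sigma u0 w) v t x) ->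
  mild_equation p sigma u0 w u v t.
Proof.
move=> p1 s1 C0u C0w cv t0 uE x; rewrite uE /mild_rhs /linear_part.
have cvp : regular (fun s y => `|v s y| `^ p) by apply: regular_powR => //; lra.
have k1 : -1 < 0 :> R by lra.
have mu := C0_measurable C0u.
rewrite -(mild_integralE x s1 (regular_cst C0w) t0) -(mild_integralE x k1 cvp t0).
rewrite (heat_semigroupE x t0 mu) addrAC; congr (_ + _ + _).
by apply: eq_Rintegral => s _; rewrite powRr0 mul1r.
Qed.

(** A global solution restricts to every [[0, tau]]. *)
Lemma Tmax_global (p q sigma gamma : R) (u0 v0 w1 w2 : 'rV[R]_N -> R) u v :
  mild_solution p q sigma gamma u0 v0 w1 w2 `[0, +oo[ u v ->
  (forall I, C0_path I u) -> (forall I, C0_path I v) ->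
  Tmax p q sigma gamma u0 v0 w1 w2 = +oo%E.
Proof.
move=> [_ _ H] pu pv; apply: hasNub_ereal_sup; last first.
  exists 1; split => //; exists u, v; split => // t.
  by rewrite /= in_itv/= => /andP[t0 _]; apply: H; rewrite /= in_itv/= t0.
move=> [M MP]; pose T := Num.max M 0 + 1.
have T0 : 0 < T by rewrite ltr_wpDl// le_max lexx orbT.
have /MP : [set tau : R | 0 < tau /\ exists u v,
    mild_solution p q sigma gamma u0 v0 w1 w2 `[0, tau] u v] T.
  split => //; exists u, v; split => // t.
  by rewrite /= in_itv/= => /andP[t0 _]; apply: H; rewrite /= in_itv/= t0.
have : M <= Num.max M 0 by rewrite le_max lexx.
by rewrite /T; lra.
Qed.

End mild.

(** The theorem in terms of the scaling exponents [a] and [b] and of the decay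
rates [b1] and [b2]: collect the constants of the linear and nonlinear
estimates, take [M] so small that the nonlinear part uses an eighth of it, and
then data so small that the linear part does too. *)
Lemma global_mild_solution (R : realType) (N : nat) (sigma gamma p q a b b1 b2 : R) :
  -1 < sigma < 0 -> -1 < gamma < 0 -> 1 < p -> 1 < q ->
  p * b = a + 1 -> q * a = b + 1 ->
  1 + sigma + a <= N%:R / 2 -> 1 + gamma + b <= N%:R / 2 ->
  0 <= b1 < - sigma -> 0 <= b2 < - gamma -> b1 < a -> b2 < b ->
  - sigma <= p * b2 < 1 -> - gamma <= q * b1 < 1 ->
  exists2 eps : R, 0 < eps & forall u0 v0 w1 w2 : 'rV[R]_N -> R,
    C0 u0 -> C0 v0 -> C0 w1 -> C0 w2 ->
    Lp_le (N%:R / 2 / a) u0 eps -> Lp_le (N%:R / 2 / b) v0 eps ->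
    Lp_le (N%:R / 2 / (1 + sigma + a)) w1 eps ->
    Lp_le (N%:R / 2 / (1 + gamma + b)) w2 eps ->
    exists u v, [/\ regular u, regular v,
      forall t x, 0 <= t -> u t x = mild_rhs p (linear_part sigma u0 w1) v t x &
      forall t x, 0 <= t -> v t x = mild_rhs q (linear_part gamma v0 w2) u t x].
Proof.
move=> s01 g01 p1 q1 pb qa am bm b1s b2g b1a b2b pb2 qb1.
have [A0 B0] : 0 < a - b1 /\ 0 < b - b2 by split; lra.
pose A := a - b1; pose B := b - b2.
have pBE : p * B = a + 1 - p * b2 by rewrite /B mulrBr pb.
have qAE : q * A = b + 1 - q * b1 by rewrite /A mulrBr qa.
have pBm : p * B <= N%:R / 2 by rewrite pBE; lra.
have qAm : q * A <= N%:R / 2 by rewrite qAE; lra.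
have pBA : p * B - A < 1 by rewrite pBE /A; lra.
have qAB : q * A - B < 1 by rewrite qAE /B; lra.
have ApB : A <= p * B by rewrite pBE /A; lra.
have BqA : B <= q * A by rewrite qAE /B; lra.
have pb2' : 0 <= p * b2 < 1 by lra.
have qb1' : 0 <= q * b1 < 1 by lra.
have E1 : 1 - (p * B - A) - p * b2 = - b1 by rewrite pBE /A; lra.
have E2 : 1 - (q * A - B) - q * b1 = - b2 by rewrite qAE /B; lra.
have [W1 W10 HW1] := @Lp_le_linear_part R N sigma a b1 s01 b1s b1a am.
have [W2 W20 HW2] := @Lp_le_linear_part R N gamma b b2 g01 b2g b2b bm.
have [W3 W30 HW3] := @Lp_le_duhamel_powR R N p A B b1 b2 p1 A0 B0 pBm ApB pBA pb2' E1.
have [W4 W40 HW4] := @Lp_le_duhamel_powR R N q B A b2 b1 q1 B0 A0 qAm BqA qAB qb1' E2.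
have [d1 d10 Hd1] := superlinear_small p1 W30.
have [d2 d20 Hd2] := superlinear_small q1 W40.
pose M := Num.min d1 d2.
have M0 : 0 < M by rewrite lt_min d10 d20.
have hp : W3 * M `^ p <= M / 8 by apply: Hd1 => //; rewrite ge_min lexx.
have hq : W4 * M `^ q <= M / 8 by apply: Hd2 => //; rewrite ge_min lexx orbT.
(* [W1 * eps] and [W2 * eps] are then at most [M / 8] *)
pose eps := M / 8 / (W1 + W2).
have W120 : 0 < W1 + W2 by rewrite addr_gt0.
have eps0 : 0 < eps by rewrite !divr_gt0.
have We : (W1 + W2) * eps = M / 8 by rewrite /eps mulrCA mulfV ?mulr1// gt_eqF.
exists eps => // u0 v0 w1 w2 Cu Cv Cw1 Cw2 Lu Lv Lw1 Lw2.
have /andP[s1 s0] := s01; have /andP[g1 g0] := g01.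
have cF1 := regular_linear_part s1 Cu Cw1; have cF2 := regular_linear_part g1 Cv Cw2.
have m0 : 0 < N%:R / 2 :> R by lra.
have widen r W F b' t : 1 <= r -> 0 <= W <= W1 + W2 -> regular F -> 0 < t ->
    Lp_le r (F t) (W * eps * t `^ (- b')) -> Lp_le r (F t : 'rV[R]_N -> R) (M / 8 * t `^ (- b')).
  move=> r1 /andP[W0 WW] cF t0 L; have mF := C0_measurable (regular_C0 t cF).
  apply: (Lp_le_trans _ mF mF _ _ _ L) => //; first by rewrite (le_trans _ r1).
    by apply: mulr_ge0; [apply: mulr_ge0 => //; exact: ltW|exact: powR_ge0].
  by rewrite -We ler_wpM2r ?powR_ge0// ler_wpM2r ?(ltW eps0).
have r1 : 1 <= N%:R / 2 / A by rewrite ler_pdivlMr// mul1r /A; lra.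
have r2 : 1 <= N%:R / 2 / B by rewrite ler_pdivlMr// mul1r /B; lra.
have M80 : 0 <= M / 8 by rewrite divr_ge0// ltW.
have Mle : 4 * (M / 8 + M / 8) <= M by lra.
have HL := @picard_Lp_le R N p q _ _ p1 q1 cF1 cF2 (N%:R / 2 / A) (N%:R / 2 / B) b1 b2 M
  (M / 8) (W3 * M `^ p) (W4 * M `^ q) r1 r2 (ltW M0) M80.
have bnd := @picard_bounded R N p q _ _ p1 q1 cF1 cF2 A B M b1 b2 A0 B0 (ltW M0) _ _
  pBm qAm pBA qAB (HL _ _ _ _ _ _ _ _).
apply: (picard_limit p1 q1 cF1 cF2 (linear_part_tpos _ _ _) (linear_part_tpos _ _ _)).
apply: bnd.
- by case/andP : b1s.
- by case/andP : b2g.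
- by rewrite mulr_ge0 ?powR_ge0 ?(ltW W30).
- by rewrite mulr_ge0 ?powR_ge0 ?(ltW W40).
- move=> t t0; apply: (widen _ W1) => //; first by rewrite (ltW W10) lerDl ltW.
  exact: (HW1 _ _ _ Cu Cw1 (ltW eps0) Lu Lw1).
- move=> t t0; apply: (widen _ W2) => //; first by rewrite (ltW W20) lerDr ltW.
  exact: (HW2 _ _ _ Cv Cw2 (ltW eps0) Lv Lw2).
- by move=> g cg Hg; exact: (HW3 g M cg (ltW M0) Hg).
- by move=> g cg Hg; exact: (HW4 g M cg (ltW M0) Hg).
- by apply: le_trans Mle; rewrite ler_wpM2l// lerD2l.
- by apply: le_trans Mle; rewrite ler_wpM2l// lerD2l.
Qed.

(** Place [q b] in the middle of the interval from [y] to the minimum of [q x] and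
1. *)
Lemma exists_decay_exponent (R : realType) (q x y a : R) : 1 < q -> 0 < y < 1 -> y < q * x ->
  1 < q * a -> exists b, [/\ 0 <= b < x, b < a & y <= q * b < 1].
Proof.
move=> q1 /andP[y0 y1] yqx qa1; have q0 : 0 < q by lra.
pose c := Num.min (q * x) 1.
have yc : y < c by rewrite lt_min yqx y1.
have [cx c1] : c <= q * x /\ c <= 1 by rewrite /c !ge_min !lexx orbT.
pose z := (y + c) / 2.
have zE : q * (z / q) = z by rewrite mulrCA mulfV ?mulr1// gt_eqF.
exists (z / q); rewrite zE; split.
- apply/andP; split; first by rewrite divr_ge0 ?(ltW q0)// /z; lra.
  by rewrite ltr_pdivrMr// mulrC /z; lra.
- by rewrite ltr_pdivrMr// mulrC /z; lra.
- by apply/andP; split; rewrite /z; lra.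
Qed.

Theorem theorem1p5 (R : realType) (N : nat) (sigma gamma p q : R)
    (d1 d2 k1 k2 : R) :
  (1 <= N)%N ->
  -1 < sigma < 0 ->
  -1 < gamma < 0 ->
  Num.max (sigma / gamma) 1 < p ->
  Num.max (gamma / sigma) 1 < q ->
  Num.max (((sigma + 1) * (p * q - 1) + p + 1) / (p * q - 1))
          (((gamma + 1) * (p * q - 1) + q + 1) / (p * q - 1)) <= N%:R / 2 ->
  d1 = N%:R * (p * q - 1) / (2 * (p + 1)) ->
  d2 = N%:R * (p * q - 1) / (2 * (q + 1)) ->
  k1 = N%:R * (p * q - 1) / (2 * ((p * q - 1) * (1 + sigma) + p + 1)) ->
  k2 = N%:R * (p * q - 1) / (2 * ((p * q - 1) * (1 + gamma) + q + 1)) ->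
  exists eps : R, 0 < eps /\
    forall u0 v0 w1 w2 : 'rV[R]_N -> R,
      C0 u0 -> u0 \in Lfun (lebesgue_rV R N) d1%:E ->
      C0 v0 -> v0 \in Lfun (lebesgue_rV R N) d2%:E ->
      C0 w1 -> w1 \in Lfun (lebesgue_rV R N) k1%:E ->
      C0 w2 -> w2 \in Lfun (lebesgue_rV R N) k2%:E ->
      ('N[lebesgue_rV R N]_(d1%:E)[EFin \o u0]
       + 'N[lebesgue_rV R N]_(d2%:E)[EFin \o v0]
       + 'N[lebesgue_rV R N]_(k1%:E)[EFin \o w1]
       + 'N[lebesgue_rV R N]_(k2%:E)[EFin \o w2] <= eps%:E)%E ->
      Tmax p q sigma gamma u0 v0 w1 w2 = +oo%E /\
      exists u v : R -> 'rV[R]_N -> R,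
        mild_solution p q sigma gamma u0 v0 w1 w2 `[0, +oo[ u v.
Proof.
move=> N1 s01 g01 pmax qmax Nmax -> -> -> ->.
have /andP[s1 s0] := s01; have /andP[g1 g0] := g01.
have [ps p1] : sigma / gamma < p /\ 1 < p by move: pmax; rewrite gt_max => /andP.
have [qs q1] : gamma / sigma < q /\ 1 < q by move: qmax; rewrite gt_max => /andP.
have [N_1 N_2] : ((sigma + 1) * (p * q - 1) + p + 1) / (p * q - 1) <= N%:R / 2 /\
  ((gamma + 1) * (p * q - 1) + q + 1) / (p * q - 1) <= N%:R / 2.
  by move: Nmax; rewrite ge_max => /andP.
have p0 : 0 < p by lra.
have q0 : 0 < q by lra.
have pq0 : 0 < p * q - 1 by nra.
have pqn : p * q - 1 != 0 by rewrite gt_eqF.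
have NR : 0 < N%:R :> R by rewrite ltr0n.
have NRn : N%:R != 0 :> R by rewrite gt_eqF.
pose a := (p + 1) / (p * q - 1); pose b := (q + 1) / (p * q - 1).
have a0 : 0 < a by rewrite divr_gt0//; lra.
have b0 : 0 < b by rewrite divr_gt0//; lra.
have pb : p * b = a + 1 by rewrite /a /b; field.
have qa : q * a = b + 1 by rewrite /a /b; field.
have am : 1 + sigma + a <= N%:R / 2.
  by apply: le_trans N_1; rewrite le_eqVlt; apply/orP; left; apply/eqP; rewrite /a; field.
have bm : 1 + gamma + b <= N%:R / 2.
  by apply: le_trans N_2; rewrite le_eqVlt; apply/orP; left; apply/eqP; rewrite /b; field.
have gq : - gamma < q * - sigma by move: qs; rewrite ltr_ndivrMr// mulrN ltrN2.
have sp : - sigma < p * - gamma by move: ps; rewrite ltr_ndivrMr// mulrN ltrN2.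
have [b1 [h1 h2 h3]] : exists b1, [/\ 0 <= b1 < - sigma, b1 < a & - gamma <= q * b1 < 1].
  by apply: exists_decay_exponent => //; [lra|rewrite qa; lra].
have [b2 [h4 h5 h6]] : exists b2, [/\ 0 <= b2 < - gamma, b2 < b & - sigma <= p * b2 < 1].
  by apply: exists_decay_exponent => //; [lra|rewrite pb; lra].
have [eps eps0 H] := global_mild_solution s01 g01 p1 q1 pb qa am bm h1 h4 h2 h5 h6 h3.
exists eps; split => // u0 v0 w1 w2 Cu _ Cv _ Cw1 _ Cw2 _ Hn.
have d1E : N%:R * (p * q - 1) / (2 * (p + 1)) = N%:R / 2 / a by rewrite /a; field; lra.
have d2E : N%:R * (p * q - 1) / (2 * (q + 1)) = N%:R / 2 / b by rewrite /b; field; lra.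
have k1E : N%:R * (p * q - 1) / (2 * ((p * q - 1) * (1 + sigma) + p + 1)) =
    N%:R / 2 / (1 + sigma + a).
  have s10 : 0 < 1 + sigma by lra.
  have p10 : 0 < p + 1 by lra.
  have K : 0 < (1 + sigma) * (p * q - 1) + (p + 1) by rewrite addr_gt0// mulr_gt0.
  by rewrite /a; field; rewrite pqn gt_eqF.
have k2E : N%:R * (p * q - 1) / (2 * ((p * q - 1) * (1 + gamma) + q + 1)) =
    N%:R / 2 / (1 + gamma + b).
  have g10 : 0 < 1 + gamma by lra.
  have q10 : 0 < q + 1 by lra.
  have K : 0 < (1 + gamma) * (p * q - 1) + (q + 1) by rewrite addr_gt0// mulr_gt0.
  by rewrite /b; field; rewrite pqn gt_eqF.
rewrite d1E d2E k1E k2E in Hn.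
set n1 := ('N[_]_(_)[EFin \o u0])%E in Hn; set n2 := ('N[_]_(_)[EFin \o v0])%E in Hn.
set n3 := ('N[_]_(_)[EFin \o w1])%E in Hn; set n4 := ('N[_]_(_)[EFin \o w2])%E in Hn.
have n10 : (0 <= n1)%E by exact: Lnorm_ge0.
have n20 : (0 <= n2)%E by exact: Lnorm_ge0.
have n30 : (0 <= n3)%E by exact: Lnorm_ge0.
have n40 : (0 <= n4)%E by exact: Lnorm_ge0.
have m0 : 0 < N%:R / 2 :> R by rewrite divr_gt0.
have sa0 : 0 < 1 + sigma + a by lra.
have gb0 : 0 < 1 + gamma + b by lra.
have L1 : Lp_le (N%:R / 2 / a) u0 eps.
  apply: Lp_le_Lnorm; [exact: divr_gt0|exact: ltW|apply: le_trans Hn].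
  by rewrite -2!addeA leeDl// !adde_ge0.
have L2 : Lp_le (N%:R / 2 / b) v0 eps.
  apply: Lp_le_Lnorm; [exact: divr_gt0|exact: ltW|apply: le_trans Hn].
  by rewrite [(n1 + n2)%E]addeC -2!addeA leeDl// !adde_ge0.
have L3 : Lp_le (N%:R / 2 / (1 + sigma + a)) w1 eps.
  apply: Lp_le_Lnorm; [exact: divr_gt0|exact: ltW|apply: le_trans Hn].
  by rewrite [(n1 + n2 + n3)%E]addeC -addeA leeDl// !adde_ge0.
have L4 : Lp_le (N%:R / 2 / (1 + gamma + b)) w2 eps.
  apply: Lp_le_Lnorm; [exact: divr_gt0|exact: ltW|apply: le_trans Hn].
  by rewrite addeC leeDl// !adde_ge0.
have [u [v [cu cv uE vE]]] := H u0 v0 w1 w2 Cu Cv Cw1 Cw2 L1 L2 L3 L4.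
have ms : mild_solution p q sigma gamma u0 v0 w1 w2 `[0, +oo[ u v.
  split; [exact: regular_C0_path|exact: regular_C0_path|].
  move=> t; rewrite /= in_itv/= andbT => t0; split.
    by apply: mild_equationP => // x; exact: uE.
  by apply: mild_equationP => // x; exact: vE.
split; last by exists u, v.
by apply: (Tmax_global ms) => I; exact: regular_C0_path.
Qed.
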